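(* Let $X$ be any localized Hardy space $H^p(D,J)$, where $J\subset\mathbb{T}$ is a closed arc and $0<p<\infty$, or any denumerable intersection of such spaces (with varying $p$ and $J$). Then the set of totally unbounded functions in $X$ is a $G_\delta$ and dense subset of $X$. Furthermore, the set of non-extendable functions in $X$ is also a $G_\delta$ and dense subset of $X$.
   Context: $D$ is the open unit disc in $\mathbb{C}$ and $\mathbb{T}=\partial D$. A closed arc is a set $J=\{e^{i\theta}:\alpha\le\theta\le\beta\}$ with $\alpha<\beta\le\alpha+2\pi$. For $0<p<\infty$, $H^p(D,J)$ is the space of holomorphic functions $f$ on $D$ such that $\sup_{0\le r<1}\int_\alpha^\beta|f(re^{i\theta})|^p\,d\theta<\infty$. Put $d_{1,p,J}(f,g)=\sup_{0\le r<1}\big(\int_\alpha^\beta|f(re^{i\theta})-g(re^{i\theta})|^p\,d\theta\big)^{1/p}$ if $1\le p<\infty$, $d_{1,p,J}(f,g)=\sup_{0\le r<1}\int_\alpha^\beta|f(re^{i\theta})-g(re^{i\theta})|^p\,d\theta$ if $0<p<1$, and $d_{m,p,J}(f,g)=\sup_{|z|\le1-\frac1m}|f(z)-g(z)|$ for $m=2,3,\dots$. The space $H^p(D,J)$ is endowed with the metric $$d_{p,J}(f,g)=\sum_{m=1}^\infty\frac1{2^m}\frac{d_{m,p,J}(f,g)}{1+d_{m,p,J}(f,g)}.$$ A denumerable intersection $\bigcap_{n}H^{p_n}(D,J_n)$ is endowed with the metric $\sum_{n}\frac1{2^n}\frac{d_{p_n,J_n}(f,g)}{1+d_{p_n,J_n}(f,g)}$,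 so that convergence in it means convergence in each $H^{p_n}(D,J_n)$. A function $g:D\to\mathbb{C}$ is called totally unbounded (on $D$) if for every open disc $B(\zeta,\varepsilon)$ with $\varepsilon>0$ and $\zeta\in\partial D$ and every connected component $Y$ of $B(\zeta,\varepsilon)\cap D$ the restriction $g|_Y$ is unbounded. A holomorphic function $f$ on $D$ is called extendable if there exist a domain (nonempty connected open set) $U\subset\mathbb{C}$ with $\partial D\cap U\neq\emptyset$ and a holomorphic function $F$ on $U$ such that $f|_Y=F|_Y$ for some connected component $Y$ of $U\cap D$. Otherwise $f$ is called non-extendable. *)

(* Defs.v *)
From Stdlib Require Import Reals.
From Coquelicot Require Import Coquelicot.

Open Scope R_scope.

(** * The disc, domains and components *)

Definition disc (c : C) (e : R) : C -> Prop := fun z => Cmod (z - c)%C < e.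

Definition unit_disc : C -> Prop := fun z => Cmod z < 1.

Definition unit_circle : C -> Prop := fun z => Cmod z = 1.

Definition set_inter (A B : C -> Prop) : C -> Prop := fun z => A z /\ B z.

Definition connected (S : C -> Prop) : Prop :=
  forall U V : C -> Prop,
    open U -> open V ->
    (forall z, S z -> U z \/ V z) ->
    (exists z, S z /\ U z) ->
    (exists z, S z /\ V z) ->
    exists z, S z /\ U z /\ V z.

(** Connected components are the maximal nonempty connected subsets. *)
Definition component (S Y : C -> Prop) : Prop :=
  (exists z, Y z) /\
  (forall z, Y z -> S z) /\
  connected Y /\
  (forall Z : C -> Prop,
      connected Z -> (forall z, Y z -> Z z) -> (forall z, Z z -> S z) ->
      forall z, Z z -> Y z).

Definition domain (U : C -> Prop) : Prop :=
  open U /\ (exists z, U z) /\ connected U.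

(** A function on a set [S] is a total function of which only the values on
    [S] matter.  The distances below are thus pseudometrics on the spaces of
    total functions considered: two members are at distance 0 when they agree
    on the unit disc.  [ex_derive] is here complex differentiability. *)
Definition holomorphic_on (S : C -> Prop) (f : C -> C) : Prop :=
  forall z : C, S z -> ex_derive f z.

(** * Localized Hardy spaces *)

(** The arc of all [e^{it}] with [arc_lo <= t <= arc_hi]. *)
Record closed_arc := ClosedArc {
  arc_lo : R;
  arc_hi : R;
  arc_lt : arc_lo < arc_hi;
  arc_le : arc_hi <= arc_lo + 2 * PI
}.

(** [x ^ p] for [0 <= x] and [0 < p]; [Rpower] is not suitable because
    [Rpower 0 p = 1]. *)
Definition rpow (x p : R) : R := if Rlt_dec 0 x then Rpower x p else 0.

Definition polar (r t : R) : C := (r * cos t, r * sin t).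

Definition sup_over {T : Type} (P : T -> Prop) (h : T -> R) : Rbar :=
  Lub_Rbar (fun y => exists x, P x /\ y = h x).

Definition radius (r : R) : Prop := 0 <= r < 1.

Definition arc_integral (p : R) (J : closed_arc) (f : C -> C) (r : R) : R :=
  RInt (fun t => rpow (Cmod (f (polar r t))) p) (arc_lo J) (arc_hi J).

Definition Hp (p : R) (J : closed_arc) (f : C -> C) : Prop :=
  holomorphic_on unit_disc f /\
  Rbar_lt (sup_over radius (arc_integral p J f)) p_infty.

Definition fun_sub (f g : C -> C) : C -> C := fun z => (f z - g z)%C.

(** The suprema are finite for [f] and [g] in [Hp p J], so that the coercion
    [real] from [Rbar] loses nothing. *)
Definition dist_arc (p : R) (J : closed_arc) (f g : C -> C) : R :=
  if Rle_dec 1 p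
  then real (sup_over radius
               (fun r => rpow (arc_integral p J (fun_sub f g) r) (1 / p)))
  else real (sup_over radius (arc_integral p J (fun_sub f g))).

Definition dist_disc (m : nat) (f g : C -> C) : R :=
  real (sup_over (fun z : C => Cmod z <= 1 - 1 / INR m)
                 (fun z => Cmod (f z - g z)%C)).

Definition dist_m (m : nat) (p : R) (J : closed_arc) (f g : C -> C) : R :=
  if Nat.eqb m 1 then dist_arc p J f g else dist_disc m f g.

(** The sum over [m >= 1] of [1/2^m * d m / (1 + d m)]. *)
Definition sum_dist (d : nat -> R) : R :=
  Series (fun k => let m := S k in 1 / 2 ^ m * (d m / (1 + d m))).

Definition dist_Hp (p : R) (J : closed_arc) (f g : C -> C) : R :=
  sum_dist (fun m => dist_m m p J f g).

(** Sequences are indexed by [n >= 1]: the value at 0 is not used. *)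
Definition Hp_inter (p : nat -> R) (J : nat -> closed_arc) (f : C -> C) : Prop :=
  forall n : nat, (1 <= n)%nat -> Hp (p n) (J n) f.

Definition dist_Hp_inter (p : nat -> R) (J : nat -> closed_arc)
    (f g : C -> C) : R :=
  sum_dist (fun n => dist_Hp (p n) (J n) f g).

(** [hardy_type_space X d]: [X], with the metric [d], is a localized Hardy
    space or a denumerable intersection of such spaces. *)
Inductive hardy_type_space :
    ((C -> C) -> Prop) -> ((C -> C) -> (C -> C) -> R) -> Prop :=
| hardy_single (p : R) (J : closed_arc) :
    0 < p -> hardy_type_space (Hp p J) (dist_Hp p J)
| hardy_inter (p : nat -> R) (J : nat -> closed_arc) :
    (forall n : nat, (1 <= n)%nat -> 0 < p n) ->
    hardy_type_space (Hp_inter p J) (dist_Hp_inter p J).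

(** * Topology of a set [X] with the distance [d] *)

Definition open_in {T : Type} (X : T -> Prop) (d : T -> T -> R)
    (O : T -> Prop) : Prop :=
  forall f, X f -> O f ->
    exists e : R, 0 < e /\ forall g, X g -> d f g < e -> O g.

(** The trace of [A] on [X] is a countable intersection of open subsets. *)
Definition Gdelta_in {T : Type} (X : T -> Prop) (d : T -> T -> R)
    (A : T -> Prop) : Prop :=
  exists O : nat -> T -> Prop,
    (forall n, open_in X d (O n)) /\
    (forall f, X f -> (A f <-> forall n, O n f)).

Definition dense_in {T : Type} (X : T -> Prop) (d : T -> T -> R)
    (A : T -> Prop) : Prop :=
  forall f, X f -> forall e : R, 0 < e ->
    exists g, X g /\ A g /\ d f g < e.

(** * Totally unbounded and non-extendable functions *)

Definition bounded_on (Y : C -> Prop) (g : C -> C) : Prop :=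
  exists M : R, forall z, Y z -> Cmod (g z) <= M.

Definition totally_unbounded (g : C -> C) : Prop :=
  forall (zeta : C) (e : R), unit_circle zeta -> 0 < e ->
    forall Y : C -> Prop,
      component (set_inter (disc zeta e) unit_disc) Y -> ~ bounded_on Y g.

Definition extendable (f : C -> C) : Prop :=
  exists (U : C -> Prop) (F : C -> C),
    domain U /\
    (exists z, unit_circle z /\ U z) /\
    holomorphic_on U F /\
    exists Y : C -> Prop,
      component (set_inter U unit_disc) Y /\
      (forall z, Y z -> f z = F z).

Definition non_extendable (f : C -> C) : Prop :=
  holomorphic_on unit_disc f /\ ~ extendable f.

(* Main.v *)
Require Import Defs.
From Stdlib Require Import Reals Lra Lia Classical ClassicalEpsilon Cantor.
From Coquelicot Require Import Coquelicot.
(* Imported again because Stdlib's Reals shadows [disc]. *)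
Require Import Defs.

(** Convergence in the metric implies locally uniform convergence, so everything
    reduces to conditions on countably many discs centred on the circle.

    Density: the lacunary series h(z) = sum z^(3^k)/(k+1) is in every H^p, as the
    Riesz products prod (1 + 2 b_k^2 + b_k cos(3^k t + phi)), with
    b_k = r^(3^k)/(k+1), bound the exponential moments of its real and imaginary
    parts; it is unbounded along every radius ending at a root of unity of order
    3^K since sum 1/(k+1) diverges. If f + c h and f + c' h are both bounded on a
    disc, then so is h; hence f + c h is totally unbounded for all but countably
    many c.

    G_delta: a holomorphic f extends over a boundary point if and only if, for some
    disc of the countable family, of centre a and radius R > 1 - |a|, the Taylor
    coefficients c_k of f at a satisfy |c_k| R^k <= M for all k. Each of these
    inequalities is a closed condition because c_k is an integral over a circle
    inside the unit disc. This uses Taylor's theorem for functions that are only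
    assumed complex differentiable, i.e. Goursat's theorem, which is proved for
    the loops w + s (r e^(it) + v), 0 <= s <= 1. *)

Open Scope R_scope.

(** * Complex topology and boundary discs *)

(** The weights 1/(k+1) are chosen between two series: they are square summable, which keeps the
    means of the Riesz products bounded, but not summable, which makes h unbounded. Exponential
    moments dominate every power, so one h lies in every H^p over every arc, and the same
    perturbation f + c h works in a single space and in an intersection. The ratio 3 of the
    exponents keeps all frequencies of a partial product below half of the next one, so that the
    mean of the product is the product of the means. Extendability asks for an unknown F, which is
    no closed condition by itself. The coefficients c_k remove F: they are numbers computed from f
    on a compact circle in the unit disc, and the inequalities on them rebuild F as a power series
    whose disc sticks out of the unit disc. The loops of Goursat's theorem depend on a rectangle of
    parameters, so that bisection takes place in two real intervals. With v = 0 they compare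
    concentric circles, which makes c_k independent of the radius; with v = a - w they shrink a
    circle about a to the point w, which gives Cauchy's formula. *)

(** Balls of the uniform structure of [C] are squares, those of [Cmod] are round; the factor sqrt 2
    passes from one to the other. *)
Lemma locally_Cmod (z : C) (P : C -> Prop) :
  locally z P <-> exists e, 0 < e /\ forall w, Cmod (w - z)%C < e -> P w.
Proof.
  split.
  - intros [e He]. exists e. split; [apply cond_pos|].
    intros w Hw. apply He. apply C_NormedModule_mixin_compat1. exact Hw.
  - intros [e [e0 He]].
    assert (Hs : 0 < sqrt 2) by (apply sqrt_lt_R0; lra).
    assert (H2 : 0 < e / sqrt 2) by (apply Rdiv_lt_0_compat; lra).
    exists (mkposreal _ H2). intros w Hw. apply He.
    apply C_NormedModule_mixin_compat2 in Hw. simpl in Hw.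
    replace e with (sqrt 2 * (e / sqrt 2)) by (field; lra). exact Hw.
Qed.

Lemma open_Cmod (U : C -> Prop) :
  open U <->
  forall z, U z -> exists e, 0 < e /\ forall w, Cmod (w - z)%C < e -> U w.
Proof.
  split; intros H z Hz.
  - apply locally_Cmod. now apply H.
  - apply locally_Cmod. now apply H.
Qed.

(** Complex differentiability is stated with the uniform structure of [C] as an absolute ring, which
    [locally_C] exchanges for the product structure. Later arguments about derivatives mostly go
    through this epsilon-delta form. *)
Lemma ex_derive_Cmod (f : C -> C) (z : C) :
  ex_derive f z <->
  exists l : C, forall e, 0 < e -> exists d, 0 < d /\
    forall w, Cmod (w - z)%C < d ->
      Cmod (f w - f z - l * (w - z))%C <= e * Cmod (w - z)%C.
Proof.
  split.
  - intros [l [_ H]]. exists l. intros e He.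
    specialize (H z (fun P HP => HP) (mkposreal e He)).
    apply (proj2 (locally_C _ _)) in H. apply locally_Cmod in H.
    destruct H as [d [Hd H]].
    exists d. split; auto. intros w Hw. specialize (H w Hw).
    rewrite Cmult_comm. exact H.
  - intros [l H]. exists l. split.
    + apply is_linear_scal_l.
    + intros x Hx.
      (* The differential must be dominated at every limit point of the filter; the only such point
         is [z]. *)
      assert (E : z = x).
      { apply (@is_filter_lim_locally_unique C_AbsRing
                 (AbsRing_NormedModule C_AbsRing)). exact Hx. }
      subst x.
      intros [e He]. destruct (H e He) as [d [Hd H']].
      apply locally_C, locally_Cmod. exists d. split; auto.
      intros w Hw. specialize (H' w Hw). rewrite Cmult_comm in H'. exact H'.
Qed.

Lemma Cmod_minus_sym (a b : C) : Cmod (a - b)%C = Cmod (b - a)%C.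
Proof. rewrite <- Cmod_opp. f_equal. ring. Qed.

Lemma Cmod_triangle_minus (a b c : C) :
  Cmod (a - c)%C <= Cmod (a - b)%C + Cmod (b - c)%C.
Proof.
  replace (a - c)%C with ((a - b) + (b - c))%C by ring. apply Cmod_triangle.
Qed.

Lemma Cmod_minus_ge (a b : C) : Cmod a - Cmod b <= Cmod (a - b)%C.
Proof.
  generalize (Cmod_triangle (a - b) b). replace (a - b + b)%C with a by ring. lra.
Qed.

Lemma ex_derive_continuous_Cmod (f : C -> C) (z : C) :
  ex_derive f z ->
  forall e, 0 < e -> exists d, 0 < d /\
    forall w, Cmod (w - z)%C < d -> Cmod (f w - f z)%C < e.
Proof.
  intros H e He. apply ex_derive_Cmod in H. destruct H as [l H].
  destruct (H 1 Rlt_0_1) as [d [Hd H']].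
  assert (Hl := Cmod_ge_0 l).
  exists (Rmin d (e / (Cmod l + 1))). split.
  - apply Rmin_pos; auto. apply Rdiv_lt_0_compat; lra.
  - intros w Hw.
    assert (H1 := Rlt_le_trans _ _ _ Hw (Rmin_l _ _)).
    assert (H2 := Rlt_le_trans _ _ _ Hw (Rmin_r _ _)).
    specialize (H' w H1).
    replace (f w - f z)%C with ((f w - f z - l * (w - z)) + l * (w - z))%C by ring.
    eapply Rle_lt_trans; [apply Cmod_triangle|]. rewrite Cmod_mult.
    apply (Rmult_lt_compat_l (Cmod l + 1)) in H2; [|lra].
    replace ((Cmod l + 1) * (e / (Cmod l + 1))) with e in H2 by (field; lra).
    lra.
Qed.

Lemma open_disc (c : C) (e : R) : open (disc c e).
Proof.
  apply open_Cmod. intros z Hz. unfold disc in *.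
  exists (e - Cmod (z - c)%C). split; [lra|].
  intros w Hw. generalize (Cmod_triangle_minus w z c). lra.
Qed.

Lemma disc_center (c : C) (e : R) : 0 < e -> disc c e c.
Proof.
  intros H. unfold disc. replace (c - c)%C with (RtoC 0) by ring.
  now rewrite Cmod_0.
Qed.

Lemma unit_disc_disc (z : C) : unit_disc z <-> disc 0 1 z.
Proof. unfold unit_disc, disc. replace (z - 0)%C with z by ring. tauto. Qed.

(** * Convexity, connectedness and components *)

Definition convex (S : C -> Prop) : Prop :=
  forall (z w : C) (t : R), S z -> S w -> 0 <= t <= 1 ->
    S (z + t * (w - z))%C.

Lemma convex_disc (c : C) (e : R) : convex (disc c e).
Proof.
  intros z w t Hz Hw Ht. unfold disc in *.
  replace (z + t * (w - z) - c)%C with ((1 - t) * (z - c) + t * (w - c))%C by ring.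
  eapply Rle_lt_trans; [apply Cmod_triangle|].
  rewrite !Cmod_mult, <- RtoC_minus, !Cmod_R, (Rabs_pos_eq t), (Rabs_pos_eq (1 - t)) by lra.
  destruct (Req_dec t 0) as [->|H0]; [lra|].
  assert (t * Cmod (w - c)%C < t * e) by (apply Rmult_lt_compat_l; lra).
  assert ((1 - t) * Cmod (z - c)%C <= (1 - t) * e) by (apply Rmult_le_compat_l; lra).
  lra.
Qed.

Lemma convex_unit_disc : convex unit_disc.
Proof.
  intros z w t Hz Hw Ht. apply unit_disc_disc.
  apply convex_disc; auto; apply (proj1 (unit_disc_disc _)); auto.
Qed.

Lemma convex_inter (A B : C -> Prop) :
  convex A -> convex B -> convex (set_inter A B).
Proof. intros HA HB z w t [] [] Ht. split; [apply HA | apply HB]; auto. Qed.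

Lemma open_set_inter (A B : C -> Prop) :
  open A -> open B -> open (set_inter A B).
Proof. intros HA HB. now apply open_and. Qed.

Lemma open_unit_disc : open unit_disc.
Proof.
  apply (open_ext (disc 0 1)).
  - intros z. symmetry. apply unit_disc_disc.
  - apply open_disc.
Qed.

(* The supremum of the [t] such that [z + t(w - z)] lies in [U] for all smaller
   parameters belongs to neither of two disjoint open sets covering the segment. *)
Lemma convex_connected (S : C -> Prop) : convex S -> connected S.
Proof.
  intros HS U V HU HV Hcov [z [Sz Uz]] [w [Sw Vw]].
  destruct (classic (exists y, S y /\ U y /\ V y)) as [H|Hno]; [exact H|exfalso].
  set (g := fun t : R => (z + t * (w - z))%C).
  assert (Hg : forall t u, Cmod (g t - g u)%C = Rabs (t - u) * Cmod (w - z)%C).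
  { intros t u. unfold g.
    replace (z + t * (w - z) - (z + u * (w - z)))%C with ((t - u) * (w - z))%C by ring.
    now rewrite Cmod_mult, <- RtoC_minus, Cmod_R. }
  assert (Hopen : forall W, open W -> forall t, W (g t) ->
      exists d, 0 < d /\ forall u, Rabs (u - t) < d -> W (g u)).
  { intros W HW t Wt. destruct (proj1 (open_Cmod W) HW (g t) Wt) as [e [He H]].
    assert (Hm := Cmod_ge_0 (w - z)%C).
    exists (e / (Cmod (w - z)%C + 1)). split; [apply Rdiv_lt_0_compat; lra|].
    intros u Hu. apply H. rewrite Hg.
    apply (Rmult_lt_compat_r (Cmod (w - z)%C + 1)) in Hu; [|lra].
    replace (e / (Cmod (w - z)%C + 1) * (Cmod (w - z)%C + 1)) with e in Hu by (field; lra).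
    generalize (Rabs_pos (u - t)). lra. }
  assert (HSg : forall t, 0 <= t <= 1 -> S (g t)) by (intros; apply HS; auto).
  set (E := fun t => 0 <= t <= 1 /\ forall u, 0 <= u <= t -> U (g u)).
  assert (E0 : E 0).
  { split; [lra|]. intros u Hu. replace u with 0 by lra. unfold g.
    now replace (z + 0 * (w - z))%C with z by ring. }
  destruct (completeness E) as [m [Hub Hlub]].
  { exists 1. intros t [Ht _]. lra. }
  { now exists 0. }
  assert (Hm0 : 0 <= m) by (apply Hub; exact E0).
  assert (Hm1 : m <= 1) by (apply Hlub; intros t [Ht _]; lra).
  assert (Hlt : forall u, 0 <= u < m -> U (g u)).
  { intros u Hu. apply NNPP. intro Hn.
    assert (is_upper_bound E u).
    { intros t [Ht Ht']. apply Rnot_lt_le. intro. apply Hn, Ht'. lra. }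
    apply Hlub in H. lra. }
  destruct (Hcov (g m)) as [Um|Vm]; [apply HSg; lra| |].
  - destruct (Hopen U HU m Um) as [d [Hd H]].
    destruct (Req_dec m 1) as [->|Hm].
    + apply Hno. exists w. unfold g in Um.
      replace (z + 1 * (w - z))%C with w in Um by ring. auto.
    + set (m' := Rmin 1 (m + d / 2)).
      assert (m < m' <= 1 /\ m' <= m + d / 2).
      { unfold m', Rmin. destruct (Rle_dec 1 (m + d / 2)); lra. }
      assert (E m').
      { split; [lra|]. intros u Hu. destruct (Rlt_dec u m); [apply Hlt; lra|].
        apply H. rewrite Rabs_pos_eq; lra. }
      apply Hub in H1. lra.
  - destruct (Hopen V HV m Vm) as [d [Hd H]].
    destruct (Req_dec m 0) as [->|Hm].
    + apply Hno. exists (g 0). repeat split; auto.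
      apply E0; lra.
    + set (m' := Rmax 0 (m - d / 2)).
      assert (0 <= m' < m /\ m - d / 2 <= m').
      { unfold m', Rmax. destruct (Rle_dec 0 (m - d / 2)); lra. }
      apply Hno. exists (g m'). repeat split.
      * apply HSg; lra.
      * apply Hlt; lra.
      * apply H. rewrite Rabs_left; lra.
Qed.

(** A convex set is connected, hence contained in its component by maximality. Since a disc meets
    the unit disc in a convex set, the quantifier over components in [totally_unbounded] reduces to
    that set. *)
Lemma component_convex (S Y : C -> Prop) :
  convex S -> component S Y -> forall z, S z -> Y z.
Proof.
  intros HS [_ [HYS [_ HYm]]]. apply HYm; auto. now apply convex_connected.
Qed.

Lemma convex_component (S : C -> Prop) :
  convex S -> (exists z, S z) -> component S S.
Proof.
  intros HS Hne. repeat split; auto. now apply convex_connected.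
Qed.

Lemma connected_union (A B : C -> Prop) (y : C) :
  connected A -> connected B -> A y -> B y ->
  connected (fun z => A z \/ B z).
Proof.
  intros HA HB Ay By U V HU HV Hcov [u [Su Uu]] [v [Sv Vv]].
  (* The common point [y] lies in one open set, called [W1]. Whichever of [A] and [B] meets [W2]
     then meets both sets. The roles of [U] and [V] are exchanged afterwards. *)
  assert (Key : forall W1 W2 : C -> Prop, open W1 -> open W2 ->
    (forall z, A z \/ B z -> W1 z \/ W2 z) -> W1 y ->
    (exists v, (A v \/ B v) /\ W2 v) ->
    exists z, (A z \/ B z) /\ W1 z /\ W2 z).
  { intros W1 W2 H1 H2 Hc Wy [x [[Ax|Bx] Wx]].
    - destruct (HA W1 W2) as [z Hz]; eauto. exists z; tauto.
    - destruct (HB W1 W2) as [z Hz]; eauto. exists z; tauto. }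
  destruct (Hcov y (or_introl Ay)) as [Uy|Vy].
  - apply Key; eauto.
  - destruct (Key V U) as [z Hz]; eauto.
    + intros z Hz. apply or_comm. auto.
    + exists z; tauto.
Qed.

Lemma component_absorbs_disc (S Y : C -> Prop) (c y : C) (e : R) :
  component S Y -> (forall z, disc c e z -> S z) -> disc c e y -> Y y ->
  forall z, disc c e z -> Y z.
Proof.
  intros [_ [HYS [HYc HYm]]] HcS Hy HYy z Hz.
  apply (HYm (fun z => Y z \/ disc c e z)); auto.
  - apply connected_union with y; auto. apply convex_connected, convex_disc.
  - intros x [Hx|Hx]; auto.
Qed.

(** A limit point of [Y] in [U] outside [Y] can only be on the circle: inside the unit disc a small
    disc around it would be absorbed by [Y], and outside the closed disc it is not a limit point. If
    there were no such point, [Y] would be both open and relatively closed in the connected set [U],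
    which also contains a circle point, not in [Y]. *)
Lemma component_reaches_circle (U Y : C -> Prop) :
  domain U -> (exists z, unit_circle z /\ U z) ->
  component (set_inter U unit_disc) Y ->
  exists z, unit_circle z /\ U z /\
    forall e, 0 < e -> exists y, disc z e y /\ Y y.
Proof.
  intros [HUo [_ HUc]] [z0 [Hz0 Uz0]] HY.
  assert (HY' := HY). destruct HY' as [[y0 Yy0] [HYS _]].
  assert (HSo : open (set_inter U unit_disc)).
  { apply open_set_inter; auto. apply open_unit_disc. }
  assert (HYo : open Y).
  { apply open_Cmod. intros y Hy.
    destruct (proj1 (open_Cmod _) HSo y (HYS y Hy)) as [e [He H]].
    exists e. split; auto. intros w Hw.
    apply (component_absorbs_disc _ Y y y e HY); auto. now apply disc_center. }
  destruct (classic (exists z, U z /\ ~ Y z /\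
    forall e, 0 < e -> exists y, disc z e y /\ Y y)) as [[z [Uz [Yz Hz]]]|Hno].
  - exists z. split; [|now split].
    unfold unit_circle. destruct (Rtotal_order (Cmod z) 1) as [H|[H|H]]; auto; exfalso.
    + destruct (proj1 (open_Cmod _) HSo z (conj Uz H)) as [e [He H']].
      destruct (Hz e He) as [y [Hy Yy]]. apply Yz.
      apply (component_absorbs_disc _ Y z y e HY); auto. now apply disc_center.
    + destruct (Hz (Cmod z - 1)) as [y [Hy Yy]]; [lra|].
      destruct (HYS y Yy) as [_ Hd]. unfold unit_disc, disc in *.
      rewrite Cmod_minus_sym in Hy. generalize (Cmod_minus_ge z y). lra.
  - exfalso.
    (* [V] is the exterior of [Y]; in the present case [Y] and [V] are disjoint open sets covering
       [U]. *)
    set (V := fun z => exists e, 0 < e /\ forall y, disc z e y -> ~ Y y).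
    assert (HV : open V).
    { apply open_Cmod. intros z [e [He H]]. exists (e / 2). split; [lra|].
      intros w Hw. exists (e / 2). split; [lra|]. intros y Hy. apply H.
      unfold disc in *. generalize (Cmod_triangle_minus y w z). lra. }
    assert (HcV : forall z, U z -> Y z \/ V z).
    { intros z Uz. destruct (classic (Y z)) as [|Yz]; auto. right.
      apply NNPP. intro HnV. apply Hno. exists z. repeat split; auto.
      intros e He. apply NNPP. intro Hn. apply HnV. exists e. split; auto.
      intros y Hy Yy. apply Hn. now exists y. }
    destruct (HUc Y V HYo HV HcV) as [z [_ [Yz [e [He H]]]]].
    + exists y0. split; auto. now apply HYS.
    + exists z0. split; auto. destruct (HcV z0 Uz0) as [Yz|]; auto.
      apply HYS in Yz. destruct Yz as [_ Hd]. unfold unit_disc, unit_circle in *. lra.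
    + apply (H z); auto. now apply disc_center.
Qed.

Lemma circle_disc_meets (zeta : C) (e : R) :
  unit_circle zeta -> 0 < e -> exists z, set_inter (disc zeta e) unit_disc z.
Proof.
  intros Hz He. set (t := Rmin (1 / 2) (e / 2)).
  assert (0 < t <= 1 / 2 /\ t < e).
  { unfold t, Rmin. destruct (Rle_dec (1 / 2) (e / 2)); lra. }
  unfold unit_circle in Hz.
  exists ((1 - t)%R * zeta)%C. split; unfold disc, unit_disc.
  - rewrite RtoC_minus.
    replace ((1 - t) * zeta - zeta)%C with (- (t * zeta))%C by ring.
    rewrite Cmod_opp, Cmod_mult, Cmod_R, Hz, Rabs_pos_eq; lra.
  - rewrite Cmod_mult, Cmod_R, Hz, Rabs_pos_eq; lra.
Qed.

(** Around a circle point that [Y] approaches, take a disc inside [U]. Its intersection with the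
    unit disc is convex and meets [Y], so maximality puts it into [Y], where [f] and [F] agree.
    Conversely the disc itself serves as [U]. *)
Lemma extendable_iff_disc (f : C -> C) :
  extendable f <->
  exists (zeta : C) (e : R) (F : C -> C),
    unit_circle zeta /\ 0 < e /\ holomorphic_on (disc zeta e) F /\
    forall z, disc zeta e z -> unit_disc z -> f z = F z.
Proof.
  split.
  - intros [U [F [HU [HUT [HF [Y [HY HfF]]]]]]].
    destruct (component_reaches_circle U Y HU HUT HY) as [z [Hz [Uz Hcl]]].
    destruct HU as [HUo _].
    destruct (proj1 (open_Cmod _) HUo z Uz) as [e [He H]].
    exists z, e, F. split; [|split; [|split]]; auto.
    + intros w Hw. apply HF, H, Hw.
    + intros w Hw Hd. apply HfF.
      destruct (Hcl e He) as [y [Hy Yy]].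
      assert (HY' := HY). destruct HY' as [_ [HYS [HYc HYm]]].
      apply (HYm (fun z' => Y z' \/ set_inter (disc z e) unit_disc z')); auto.
      * apply connected_union with y; auto.
        -- apply convex_connected, convex_inter;
             [apply convex_disc | apply convex_unit_disc].
        -- split; auto. apply HYS, Yy.
      * intros x [Hx|[Hx1 Hx2]]; auto. split; auto.
      * right. now split.
  - intros [zeta [e [F [Hz [He [HF HfF]]]]]].
    exists (disc zeta e), F. repeat split.
    + apply open_disc.
    + exists zeta. now apply disc_center.
    + apply convex_connected, convex_disc.
    + exists zeta. split; auto. now apply disc_center.
    + exact HF.
    + exists (set_inter (disc zeta e) unit_disc). split.
      * apply convex_component.
        -- apply convex_inter; [apply convex_disc | apply convex_unit_disc].
        -- now apply circle_disc_meets.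
      * intros z [H1 H2]. auto.
Qed.

(** * Integrals of complex-valued functions on an interval *)

(** Phrased with [Cmod] so that it composes with [ex_derive_Cmod]; integration uses it through the
    real and imaginary parts. *)
Definition ccont (f : R -> C) (t : R) : Prop :=
  forall e, 0 < e -> exists d, 0 < d /\
    forall u, Rabs (u - t) < d -> Cmod (f u - f t)%C < e.

Lemma Im_le_Cmod (z : C) : Rabs (Im z) <= Cmod z.
Proof. eapply Rle_trans; [apply Rmax_r | apply Rmax_Cmod]. Qed.

Lemma Cmod_le_Re_Im (z : C) : Cmod z <= Rabs (Re z) + Rabs (Im z).
Proof.
  replace z with (Re z + Ci * Im z)%C at 1.
  - eapply Rle_trans; [apply Cmod_triangle|].
    rewrite Cmod_mult, !Cmod_R, Cmod_Ci. lra.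
  - destruct z as [x y]. unfold Ci, Cmult, Cplus, RtoC, Re, Im; simpl.
    f_equal; ring.
Qed.

Lemma continuous_Rabs (g : R -> R) (t : R) :
  (forall e, 0 < e -> exists d, 0 < d /\
    forall u, Rabs (u - t) < d -> Rabs (g u - g t) < e) ->
  continuous g t.
Proof.
  intros H. apply filterlim_locally. intros e.
  destruct (H e (cond_pos e)) as [d [Hd H']].
  exists (mkposreal d Hd). intros u Hu. apply H', Hu.
Qed.

Lemma ccont_Re (f : R -> C) (t : R) :
  ccont f t -> continuous (fun u => Re (f u)) t.
Proof.
  intros H. apply continuous_Rabs. intros e He. destruct (H e He) as [d [Hd H']].
  exists d. split; auto. intros u Hu. eapply Rle_lt_trans; [|apply H', Hu].
  eapply Rle_trans; [|apply re_le_Cmod].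
  apply Req_le. reflexivity.
Qed.

Lemma ccont_Im (f : R -> C) (t : R) :
  ccont f t -> continuous (fun u => Im (f u)) t.
Proof.
  intros H. apply continuous_Rabs. intros e He. destruct (H e He) as [d [Hd H']].
  exists d. split; auto. intros u Hu. eapply Rle_lt_trans; [|apply H', Hu].
  eapply Rle_trans; [|apply Im_le_Cmod].
  apply Req_le. reflexivity.
Qed.

Lemma continuous_Rabs_inv (g : R -> R) (t : R) :
  continuous g t ->
  forall e, 0 < e -> exists d, 0 < d /\
    forall u, Rabs (u - t) < d -> Rabs (g u - g t) < e.
Proof.
  intros H e He. apply (proj1 (filterlim_locally _ _)) with (eps := mkposreal e He) in H.
  destruct H as [d H]. exists d. split; [apply cond_pos|]. exact H.
Qed.

Lemma ccont_pair (f g : R -> R) (t : R) :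
  continuous f t -> continuous g t -> ccont (fun u => (f u, g u)) t.
Proof.
  intros Hf Hg e He.
  destruct (continuous_Rabs_inv f t Hf (e / 2)) as [d1 [H1 H1']]; [lra|].
  destruct (continuous_Rabs_inv g t Hg (e / 2)) as [d2 [H2 H2']]; [lra|].
  exists (Rmin d1 d2). split; [now apply Rmin_pos|]. intros u Hu.
  assert (A1 := H1' u (Rlt_le_trans _ _ _ Hu (Rmin_l _ _))).
  assert (A2 := H2' u (Rlt_le_trans _ _ _ Hu (Rmin_r _ _))).
  eapply Rle_lt_trans; [apply Cmod_le_Re_Im|].
  change (Rabs (f u - f t) + Rabs (g u - g t) < e). lra.
Qed.

Lemma continuous_Cmod (f : R -> C) (t : R) :
  ccont f t -> continuous (fun t => Cmod (f t)) t.
Proof.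
  intros Hf. apply continuous_Rabs. intros e He. destruct (Hf e He) as [d [Hd H]].
  exists d. split; auto. intros u Hu. specialize (H u Hu).
  assert (H1 := Cmod_minus_ge (f u) (f t)).
  assert (H2 := Cmod_minus_ge (f t) (f u)). rewrite Cmod_minus_sym in H2.
  apply Rabs_lt_between'. lra.
Qed.

Lemma ccont_ext (f g : R -> C) (t : R) :
  (forall u, f u = g u) -> ccont f t -> ccont g t.
Proof.
  intros E H e He. destruct (H e He) as [d [Hd H']]. exists d. split; auto.
  intros u Hu. rewrite <- !E. auto.
Qed.

Lemma ccont_const (c : C) (t : R) : ccont (fun _ => c) t.
Proof.
  intros e He. exists 1. split; [lra|]. intros u _.
  replace (c - c)%C with (RtoC 0) by ring. now rewrite Cmod_0.
Qed.

Lemma ccont_plus (f g : R -> C) (t : R) :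
  ccont f t -> ccont g t -> ccont (fun u => f u + g u)%C t.
Proof.
  intros Hf Hg.
  apply (ccont_ext (fun u => (Re (f u) + Re (g u), Im (f u) + Im (g u)))).
  { intros u. reflexivity. }
  apply ccont_pair.
  - apply (continuous_plus (fun u => Re (f u)) (fun u => Re (g u)));
      now apply ccont_Re.
  - apply (continuous_plus (fun u => Im (f u)) (fun u => Im (g u)));
      now apply ccont_Im.
Qed.

Lemma ccont_mult (f g : R -> C) (t : R) :
  ccont f t -> ccont g t -> ccont (fun u => f u * g u)%C t.
Proof.
  intros Hf Hg.
  apply (ccont_ext (fun u => (Re (f u) * Re (g u) - Im (f u) * Im (g u),
                              Re (f u) * Im (g u) + Im (f u) * Re (g u)))).
  { intros u. reflexivity. }
  assert (A := ccont_Re f t Hf). assert (B := ccont_Im f t Hf).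
  assert (A' := ccont_Re g t Hg). assert (B' := ccont_Im g t Hg).
  apply ccont_pair.
  - apply (continuous_minus (fun u => Re (f u) * Re (g u))
                            (fun u => Im (f u) * Im (g u)));
      now apply (continuous_mult (K := R_AbsRing)).
  - apply (continuous_plus (fun u => Re (f u) * Im (g u))
                           (fun u => Im (f u) * Re (g u)));
      now apply (continuous_mult (K := R_AbsRing)).
Qed.

Lemma ccont_opp (f : R -> C) (t : R) :
  ccont f t -> ccont (fun u => - f u)%C t.
Proof.
  intros H. apply (ccont_ext (fun u => (RtoC (-1) * f u)%C)).
  { intros u. ring. }
  apply ccont_mult; auto. apply ccont_const.
Qed.

Lemma ccont_minus (f g : R -> C) (t : R) :
  ccont f t -> ccont g t -> ccont (fun u => f u - g u)%C t.
Proof. intros Hf Hg. apply ccont_plus; auto. now apply ccont_opp. Qed.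

Lemma ccont_RtoC (g : R -> R) (t : R) :
  continuous g t -> ccont (fun u => RtoC (g u)) t.
Proof. intros H. apply ccont_pair; auto. apply continuous_const. Qed.

Lemma ccont_comp (f : C -> C) (g : R -> C) (t : R) :
  ex_derive f (g t) -> ccont g t -> ccont (fun u => f (g u)) t.
Proof.
  intros Hf Hg e He.
  destruct (ex_derive_continuous_Cmod f (g t) Hf e He) as [d [Hd H]].
  destruct (Hg d Hd) as [d' [Hd' H']]. exists d'. split; auto.
Qed.

Lemma ex_derive_Cinv (z : C) : z <> 0 -> ex_derive Cinv z.
Proof.
  intros Hz. apply ex_derive_Cmod. exists (- / (z * z))%C. intros e He.
  assert (Hm : 0 < Cmod z) by now apply Cmod_gt_0.
  set (m := Cmod z) in *.
  (* The remainder equals (w - z)^2 / (z^2 w). The first bound gives |w| > m/2, and the second then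
     makes |w - z| / (m^2 * m/2) at most [e]. *)
  exists (Rmin (m / 2) (e * (m * m * m) / 2)).
  assert (0 < m * m * m) by (repeat apply Rmult_lt_0_compat; lra).
  split; [apply Rmin_pos; [lra|]; apply Rdiv_lt_0_compat; [nra|lra]|].
  intros w Hw.
  assert (H1 := Rlt_le_trans _ _ _ Hw (Rmin_l _ _)).
  assert (H2 := Rlt_le_trans _ _ _ Hw (Rmin_r _ _)).
  assert (Hw' : m / 2 < Cmod w).
  { rewrite Cmod_minus_sym in H1. generalize (Cmod_minus_ge z w). fold m. lra. }
  assert (Hw0 : w <> 0) by (apply Cmod_gt_0; lra).
  replace (/ w - / z - - / (z * z) * (w - z))%C
    with ((w - z) * ((w - z) * / (z * z * w)))%C by (field; auto).
  rewrite !Cmod_mult, Cmod_inv, !Cmod_mult by (repeat apply Cmult_neq_0; auto).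
  fold m. rewrite (Rmult_comm e). apply Rmult_le_compat_l; [apply Cmod_ge_0|].
  assert (Hp : 0 < m * m * (m / 2)) by nra.
  apply Rle_trans with ((e * (m * m * m) / 2) * / (m * m * (m / 2))).
  - apply Rmult_le_compat.
    + apply Cmod_ge_0.
    + left. apply Rinv_0_lt_compat. nra.
    + lra.
    + apply Rinv_le_contravar; nra.
  - right. field. lra.
Qed.

Lemma ccont_inv (f : R -> C) (t : R) :
  f t <> 0 -> ccont f t -> ccont (fun u => / f u)%C t.
Proof. intros H0 H. apply (ccont_comp Cinv); auto. now apply ex_derive_Cinv. Qed.

Definition CInt (f : R -> C) (a b : R) : C :=
  (RInt (fun t => Re (f t)) a b, RInt (fun t => Im (f t)) a b).

Lemma ex_RInt_ccont (f : R -> C) (a b : R) :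
  a <= b -> (forall t, a <= t <= b -> ccont f t) ->
  ex_RInt (fun t => Re (f t)) a b /\ ex_RInt (fun t => Im (f t)) a b.
Proof.
  intros Hab H.
  split; apply (ex_RInt_continuous (V := R_CompleteNormedModule)); intros t Ht;
    rewrite Rmin_left, Rmax_right in Ht by lra.
  - now apply ccont_Re, H.
  - now apply ccont_Im, H.
Qed.

Lemma CInt_ext (f g : R -> C) (a b : R) :
  a <= b -> (forall t, a < t < b -> f t = g t) -> CInt f a b = CInt g a b.
Proof.
  intros Hab H. unfold CInt. f_equal; apply RInt_ext; intros t Ht;
    rewrite Rmin_left, Rmax_right in Ht by lra; now rewrite H.
Qed.

Lemma CInt_plus (f g : R -> C) (a b : R) :
  a <= b -> (forall t, a <= t <= b -> ccont f t) ->
  (forall t, a <= t <= b -> ccont g t) ->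
  CInt (fun t => f t + g t)%C a b = (CInt f a b + CInt g a b)%C.
Proof.
  intros Hab Hf Hg.
  destruct (ex_RInt_ccont f a b Hab Hf), (ex_RInt_ccont g a b Hab Hg).
  unfold CInt, Cplus; simpl. f_equal.
  - now apply (RInt_plus (V := R_CompleteNormedModule)
      (fun t => Re (f t)) (fun t => Re (g t))).
  - now apply (RInt_plus (V := R_CompleteNormedModule)
      (fun t => Im (f t)) (fun t => Im (g t))).
Qed.

Lemma CInt_scal (c : C) (f : R -> C) (a b : R) :
  a <= b -> (forall t, a <= t <= b -> ccont f t) ->
  CInt (fun t => c * f t)%C a b = (c * CInt f a b)%C.
Proof.
  intros Hab Hf. destruct (ex_RInt_ccont f a b Hab Hf) as [H1 H2].
  assert (S : forall (k : R) (g : R -> R), ex_RInt g a b ->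
    ex_RInt (fun t => k * g t) a b /\ RInt (fun t => k * g t) a b = k * RInt g a b).
  { intros k g Hg. split.
    - now apply (ex_RInt_scal (V := R_CompleteNormedModule) g).
    - now apply (RInt_scal (V := R_CompleteNormedModule) g). }
  destruct c as [x y]. unfold CInt, Cmult; simpl. f_equal.
  - rewrite <- (proj2 (S x _ H1)), <- (proj2 (S y _ H2)).
    now apply (RInt_minus (V := R_CompleteNormedModule)
      (fun t => x * Re (f t)) (fun t => y * Im (f t))); apply S.
  - rewrite <- (proj2 (S x _ H2)), <- (proj2 (S y _ H1)).
    now apply (RInt_plus (V := R_CompleteNormedModule)
      (fun t => x * Im (f t)) (fun t => y * Re (f t))); apply S.
Qed.

Lemma CInt_minus (f g : R -> C) (a b : R) :
  a <= b -> (forall t, a <= t <= b -> ccont f t) ->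
  (forall t, a <= t <= b -> ccont g t) ->
  CInt (fun t => f t - g t)%C a b = (CInt f a b - CInt g a b)%C.
Proof.
  intros Hab Hf Hg.
  rewrite (CInt_ext _ (fun t => f t + (RtoC (-1)) * g t)%C); auto.
  2:{ intros; ring. }
  rewrite CInt_plus, CInt_scal; auto.
  - ring.
  - intros t Ht. apply ccont_mult; auto. apply ccont_const.
Qed.

Lemma CInt_Chasles (f : R -> C) (a b c : R) :
  a <= b <= c -> (forall t, a <= t <= c -> ccont f t) ->
  CInt f a c = (CInt f a b + CInt f b c)%C.
Proof.
  intros Hab Hf.
  destruct (ex_RInt_ccont f a b) as [H1 H2]; [lra|intros; apply Hf; lra|].
  destruct (ex_RInt_ccont f b c) as [H3 H4]; [lra|intros; apply Hf; lra|].
  unfold CInt, Cplus; simpl. f_equal; symmetry;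
    now apply (RInt_Chasles (V := R_CompleteNormedModule)).
Qed.

Lemma RInt_abs_le (g : R -> R) (a b B : R) :
  a <= b -> ex_RInt g a b -> (forall t, a <= t <= b -> Rabs (g t) <= B) ->
  Rabs (RInt g a b) <= B * (b - a).
Proof.
  intros Hab Hg H. rewrite Rmult_comm.
  apply (abs_RInt_le_const g a b B Hab Hg). exact H.
Qed.

(* The factor 2 is the price for integrating the two components separately. *)
Lemma CInt_le (f : R -> C) (a b B : R) :
  a <= b -> (forall t, a <= t <= b -> ccont f t) ->
  (forall t, a <= t <= b -> Cmod (f t) <= B) ->
  Cmod (CInt f a b) <= 2 * B * (b - a).
Proof.
  intros Hab Hf H. destruct (ex_RInt_ccont f a b Hab Hf) as [H1 H2].
  eapply Rle_trans; [apply Cmod_le_Re_Im|]. unfold CInt; simpl.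
  assert (A1 : Rabs (RInt (fun t => Re (f t)) a b) <= B * (b - a)).
  { apply RInt_abs_le; auto. intros t Ht.
    eapply Rle_trans; [apply re_le_Cmod | auto]. }
  assert (A2 : Rabs (RInt (fun t => Im (f t)) a b) <= B * (b - a)).
  { apply RInt_abs_le; auto. intros t Ht.
    eapply Rle_trans; [apply Im_le_Cmod | auto]. }
  lra.
Qed.

Lemma CInt_derive (F f : R -> C) (a b : R) :
  a <= b -> (forall t, a <= t <= b -> ccont f t) ->
  (forall t, is_derive (fun u => Re (F u)) t (Re (f t))) ->
  (forall t, is_derive (fun u => Im (F u)) t (Im (f t))) ->
  CInt f a b = (F b - F a)%C.
Proof.
  intros Hab Hf H1 H2.
  assert (E : forall (G g : R -> R), (forall t, is_derive G t (g t)) ->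
     (forall t, a <= t <= b -> continuous g t) -> RInt g a b = G b - G a).
  { intros G g HG Hg. apply is_RInt_unique.
    apply (is_RInt_derive (V := R_CompleteNormedModule) G g); auto.
    intros t Ht. rewrite Rmin_left, Rmax_right in Ht by lra. auto. }
  assert (E1 : RInt (fun t => Re (f t)) a b = Re (F b) - Re (F a)).
  { apply (E (fun t => Re (F t)) (fun t => Re (f t)) H1).
    intros. now apply ccont_Re, Hf. }
  assert (E2 : RInt (fun t => Im (f t)) a b = Im (F b) - Im (F a)).
  { apply (E (fun t => Im (F t)) (fun t => Im (f t)) H2).
    intros. now apply ccont_Im, Hf. }
  unfold CInt. rewrite E1, E2. destruct (F b), (F a). reflexivity.
Qed.

(** * Polar coordinates *)

Lemma polar_mult (r s t u : R) :
  (polar r t * polar s u)%C = polar (r * s) (t + u).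
Proof.
  unfold polar, Cmult; simpl. rewrite cos_plus, sin_plus. f_equal; ring.
Qed.

Lemma polar_pow (r t : R) (n : nat) :
  (polar r t ^ n)%C = polar (r ^ n) (INR n * t).
Proof.
  induction n as [|n IH].
  - simpl. unfold polar. rewrite Rmult_0_l, cos_0, sin_0. unfold RtoC. f_equal; ring.
  - rewrite Cpow_S, IH, polar_mult. f_equal. rewrite S_INR. ring.
Qed.

Lemma RtoC_polar (s r t : R) : (s * polar r t)%C = polar (s * r) t.
Proof. unfold polar, Cmult, RtoC; simpl. f_equal; ring. Qed.

Lemma Cmod_polar (r t : R) : Cmod (polar r t) = Rabs r.
Proof.
  unfold Cmod, polar; simpl.
  replace (_ + _) with (r * r * ((sin t)² + (cos t)²)) by (unfold Rsqr; ring).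
  rewrite sin2_cos2, Rmult_1_r. apply sqrt_Rsqr_abs.
Qed.

Lemma ccont_polar (r t : R) : ccont (polar r) t.
Proof.
  apply ccont_pair; apply (ex_derive_continuous (V := R_NormedModule)); auto_derive; auto.
Qed.

Lemma abs_diff_le (g g' : R -> R) (a b : R) :
  (forall t, is_derive g t (g' t)) -> (forall t, Rabs (g' t) <= 1) ->
  Rabs (g a - g b) <= Rabs (a - b).
Proof.
  intros Hg Hb.
  destruct (MVT_gen g b a g') as [c [_ E]].
  - intros; apply Hg.
  - intros. apply continuity_pt_filterlim, (ex_derive_continuous (V := R_NormedModule)).
    eexists; apply Hg.
  - rewrite E, Rabs_mult. generalize (Hb c) (Rabs_pos (a - b)). nra.
Qed.

Lemma polar_lipschitz (r t u : R) :
  0 <= r -> Cmod (polar r t - polar r u)%C <= 2 * r * Rabs (t - u).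
Proof.
  intros Hr. eapply Rle_trans; [apply Cmod_le_Re_Im|]. unfold polar; simpl.
  replace (r * cos t + - (r * cos u)) with (r * (cos t - cos u)) by ring.
  replace (r * sin t + - (r * sin u)) with (r * (sin t - sin u)) by ring.
  rewrite !Rabs_mult, (Rabs_pos_eq r) by auto.
  assert (Rabs (cos t - cos u) <= Rabs (t - u)).
  { apply abs_diff_le with (fun x => - sin x).
    - intros x. auto_derive; auto; ring.
    - intros x. rewrite Rabs_Ropp. apply Rabs_le. apply SIN_bound. }
  assert (Rabs (sin t - sin u) <= Rabs (t - u)).
  { apply abs_diff_le with cos.
    - intros x. auto_derive; auto; ring.
    - intros x. apply Rabs_le. apply COS_bound. }
  nra.
Qed.

(** The index is also made positive because [kernel_int] needs the term of index 0 in its partial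
    sum. *)
Lemma pow_small (K q e : R) : 0 <= q < 1 -> 0 < e ->
  exists n, K * q ^ n < e /\ (0 < n)%nat.
Proof.
  intros Hq He.
  destruct (pow_lt_1_zero q) with (y := e / (Rabs K + 1)) as [n Hn].
  - rewrite Rabs_pos_eq; lra.
  - apply Rdiv_lt_0_compat; auto. generalize (Rabs_pos K). lra.
  - exists (S n). split; [|lia]. specialize (Hn (S n) ltac:(lia)).
    assert (P : 0 <= q ^ S n) by (apply pow_le; lra).
    rewrite Rabs_pos_eq in Hn by lra.
    assert (HK := Rabs_pos K). assert (HK' := Rle_abs K).
    apply (Rmult_lt_compat_l (Rabs K + 1)) in Hn; [|lra].
    replace ((Rabs K + 1) * (e / (Rabs K + 1))) with e in Hn by (field; lra).
    nra.
Qed.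

(* Cousin's lemma for subadditive functions of rectangles [a,b] x [c,d]. *)
Lemma rectangle_bisection (N : R -> R -> R -> R -> R) (a b c d : R) :
  a <= b -> c <= d ->
  (forall a' m b' c' d', a <= a' -> a' <= m <= b' -> b' <= b ->
     c <= c' -> c' <= d' -> d' <= d ->
     N a' b' c' d' <= N a' m c' d' + N m b' c' d') ->
  (forall a' b' c' m d', a <= a' -> a' <= b' -> b' <= b ->
     c <= c' -> c' <= m <= d' -> d' <= d ->
     N a' b' c' d' <= N a' b' c' m + N a' b' m d') ->
  (forall x y, a <= x <= b -> c <= y <= d -> forall e, 0 < e ->
     exists r, 0 < r /\ forall a' b' c' d',
       a <= a' -> a' <= x <= b' -> b' <= b ->
       c <= c' -> c' <= y <= d' -> d' <= d ->
       b' - a' < r -> d' - c' < r ->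
       N a' b' c' d' <= e * ((b' - a') + (d' - c')) ^ 2) ->
  N a b c d <= 0.
Proof.
  intros Hab Hcd Hx Hy Hloc.
  destruct (Rle_dec (N a b c d) 0) as [|Hpos]; auto. exfalso.
  apply Rnot_le_lt in Hpos.
  (* Of two halves, one carries at least half of [N], by subadditivity. Halving in both directions
     therefore divides [N] by at most 4, while the squared size is divided by exactly 4. *)
  set (halfx := fun a b c d =>
    if Rle_dec (N a b c d) (2 * N a ((a + b) / 2) c d)
    then (a, (a + b) / 2) else ((a + b) / 2, b)).
  set (halfy := fun a b c d =>
    if Rle_dec (N a b c d) (2 * N a b c ((c + d) / 2))
    then (c, (c + d) / 2) else ((c + d) / 2, d)).
  set (step := fun q : (R * R) * (R * R) =>
    let (p1, p2) := q in let (a, b) := p1 in let (c, d) := p2 in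
    let (a', b') := halfx a b c d in ((a', b'), halfy a' b' c d)).
  set (Q := fun n => Nat.iter n step ((a, b), (c, d))).
  set (A := fun n => fst (fst (Q n))). set (B := fun n => snd (fst (Q n))).
  set (C' := fun n => fst (snd (Q n))). set (D := fun n => snd (snd (Q n))).
  assert (Hstep : forall n,
    (a <= A n <= B n /\ B n <= b /\ c <= C' n <= D n /\ D n <= d) ->
    (A n <= A (S n) <= B (S n) /\ B (S n) <= B n /\
     C' n <= C' (S n) <= D (S n) /\ D (S n) <= D n /\
     B (S n) - A (S n) = (B n - A n) / 2 /\
     D (S n) - C' (S n) = (D n - C' n) / 2 /\
     N (A n) (B n) (C' n) (D n) <= 4 * N (A (S n)) (B (S n)) (C' (S n)) (D (S n)))).
  { intros n. unfold A, B, C', D. simpl. fold (Q n).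
    destruct (Q n) as [[a0 b0] [c0 d0]]. simpl. intros Hb.
    set (m := (a0 + b0) / 2). set (m' := (c0 + d0) / 2).
    assert (Hm : a0 <= m <= b0) by (unfold m; lra).
    assert (Hm' : c0 <= m' <= d0) by (unfold m'; lra).
    assert (K : forall a1 b1, halfx a0 b0 c0 d0 = (a1, b1) ->
      a0 <= a1 <= b1 /\ b1 <= b0 /\ b1 - a1 = (b0 - a0) / 2 /\
      N a0 b0 c0 d0 <= 2 * N a1 b1 c0 d0).
    { intros a1 b1. unfold halfx. fold m. specialize (Hx a0 m b0 c0 d0).
      destruct (Rle_dec _ _); intros E; injection E; intros <- <-;
        repeat split; unfold m in *; try lra. }
    destruct (halfx a0 b0 c0 d0) as [a1 b1]. specialize (K a1 b1 eq_refl).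
    assert (K' : forall c1 d1, halfy a1 b1 c0 d0 = (c1, d1) ->
      c0 <= c1 <= d1 /\ d1 <= d0 /\ d1 - c1 = (d0 - c0) / 2 /\
      N a1 b1 c0 d0 <= 2 * N a1 b1 c1 d1).
    { intros c1 d1. unfold halfy. fold m'. specialize (Hy a1 b1 c0 m' d0).
      destruct (Rle_dec _ _); intros E; injection E; intros <- <-;
        repeat split; unfold m' in *; try lra. }
    destruct (halfy a1 b1 c0 d0) as [c1 d1]. specialize (K' c1 d1 eq_refl).
    simpl. lra. }
  assert (Hinv : forall n,
    (a <= A n <= B n /\ B n <= b /\ c <= C' n <= D n /\ D n <= d)).
  { induction n as [|n IH].
    - unfold A, B, C', D, Q; simpl. lra.
    - destruct (Hstep n IH) as (H1 & H2 & H3 & H4 & _). lra. }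
  assert (Hsize : forall n, B n - A n = (b - a) * (/ 2) ^ n /\
    D n - C' n = (d - c) * (/ 2) ^ n /\
    N a b c d <= 4 ^ n * N (A n) (B n) (C' n) (D n)).
  { induction n as [|n IH].
    - unfold A, B, C', D, Q; simpl. lra.
    - destruct (Hstep n (Hinv n)) as (_ & _ & _ & _ & H5 & H6 & H7).
      destruct IH as (I1 & I2 & I3). rewrite H5, H6, I1, I2.
      split; [simpl; field|split; [simpl; field|]].
      assert (0 < 4 ^ n) by (apply pow_lt; lra).
      simpl. nra. }
  assert (Hmono : forall n k, A n <= A (n + k)%nat /\ B (n + k)%nat <= B n /\
    C' n <= C' (n + k)%nat /\ D (n + k)%nat <= D n).
  { intros n. induction k as [|k IH].
    - rewrite Nat.add_0_r. lra.
    - rewrite Nat.add_succ_r.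
      destruct (Hstep _ (Hinv (n + k)%nat)) as (H1 & H2 & H3 & H4 & _). lra. }
  assert (Hnest : forall n m, A n <= B m /\ C' n <= D m).
  { intros n m. destruct (Hmono n m) as (H1 & _ & H3 & _).
    destruct (Hmono m n) as (_ & H2 & _ & H4).
    rewrite Nat.add_comm in H2, H4. generalize (Hinv (n + m)%nat). lra. }
  destruct (completeness (fun x => exists n, x = A n)) as [x [Hxu Hxl]].
  { exists (B 0%nat). intros x [n ->]. apply Hnest. }
  { exists (A 0%nat). now exists 0%nat. }
  destruct (completeness (fun x => exists n, x = C' n)) as [y [Hyu Hyl]].
  { exists (D 0%nat). intros y [n ->]. apply Hnest. }
  { exists (C' 0%nat). now exists 0%nat. }
  assert (Hxn : forall n, A n <= x <= B n).
  { intros n. split; [apply Hxu; now exists n|].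
    apply Hxl. intros z [k ->]. apply Hnest. }
  assert (Hyn : forall n, C' n <= y <= D n).
  { intros n. split; [apply Hyu; now exists n|].
    apply Hyl. intros z [k ->]. apply Hnest. }
  set (S0 := (b - a) + (d - c)).
  assert (HS0 : 0 <= S0) by (unfold S0; lra).
  (* After n steps the local estimate gives N a b c d <= 4^n * e * (S0 / 2^n)^2 = e * S0^2, which
     this [e] makes smaller than [N a b c d]. *)
  set (e := N a b c d / (2 * (S0 ^ 2 + 1))).
  assert (He : 0 < e).
  { apply Rdiv_lt_0_compat; auto. generalize (pow2_ge_0 S0). lra. }
  destruct (Hloc x y) with (e := e) as [r [Hr H]]; auto.
  { generalize (Hxn 0%nat). unfold A, B, Q. simpl. auto. }
  { generalize (Hyn 0%nat). unfold C', D, Q. simpl. auto. }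
  destruct (pow_small S0 (/ 2) r ltac:(lra) Hr) as [n [Hn _]].
  destruct (Hinv n) as ((I1 & I2) & I3 & (I4 & I5) & I6).
  destruct (Hsize n) as (J1 & J2 & J3).
  assert (P : 0 < (/ 2) ^ n) by (apply pow_lt; lra).
  assert (Hf : N (A n) (B n) (C' n) (D n) <= e * ((B n - A n) + (D n - C' n)) ^ 2).
  { apply H; auto; rewrite ?J1, ?J2; unfold S0 in Hn; nra. }
  rewrite J1, J2 in Hf.
  replace ((b - a) * (/ 2) ^ n + (d - c) * (/ 2) ^ n) with (S0 * (/ 2) ^ n) in Hf
    by (unfold S0; ring).
  assert (E4 : 4 ^ n * ((/ 2) ^ n) ^ 2 = 1).
  { rewrite <- pow_mult, Nat.mul_comm, pow_mult, <- Rpow_mult_distr.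
    replace (4 * (/ 2) ^ 2) with 1 by field. apply pow1. }
  assert (P4 : 0 < 4 ^ n) by (apply pow_lt; lra).
  apply (Rmult_le_compat_l (4 ^ n)) in Hf; [|lra].
  rewrite Rpow_mult_distr in Hf.
  replace (4 ^ n * (e * (S0 ^ 2 * ((/ 2) ^ n) ^ 2)))
    with (e * S0 ^ 2 * (4 ^ n * ((/ 2) ^ n) ^ 2)) in Hf by ring.
  rewrite E4, Rmult_1_r in Hf.
  assert (e * (2 * (S0 ^ 2 + 1)) = N a b c d).
  { unfold e. field. generalize (pow2_ge_0 S0). lra. }
  generalize (pow2_ge_0 S0). nra.
Qed.

(** * Goursat's theorem *)

Section Goursat.

Variables (w v : C) (r : R).
Hypothesis r_ge0 : 0 <= r.

(** The circle of radius [r] about w + v, contracted towards [w] by the factor [s]. *)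
Definition path (s t : R) : C := (w + s * (polar r t + v))%C.

(** The contour integral of h dz along the side where [s] is fixed: the second factor is the
    derivative of [path] in [t]. In [hside] it is the derivative in [s]. *)
Definition vside (h : C -> C) (s t0 t1 : R) : C :=
  CInt (fun t => h (path s t) * (s * (Ci * polar r t)))%C t0 t1.

Definition hside (h : C -> C) (t s0 s1 : R) : C :=
  CInt (fun s => h (path s t) * (polar r t + v))%C s0 s1.

(** The contour integral of h dz along the image under [path] of the oriented boundary of the
    parameter rectangle. *)
Definition boundary_int (h : C -> C) (s0 s1 t0 t1 : R) : C :=
  (vside h s1 t0 t1 - vside h s0 t0 t1 - (hside h t1 s0 s1 - hside h t0 s0 s1))%C.

Lemma ccont_path_t (s t : R) : ccont (path s) t.
Proof.
  unfold path. apply ccont_plus; [apply ccont_const|].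
  apply ccont_mult; [apply ccont_const|].
  apply ccont_plus; [apply ccont_polar | apply ccont_const].
Qed.

Lemma ccont_path_s (s t : R) : ccont (fun s => path s t) s.
Proof.
  unfold path. apply ccont_plus; [apply ccont_const|].
  apply ccont_mult; [apply ccont_RtoC, continuous_id | apply ccont_const].
Qed.

Definition sides_cont (h : C -> C) (s0 s1 t0 t1 : R) : Prop :=
  forall s t, s0 <= s <= s1 -> t0 <= t <= t1 ->
    ccont (fun t => h (path s t)) t /\ ccont (fun s => h (path s t)) s.

Lemma ccont_vside (h : C -> C) (s0 s1 t0 t1 s : R) :
  sides_cont h s0 s1 t0 t1 -> s0 <= s <= s1 -> forall t, t0 <= t <= t1 ->
  ccont (fun t => h (path s t) * (s * (Ci * polar r t)))%C t.
Proof.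
  intros H Hs t Ht. apply ccont_mult; [now apply H|].
  apply ccont_mult; [apply ccont_const|].
  apply ccont_mult; [apply ccont_const | apply ccont_polar].
Qed.

Lemma ccont_hside (h : C -> C) (s0 s1 t0 t1 t : R) :
  sides_cont h s0 s1 t0 t1 -> t0 <= t <= t1 -> forall s, s0 <= s <= s1 ->
  ccont (fun s => h (path s t) * (polar r t + v))%C s.
Proof. intros H Ht s Hs. apply ccont_mult; [now apply H | apply ccont_const]. Qed.

Lemma boundary_int_minus (h k : C -> C) (s0 s1 t0 t1 : R) :
  s0 <= s1 -> t0 <= t1 ->
  sides_cont h s0 s1 t0 t1 -> sides_cont k s0 s1 t0 t1 ->
  boundary_int (fun z => h z - k z)%C s0 s1 t0 t1 =
  (boundary_int h s0 s1 t0 t1 - boundary_int k s0 s1 t0 t1)%C.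
Proof.
  intros Hs Ht Hh Hk.
  assert (V : forall s, s0 <= s <= s1 ->
    vside (fun z => h z - k z)%C s t0 t1 = (vside h s t0 t1 - vside k s t0 t1)%C).
  { intros s Hss. unfold vside. rewrite <- CInt_minus; auto.
    - apply CInt_ext; auto. intros. ring.
    - now apply (ccont_vside h s0 s1).
    - now apply (ccont_vside k s0 s1). }
  assert (W : forall t, t0 <= t <= t1 ->
    hside (fun z => h z - k z)%C t s0 s1 = (hside h t s0 s1 - hside k t s0 s1)%C).
  { intros t Htt. unfold hside. rewrite <- CInt_minus; auto.
    - apply CInt_ext; auto. intros. ring.
    - now apply (ccont_hside h s0 s1 t0 t1).
    - now apply (ccont_hside k s0 s1 t0 t1). }
  unfold boundary_int. rewrite !V, !W by lra. ring.
Qed.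

(** An affine function has the quadratic primitive [P], so each side contributes a difference of
    values of [P] at two corners, and these cancel. *)
Lemma boundary_int_affine (A B : C) (s0 s1 t0 t1 : R) :
  s0 <= s1 -> t0 <= t1 ->
  boundary_int (fun z => A + B * z)%C s0 s1 t0 t1 = 0.
Proof.
  intros Hs Ht.
  set (P := fun z : C => (A * z + RtoC (/ 2) * (B * (z * z)))%C).
  assert (V : forall s, vside (fun z => A + B * z)%C s t0 t1
                        = (P (path s t1) - P (path s t0))%C).
  { intros s. unfold vside. apply (CInt_derive (fun t => P (path s t))); auto.
    - intros t _. apply ccont_mult.
      + apply ccont_plus; [apply ccont_const|].
        apply ccont_mult; [apply ccont_const | apply ccont_path_t].
      + apply ccont_mult; [apply ccont_const|].
        apply ccont_mult; [apply ccont_const | apply ccont_polar].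
    - intros t. unfold P, path, polar, Ci, RtoC, Cmult, Cplus, Re, Im; simpl.
      destruct A, B, w, v; simpl. auto_derive; auto. field.
    - intros t. unfold P, path, polar, Ci, RtoC, Cmult, Cplus, Re, Im; simpl.
      destruct A, B, w, v; simpl. auto_derive; auto. field. }
  assert (W : forall t, hside (fun z => A + B * z)%C t s0 s1
                        = (P (path s1 t) - P (path s0 t))%C).
  { intros t. unfold hside. apply (CInt_derive (fun s => P (path s t))); auto.
    - intros s _. apply ccont_mult; [|apply ccont_const].
      apply ccont_plus; [apply ccont_const|].
      apply ccont_mult; [apply ccont_const | apply ccont_path_s].
    - intros s. unfold P, path, polar, Ci, RtoC, Cmult, Cplus, Re, Im; simpl.
      destruct A, B, w, v; simpl. auto_derive; auto. field.
    - intros s. unfold P, path, polar, Ci, RtoC, Cmult, Cplus, Re, Im; simpl.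
      destruct A, B, w, v; simpl. auto_derive; auto. field. }
  unfold boundary_int. rewrite !V, !W. ring.
Qed.

(** A common bound for the speed of [path] in both parameters; the 2 comes from
    [polar_lipschitz]. *)
Let L := 2 * r + Cmod v.

Lemma path_lipschitz (s s' t t' : R) :
  0 <= s' <= 1 ->
  Cmod (path s t - path s' t')%C <= L * (Rabs (s - s') + Rabs (t - t')).
Proof.
  intros Hs. unfold path.
  replace (w + s * (polar r t + v) - (w + s' * (polar r t' + v)))%C with
    ((s - s') * (polar r t + v) + s' * (polar r t - polar r t'))%C by ring.
  eapply Rle_trans; [apply Cmod_triangle|].
  rewrite !Cmod_mult, <- RtoC_minus, !Cmod_R, (Rabs_pos_eq s') by lra.
  assert (H1 := Cmod_triangle (polar r t) v).
  rewrite Cmod_polar, (Rabs_pos_eq r) in H1 by auto.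
  assert (H2 := polar_lipschitz r t t' r_ge0).
  assert (Hv := Cmod_ge_0 v). assert (Hp := Cmod_ge_0 (polar r t - polar r t')%C).
  assert (H3 := Rabs_pos (s - s')). assert (H4 := Rabs_pos (t - t')).
  assert (Rabs (s - s') * Cmod (polar r t + v)%C <= Rabs (s - s') * L).
  { apply Rmult_le_compat_l; unfold L; lra. }
  assert (s' * Cmod (polar r t - polar r t')%C <= 2 * r * Rabs (t - t')) by nra.
  assert (2 * r * Rabs (t - t') <= L * Rabs (t - t')).
  { apply Rmult_le_compat_r; unfold L; lra. }
  lra.
Qed.

(** The factor 4 is the 2 of [CInt_le] times the number of parallel sides. *)
Lemma boundary_int_le (h : C -> C) (s0 s1 t0 t1 B : R) :
  0 <= s0 <= s1 -> s1 <= 1 -> t0 <= t1 -> 0 <= B ->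
  sides_cont h s0 s1 t0 t1 ->
  (forall s t, s0 <= s <= s1 -> t0 <= t <= t1 -> Cmod (h (path s t)) <= B) ->
  Cmod (boundary_int h s0 s1 t0 t1) <= 4 * B * L * ((s1 - s0) + (t1 - t0)).
Proof.
  intros Hs Hs1 Ht HB Hc Hb.
  assert (Hv := Cmod_ge_0 v).
  assert (V : forall s, s0 <= s <= s1 ->
    Cmod (vside h s t0 t1) <= 2 * (B * L) * (t1 - t0)).
  { intros s Hss. apply CInt_le; auto.
    - now apply (ccont_vside h s0 s1).
    - intros t Htt.
      rewrite !Cmod_mult, Cmod_R, Cmod_Ci, Cmod_polar, !Rabs_pos_eq by lra.
      apply Rmult_le_compat; auto using Cmod_ge_0; unfold L; nra. }
  assert (W : forall t, t0 <= t <= t1 ->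
    Cmod (hside h t s0 s1) <= 2 * (B * L) * (s1 - s0)).
  { intros t Htt. apply CInt_le; [lra| |].
    - now apply (ccont_hside h s0 s1 t0 t1).
    - intros s Hss. rewrite Cmod_mult.
      apply Rmult_le_compat; auto using Cmod_ge_0.
      eapply Rle_trans; [apply Cmod_triangle|].
      rewrite Cmod_polar, Rabs_pos_eq; unfold L; lra. }
  unfold boundary_int, Cminus.
  eapply Rle_trans; [apply Cmod_triangle|].
  eapply Rle_trans; [apply Rplus_le_compat; [apply Cmod_triangle | rewrite Cmod_opp; apply Cmod_triangle]|].
  rewrite !Cmod_opp.
  generalize (V s0 ltac:(lra)) (V s1 ltac:(lra)) (W t0 ltac:(lra)) (W t1 ltac:(lra)).
  lra.
Qed.

Lemma sides_cont_holomorphic (h : C -> C) (s0 s1 t0 t1 : R) :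
  (forall s t, s0 <= s <= s1 -> t0 <= t <= t1 -> ex_derive h (path s t)) ->
  sides_cont h s0 s1 t0 t1.
Proof.
  intros H s t Hs Ht. split.
  - apply (ccont_comp h (path s)); auto. apply ccont_path_t.
  - apply (ccont_comp h (fun s => path s t)); auto. apply ccont_path_s.
Qed.

(** Subtracting the affine approximation at a point does not change the boundary integral. What is
    left is at most a small multiple of the diameter on a boundary of comparable length, hence a
    small multiple of the squared size, as [rectangle_bisection] requires. *)
Lemma goursat (h : C -> C) (s0 s1 t0 t1 : R) :
  0 <= s0 <= s1 -> s1 <= 1 -> t0 <= t1 ->
  (forall s t, s0 <= s <= s1 -> t0 <= t <= t1 -> ex_derive h (path s t)) ->
  boundary_int h s0 s1 t0 t1 = 0.
Proof.
  intros Hs Hs1 Ht Hh.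
  assert (Hc : forall a b c d, s0 <= a -> b <= s1 -> t0 <= c -> d <= t1 ->
    sides_cont h a b c d).
  { intros a b c d Ha Hb Hcc Hd. apply sides_cont_holomorphic.
    intros s t Hss Htt. apply Hh; lra. }
  apply Cmod_eq_0, Rle_antisym; [|apply Cmod_ge_0].
  apply (rectangle_bisection (fun a b c d => Cmod (boundary_int h a b c d))); [lra|auto| | |].
  - intros a m b c d Ha Hm Hb Hcc Hd Hd'.
    replace (boundary_int h a b c d) with
      (boundary_int h a m c d + boundary_int h m b c d)%C; [apply Cmod_triangle|].
    unfold boundary_int.
    assert (E : forall t, c <= t <= d ->
      hside h t a b = (hside h t a m + hside h t m b)%C).
    { intros t Htt. apply CInt_Chasles; [lra|].
      apply (ccont_hside h a b c d); [apply Hc|]; lra. }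
    rewrite (E c), (E d) by lra. ring.
  - intros a b c m d Ha Hab Hb Hcc Hm Hd.
    replace (boundary_int h a b c d) with
      (boundary_int h a b c m + boundary_int h a b m d)%C; [apply Cmod_triangle|].
    unfold boundary_int.
    assert (E : forall s, a <= s <= b ->
      vside h s c d = (vside h s c m + vside h s m d)%C).
    { intros s Hss. apply CInt_Chasles; [lra|].
      apply (ccont_vside h a b c d); [apply Hc|]; lra. }
    rewrite (E a), (E b) by lra. ring.
  - intros x y Hx Hy e He.
    destruct (proj1 (ex_derive_Cmod _ _) (Hh x y Hx Hy)) as [l Hl].
    set (z0 := path x y) in *.
    assert (Hv := Cmod_ge_0 v).
    assert (HL : 0 <= L) by (unfold L; lra).
    (* With size [D], points of the image are within L * D of [z0]; [boundary_int_le] then gives e *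
       D^2 * L^2 / (L^2 + 1). *)
    destruct (Hl (e / (4 * (L * L + 1)))) as [d [Hd Hl']].
    { apply Rdiv_lt_0_compat; nra. }
    exists (d / (2 * (L + 1))). split; [apply Rdiv_lt_0_compat; lra|].
    intros a b c c' Ha Hax Hb Hcc Hcy Hc' Hab Hcd.
    set (k := fun z : C => ((h z0 - l * z0) + l * z)%C).
    assert (Hck : sides_cont k a b c c').
    { intros s t _ _. unfold k. split; apply ccont_plus; try apply ccont_const;
        apply ccont_mult; try apply ccont_const;
        [apply ccont_path_t | apply ccont_path_s]. }
    assert (Hch : sides_cont h a b c c') by (apply Hc; lra).
    assert (E : boundary_int h a b c c' = boundary_int (fun z => h z - k z)%C a b c c').
    { rewrite boundary_int_minus by (auto; lra).
      unfold k at 1. rewrite boundary_int_affine by lra. ring. }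
    rewrite E.
    set (D := (b - a) + (c' - c)).
    assert (HD : 0 <= D) by (unfold D; lra).
    eapply Rle_trans.
    + apply boundary_int_le with (B := e / (4 * (L * L + 1)) * (L * D)); try lra.
      * apply Rmult_le_pos; [|nra]. left. apply Rdiv_lt_0_compat; nra.
      * intros s t Hss Htt. split; apply ccont_minus;
          [apply Hch | apply Hck | apply Hch | apply Hck]; auto.
      * intros s t Hss Htt. unfold k.
        assert (Hp : Cmod (path s t - z0)%C <= L * D).
        { eapply Rle_trans; [apply path_lipschitz; lra|].
          apply Rmult_le_compat_l; auto. unfold D.
          apply Rplus_le_compat; apply Rabs_le; lra. }
        replace (h (path s t) - (h z0 - l * z0 + l * path s t))%C with
          (h (path s t) - h z0 - l * (path s t - z0))%C by ring.
        eapply Rle_trans; [apply Hl'|].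
        -- eapply Rle_lt_trans; [apply Hp|].
           assert (D < 2 * (d / (2 * (L + 1)))) by (unfold D; lra).
           replace (2 * (d / (2 * (L + 1)))) with (d / (L + 1)) in H by (field; lra).
           assert ((L + 1) * D < d).
           { apply (Rmult_lt_compat_l (L + 1)) in H; [|lra].
             replace ((L + 1) * (d / (L + 1))) with d in H by (field; lra). lra. }
           nra.
        -- apply Rmult_le_compat_l; auto. left. apply Rdiv_lt_0_compat; nra.
    + fold D.
      replace (4 * (e / (4 * (L * L + 1)) * (L * D)) * L * D) with
        (e * D ^ 2 * (L * L / (L * L + 1))) by (field; nra).
      assert (L * L / (L * L + 1) <= 1).
      { apply (Rmult_le_reg_r (L * L + 1)); [nra|].
        unfold Rdiv. rewrite Rmult_assoc, Rinv_l by nra. lra. }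
      assert (0 <= e * D ^ 2) by (generalize (pow2_ge_0 D); nra).
      nra.
Qed.

(** The sides t = 0 and t = 2 * PI have the same image by periodicity, so in the vanishing boundary
    integral only the two loops remain. *)
Lemma loop_int_const (h : C -> C) (s0 : R) :
  0 <= s0 <= 1 ->
  (forall s t, s0 <= s <= 1 -> 0 <= t <= 2 * PI -> ex_derive h (path s t)) ->
  vside h 1 0 (2 * PI) = vside h s0 0 (2 * PI).
Proof.
  intros Hs Hh. assert (HPI := PI_RGT_0).
  assert (G := goursat h s0 1 0 (2 * PI) ltac:(lra) ltac:(lra) ltac:(lra) Hh).
  unfold boundary_int in G.
  assert (E : hside h (2 * PI) s0 1 = hside h 0 s0 1).
  { unfold hside, path, polar. now rewrite cos_2PI, sin_2PI, cos_0, sin_0. }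
  rewrite E in G.
  apply Ceq_minus. rewrite <- G. ring.
Qed.

End Goursat.

(** * Taylor coefficients and the identity theorem *)

Lemma ex_derive_Cplus (f g : C -> C) (z : C) :
  ex_derive f z -> ex_derive g z -> ex_derive (fun x => f x + g x)%C z.
Proof.
  intros [l Hl] [m Hm]. exists (plus l m). now apply (is_derive_plus f g).
Qed.

Lemma ex_derive_Cmult (f g : C -> C) (z : C) :
  ex_derive f z -> ex_derive g z -> ex_derive (fun x => f x * g x)%C z.
Proof.
  intros Hf Hg.
  assert (Cg := ex_derive_continuous_Cmod g z Hg).
  apply ex_derive_Cmod in Hf. apply ex_derive_Cmod in Hg.
  destruct Hf as [l Hl]. destruct Hg as [m Hm].
  apply ex_derive_Cmod. exists (l * g z + f z * m)%C. intros e He.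
  set (B := Cmod (g z) + 1 + Cmod l + Cmod (f z)).
  assert (Hg0 := Cmod_ge_0 (g z)). assert (Hl0 := Cmod_ge_0 l).
  assert (Hf0 := Cmod_ge_0 (f z)).
  (* The remainder of the product splits into three pieces, each at most e' * B * |x - z|, since [B]
     bounds |g| near [z], |l| and |f z|. *)
  set (e' := e / (3 * B)).
  assert (HB : 1 <= B) by (unfold B; lra).
  assert (He' : 0 < e') by (apply Rdiv_lt_0_compat; lra).
  destruct (Hl e' He') as [d1 [Hd1 H1]].
  destruct (Hm e' He') as [d2 [Hd2 H2]].
  destruct (Cg (Rmin 1 e')) as [d3 [Hd3 H3]]; [apply Rmin_pos; lra|].
  exists (Rmin d1 (Rmin d2 d3)).
  split; [repeat apply Rmin_pos; auto|]. intros x Hx.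
  assert (X1 := Rlt_le_trans _ _ _ Hx (Rmin_l _ _)).
  assert (X2 := Rlt_le_trans _ _ _ Hx (Rmin_r _ _)).
  assert (X3 := Rlt_le_trans _ _ _ X2 (Rmin_r _ _)).
  apply (fun H => Rlt_le_trans _ _ _ H (Rmin_l _ _)) in X2.
  specialize (H1 x X1). specialize (H2 x X2). specialize (H3 x X3).
  assert (Y1 := Rlt_le_trans _ _ _ H3 (Rmin_l _ _)).
  assert (Y2 := Rlt_le_trans _ _ _ H3 (Rmin_r _ _)).
  replace (f x * g x - f z * g z - (l * g z + f z * m) * (x - z))%C with
    ((f x - f z - l * (x - z)) * g x + (l * (g x - g z) * (x - z)
      + f z * (g x - g z - m * (x - z))))%C by ring.
  eapply Rle_trans; [apply Cmod_triangle|].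
  eapply Rle_trans; [apply Rplus_le_compat_l, Cmod_triangle|].
  rewrite !Cmod_mult.
  assert (Gx : Cmod (g x) <= B).
  { generalize (Cmod_minus_ge (g x) (g z)). unfold B. lra. }
  set (D := Cmod (x - z)%C) in *.
  assert (HD : 0 <= D) by apply Cmod_ge_0.
  assert (A1 : Cmod (f x - f z - l * (x - z))%C * Cmod (g x) <= e' * D * B).
  { apply Rmult_le_compat; auto using Cmod_ge_0. }
  assert (A2 : Cmod l * Cmod (g x - g z)%C * D <= B * e' * D).
  { apply Rmult_le_compat_r; auto. apply Rmult_le_compat; auto using Cmod_ge_0.
    - unfold B; lra.
    - lra. }
  assert (A3 : Cmod (f z) * Cmod (g x - g z - m * (x - z))%C <= B * (e' * D)).
  { apply Rmult_le_compat; auto using Cmod_ge_0. unfold B; lra. }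
  assert (E : e = 3 * B * e') by (unfold e'; field; lra).
  rewrite E. lra.
Qed.

Lemma ex_derive_Cconst (c z : C) : ex_derive (fun _ : C => c) z.
Proof.
  apply ex_derive_Cmod. exists 0. intros e He. exists 1. split; [lra|].
  intros x _. replace (c - c - 0 * (x - z))%C with (RtoC 0) by ring.
  rewrite Cmod_0. apply Rmult_le_pos; [lra | apply Cmod_ge_0].
Qed.

Lemma ex_derive_Cinv_sub (w z : C) : z <> w -> ex_derive (fun x => / (x - w))%C z.
Proof.
  intros H.
  assert (H0 : (z - w)%C <> 0) by now apply Cminus_eq_contra.
  destruct (proj1 (ex_derive_Cmod _ _) (ex_derive_Cinv _ H0)) as [l Hl].
  apply ex_derive_Cmod. exists l. intros e He.
  destruct (Hl e He) as [d [Hd Hl']]. exists d. split; auto.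
  intros x Hx. specialize (Hl' (x - w)%C).
  replace (x - w - (z - w))%C with (x - z)%C in Hl' by ring. auto.
Qed.

Lemma ex_derive_Cpow (f : C -> C) (z : C) (n : nat) :
  ex_derive f z -> ex_derive (fun x => f x ^ n)%C z.
Proof.
  intros H. induction n as [|n IH].
  - apply (ex_derive_Cconst 1).
  - now apply (ex_derive_Cmult f (fun x => f x ^ n)%C).
Qed.

Lemma ccont_bounded (f : R -> C) (a b : R) :
  a <= b -> (forall t, a <= t <= b -> ccont f t) ->
  exists M, 0 <= M /\ forall t, a <= t <= b -> Cmod (f t) <= M.
Proof.
  intros Hab Hf.
  assert (Hc : forall t, a <= t <= b -> continuity_pt (fun t => Cmod (f t)) t).
  { intros t Ht. now apply continuity_pt_filterlim, (continuous_Cmod f t), Hf. }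
  destruct (continuity_ab_maj _ a b Hab Hc) as [m [Hm _]].
  exists (Cmod (f m)). split; [apply Cmod_ge_0 | exact Hm].
Qed.

Lemma ccont_polar_neg (c x t : R) : ccont (fun t => polar c (- (x * t))) t.
Proof.
  apply ccont_pair; apply (ex_derive_continuous (V := R_NormedModule)); auto_derive; auto.
Qed.

Lemma ccont_polar_disc (f : C -> C) (a : C) (r R0 t : R) :
  holomorphic_on (disc a R0) f -> 0 <= r < R0 -> ccont (fun t => f (a + polar r t)%C) t.
Proof.
  intros Hf Hr. apply (ccont_comp f (fun t => a + polar r t)%C).
  - apply Hf. unfold disc. replace (a + polar r t - a)%C with (polar r t) by ring.
    rewrite Cmod_polar, Rabs_pos_eq; lra.
  - apply ccont_plus; [apply ccont_const | apply ccont_polar].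
Qed.

Lemma polar_inv (r t : R) : r <> 0 -> (/ polar r t)%C = polar (/ r) (- t).
Proof.
  intros Hr.
  assert (H : polar r t <> 0).
  { apply Cmod_gt_0. rewrite Cmod_polar. now apply Rabs_pos_lt. }
  assert (E : (polar r t * polar (/ r) (- t))%C = 1).
  { rewrite polar_mult, Rinv_r, Rplus_opp_r by auto.
    unfold polar. rewrite cos_0, sin_0. unfold RtoC. f_equal; ring. }
  replace (polar (/ r) (- t)) with (/ polar r t * (polar r t * polar (/ r) (- t)))%C
    by (field; auto).
  rewrite E. ring.
Qed.

(* The [k]-th Taylor coefficient at [a], as an integral over the circle of radius
   [r]; the second factor is [(r e^{it})^(-k)]. *)
Definition coef (f : C -> C) (a : C) (r : R) (k : nat) : C :=
  (/ (2 * PI) * CInt (fun t => f (a + polar r t) * polar ((/ r) ^ k) (- (INR k * t)))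
                      0 (2 * PI))%C.

Lemma CInt_coef (f : C -> C) (a : C) (r : R) (k : nat) :
  CInt (fun t => f (a + polar r t) * polar ((/ r) ^ k) (- (INR k * t)))%C 0 (2 * PI)
  = (2 * PI * coef f a r k)%C.
Proof.
  unfold coef. assert (HPI := PI_RGT_0).
  assert (RtoC PI <> 0) by (intro E; apply RtoC_inj in E; lra).
  field. auto.
Qed.

(** The function f(z) / (z - a)^(k+1) is holomorphic in the punctured disc, and its integral over
    the circle of radius s * r about [a] is 2 * PI * i times the coefficient. [loop_int_const] with
    v = 0 compares s = 1 with s = rho / r. *)
Lemma coef_radius (f : C -> C) (a : C) (R0 r rho : R) (k : nat) :
  holomorphic_on (disc a R0) f -> 0 < rho <= r -> r < R0 ->
  coef f a r k = coef f a rho k.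
Proof.
  intros Hf Hrho Hr. assert (HPI := PI_RGT_0).
  set (h := fun z : C => (f z * (/ (z - a)) ^ (S k))%C).
  set (s0 := rho / r).
  assert (Hs0 : 0 < s0 <= 1).
  { split; [apply Rdiv_lt_0_compat; lra|].
    apply (Rmult_le_reg_r r); [lra|]. unfold s0. field_simplify; lra. }
  assert (Hpath : forall s t, (path a 0 r s t - a)%C = polar (s * r) t).
  { intros s t. unfold path. rewrite <- RtoC_polar. ring. }
  assert (E : forall s, 0 < s <= 1 -> vside a 0 r h s 0 (2 * PI) =
    (Ci * CInt (fun t => f (a + polar (s * r) t) *
             polar ((/ (s * r)) ^ k) (- (INR k * t))) 0 (2 * PI))%C).
  { intros s Hs. rewrite <- CInt_scal; [|lra|].
    - unfold vside. apply CInt_ext; [lra|]. intros t _.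
      unfold h. rewrite Hpath.
      replace (path a 0 r s t) with (a + polar (s * r) t)%C
        by (rewrite <- Hpath; ring).
      assert (Hsr : s * r <> 0) by nra.
      rewrite Cpow_S, polar_inv, polar_pow by auto.
      replace (INR k * - t) with (- (INR k * t)) by ring.
      replace (s * (Ci * polar r t))%C with (Ci * polar (s * r) t)%C
        by (rewrite <- RtoC_polar; ring).
      set (P := polar ((/ (s * r)) ^ k) (- (INR k * t))).
      replace (f (a + polar (s * r) t) * (polar (/ (s * r)) (- t) * P) *
               (Ci * polar (s * r) t))%C with
        (Ci * (f (a + polar (s * r) t) * P) *
         (polar (/ (s * r)) (- t) * polar (s * r) t))%C by ring.
      rewrite polar_mult, Rinv_l, Rplus_opp_l by auto.
      replace (polar 1 0) with (RtoC 1); [ring|].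
      unfold polar. rewrite cos_0, sin_0. unfold RtoC. f_equal; ring.
    - intros t _. apply ccont_mult; [|apply ccont_polar_neg].
      apply (ccont_polar_disc f a (s * r) R0); auto. nra. }
  assert (G : vside a 0 r h 1 0 (2 * PI) = vside a 0 r h s0 0 (2 * PI)).
  { apply loop_int_const; [lra|lra|]. intros s t Hs Ht.
    assert (Hm : Cmod (path a 0 r s t - a)%C = s * r).
    { rewrite Hpath, Cmod_polar. apply Rabs_pos_eq. nra. }
    apply ex_derive_Cmult.
    - apply Hf. unfold disc. rewrite Hm. nra.
    - apply ex_derive_Cpow, ex_derive_Cinv_sub. intro E'.
      rewrite E' in Hm. replace (a - a)%C with (RtoC 0) in Hm by ring.
      rewrite Cmod_0 in Hm. nra. }
  rewrite (E 1), (E s0) in G by lra.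
  rewrite Rmult_1_l in G. replace (s0 * r) with rho in G by (unfold s0; field; lra).
  rewrite !CInt_coef in G.
  assert (N : RtoC PI <> 0) by (intro E'; apply RtoC_inj in E'; lra).
  replace (coef f a r k) with (/ (Ci * (2 * PI)) * (Ci * (2 * PI * coef f a r k)))%C.
  - rewrite G. field. repeat split; auto using Ci_nz.
  - field. repeat split; auto using Ci_nz.
Qed.

(** The Cauchy estimate, with the extra factor 2 of [CInt_le]. *)
Lemma coef_le (f : C -> C) (a : C) (R0 r M : R) (k : nat) :
  holomorphic_on (disc a R0) f -> 0 < r < R0 ->
  (forall t, 0 <= t <= 2 * PI -> Cmod (f (a + polar r t)%C) <= M) ->
  Cmod (coef f a r k) * r ^ k <= 2 * M.
Proof.
  intros Hf Hr HM. assert (HPI := PI_RGT_0).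
  assert (Hk : 0 < r ^ k) by (apply pow_lt; lra).
  assert (Hk' : 0 < (/ r) ^ k) by (apply pow_lt, Rinv_0_lt_compat; lra).
  assert (Hkk : (/ r) ^ k * r ^ k = 1).
  { rewrite <- Rpow_mult_distr, Rinv_l, pow1; lra. }
  assert (B : Cmod (CInt (fun t => f (a + polar r t) *
      polar ((/ r) ^ k) (- (INR k * t)))%C 0 (2 * PI)) <=
      2 * (M * (/ r) ^ k) * (2 * PI - 0)).
  { apply CInt_le; [lra| |].
    - intros t _. apply ccont_mult; [|apply ccont_polar_neg].
      apply (ccont_polar_disc f a r R0); auto. lra.
    - intros t Ht. rewrite Cmod_mult, Cmod_polar, (Rabs_pos_eq _ (Rlt_le _ _ Hk')).
      apply Rmult_le_compat_r; auto; lra. }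
  rewrite CInt_coef, Cmod_mult, <- RtoC_mult, Cmod_R, Rabs_pos_eq in B by lra.
  assert (Cmod (coef f a r k) <= 2 * (M * (/ r) ^ k)).
  { apply (Rmult_le_reg_l (2 * PI)); lra. }
  apply Rle_trans with (2 * (M * (/ r) ^ k) * r ^ k).
  - apply Rmult_le_compat_r; lra.
  - replace (2 * (M * (/ r) ^ k) * r ^ k) with (2 * M * ((/ r) ^ k * r ^ k)) by ring.
    rewrite Hkk. lra.
Qed.

Fixpoint Csum (u : nat -> C) (n : nat) : C :=
  match n with O => 0 | S n => (Csum u n + u n)%C end.

Lemma Csum_ext (u v : nat -> C) (n : nat) :
  (forall k, u k = v k) -> Csum u n = Csum v n.
Proof. intros H. induction n as [|n IH]; simpl; auto. now rewrite IH, H. Qed.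

Lemma Cmod_le_0 (z : C) : (forall e, 0 < e -> Cmod z <= e) -> z = 0.
Proof.
  intros H. apply Cmod_eq_0. apply Rle_antisym; [|apply Cmod_ge_0].
  apply Rnot_lt_le. intro Hp. specialize (H (Cmod z / 2)). lra.
Qed.

(** * Cauchy's formula and Taylor's theorem with remainder *)

Section Cauchy.

Variables (a w : C) (r : R).
Hypothesis r_pos : 0 < r.
Hypothesis w_in : Cmod (w - a)%C < r.

Let q := Cmod (w - a)%C / r.
Let B := r / (r - Cmod (w - a)%C).

(** With z = a + r e^(it), this is dz / (z - w) divided by i dt. *)
Definition cauchy_kernel (t : R) : C := (polar r t * / (a + polar r t - w))%C.

Lemma kernel_denominator (t : R) : r - Cmod (w - a)%C <= Cmod (a + polar r t - w)%C.
Proof.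
  generalize (Cmod_minus_ge (polar r t) (w - a)%C).
  rewrite Cmod_polar, Rabs_pos_eq by lra.
  replace (polar r t - (w - a))%C with (a + polar r t - w)%C by ring. lra.
Qed.

Lemma kernel_denominator_neq0 (t : R) : (a + polar r t - w)%C <> 0.
Proof. apply Cmod_gt_0. generalize (kernel_denominator t). lra. Qed.

Lemma ccont_kernel (t : R) : ccont cauchy_kernel t.
Proof.
  apply ccont_mult; [apply ccont_polar|].
  apply ccont_inv; [apply kernel_denominator_neq0|].
  apply ccont_minus; [|apply ccont_const].
  apply ccont_plus; [apply ccont_const | apply ccont_polar].
Qed.

Lemma kernel_le (t : R) : Cmod (cauchy_kernel t) <= B.
Proof.
  unfold cauchy_kernel. assert (H := kernel_denominator t).
  rewrite Cmod_mult, Cmod_inv, Cmod_polar, Rabs_pos_eq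
    by (lra || apply kernel_denominator_neq0).
  apply Rmult_le_compat_l; [lra|]. apply Rinv_le_contravar; lra.
Qed.

(** The kernel is 1 / (1 - x) with x = (w - a) / (r e^(it)), and this is the finite geometric
    identity 1 / (1 - x) = 1 + ... + x^(n-1) + x^n / (1 - x). *)
Lemma kernel_expansion (t : R) (n : nat) :
  cauchy_kernel t =
  (Csum (fun k => (w - a) ^ k * polar ((/ r) ^ k) (- (INR k * t))) n
   + (w - a) ^ n * polar ((/ r) ^ n) (- (INR n * t)) * cauchy_kernel t)%C.
Proof.
  induction n as [|n IH].
  - simpl. rewrite Rmult_0_l, Ropp_0.
    replace (polar 1 0) with (RtoC 1); [ring|].
    unfold polar. rewrite cos_0, sin_0. unfold RtoC. f_equal; ring.
  - rewrite IH at 1. simpl Csum.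
    assert (P : polar ((/ r) ^ S n) (- (INR (S n) * t)) =
      (/ polar r t * polar ((/ r) ^ n) (- (INR n * t)))%C).
    { rewrite polar_inv, polar_mult by lra. f_equal. rewrite S_INR. ring. }
    rewrite P, Cpow_S. unfold cauchy_kernel. field.
    split; [apply kernel_denominator_neq0|].
    apply Cmod_gt_0. rewrite Cmod_polar. apply Rabs_pos_lt. lra.
Qed.

(** Keeping the remainder of the finite expansion leaves only finite sums to exchange with the
    integral. It is applied twice: to the constant 1 for [kernel_int], and to the values of f for
    [taylor]. *)
Lemma kernel_int_expansion (g : R -> C) (M : R) (n : nat) :
  (forall t, ccont g t) -> (forall t, 0 <= t <= 2 * PI -> Cmod (g t) <= M) ->
  Cmod (CInt (fun t => g t * cauchy_kernel t)%C 0 (2 * PI) -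
        Csum (fun k => (w - a) ^ k *
          CInt (fun t => g t * polar ((/ r) ^ k) (- (INR k * t))) 0 (2 * PI)) n)%C
  <= 2 * (M * B * q ^ n) * (2 * PI).
Proof.
  intros Hg HM. assert (HPI := PI_RGT_0).
  assert (Hc : forall k t, ccont (fun t => g t * polar ((/ r) ^ k) (- (INR k * t)))%C t).
  { intros k t. apply ccont_mult; auto. apply ccont_polar_neg. }
  assert (HS : forall n t, ccont (fun t => Csum (fun k => (w - a) ^ k *
           (g t * polar ((/ r) ^ k) (- (INR k * t)))) n)%C t).
  { induction n0 as [|m IH]; intros t; simpl; [apply ccont_const|].
    apply ccont_plus; auto. apply ccont_mult; [apply ccont_const | auto]. }
  assert (E : forall n, Csum (fun k => (w - a) ^ k *
          CInt (fun t => g t * polar ((/ r) ^ k) (- (INR k * t))) 0 (2 * PI))%C n =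
        CInt (fun t => Csum (fun k => (w - a) ^ k *
           (g t * polar ((/ r) ^ k) (- (INR k * t)))) n)%C 0 (2 * PI)).
  { induction n0 as [|m IH]; simpl.
    - unfold CInt. rewrite !RInt_const. unfold scal; simpl. unfold mult; simpl.
      unfold RtoC. f_equal; ring.
    - rewrite CInt_plus; [|lra|auto|].
      + rewrite IH, CInt_scal; [reflexivity|lra|auto].
      + intros t _. apply ccont_mult; [apply ccont_const | auto]. }
  rewrite E, <- CInt_minus; [|lra| |auto].
  2:{ intros t _. apply ccont_mult; auto. apply ccont_kernel. }
  replace (2 * PI) with (2 * PI - 0) at 2 by ring.
  assert (D : forall t, (g t * cauchy_kernel t - Csum (fun k => (w - a) ^ k *
           (g t * polar ((/ r) ^ k) (- (INR k * t)))) n)%C =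
     ((w - a) ^ n * (g t * (polar ((/ r) ^ n) (- (INR n * t)) * cauchy_kernel t)))%C).
  { intros t. rewrite (kernel_expansion t n) at 1.
    replace (Csum (fun k => (w - a) ^ k *
           (g t * polar ((/ r) ^ k) (- (INR k * t)))) n)%C with
      (g t * Csum (fun k => (w - a) ^ k * polar ((/ r) ^ k) (- (INR k * t))) n)%C.
    - ring.
    - clear. induction n as [|n IH]; simpl; [ring|]. rewrite <- IH. ring. }
  apply CInt_le; [lra| |].
  - intros t _. apply ccont_minus; auto. apply ccont_mult; auto. apply ccont_kernel.
  - intros t Ht. rewrite D, !Cmod_mult, Cmod_pow, Cmod_polar.
    assert (HB := kernel_le t). assert (HM' := HM t Ht).
    assert (P1 := Cmod_ge_0 (g t)). assert (P2 := Cmod_ge_0 (cauchy_kernel t)).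
    assert (P3 : 0 < (/ r) ^ n) by (apply pow_lt, Rinv_0_lt_compat; lra).
    rewrite (Rabs_pos_eq _ (Rlt_le _ _ P3)).
    assert (Q : q ^ n = Cmod (w - a)%C ^ n * (/ r) ^ n).
    { unfold q, Rdiv. apply Rpow_mult_distr. }
    assert (P4 : 0 <= Cmod (w - a)%C ^ n) by (apply pow_le, Cmod_ge_0).
    rewrite Q.
    replace (Cmod (w - a)%C ^ n * (Cmod (g t) * ((/ r) ^ n * Cmod (cauchy_kernel t))))
      with ((Cmod (g t) * Cmod (cauchy_kernel t)) * (Cmod (w - a)%C ^ n * (/ r) ^ n))
      by ring.
    apply Rmult_le_compat_r; [nra|]. apply Rmult_le_compat; auto.
Qed.

Lemma q_bounds : 0 <= q < 1.
Proof.
  unfold q. split.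
  - apply Rmult_le_pos; [apply Cmod_ge_0|]. left. now apply Rinv_0_lt_compat.
  - apply (Rmult_lt_reg_r r); auto. unfold Rdiv. rewrite Rmult_assoc, Rinv_l; lra.
Qed.

Lemma kernel_int : CInt cauchy_kernel 0 (2 * PI) = (2 * PI)%C.
Proof.
  assert (HPI := PI_RGT_0).
  apply Ceq_minus, Cmod_le_0. intros e He.
  destruct (pow_small (2 * (1 * B) * (2 * PI)) q e q_bounds He) as [n [Hn Hn0]].
  assert (H := kernel_int_expansion (fun _ => 1) 1 n (fun t => ccont_const _ _)).
  assert (E0 : forall k, CInt (fun t => 1 * polar ((/ r) ^ k) (- (INR k * t)))%C 0 (2 * PI)
    = match k with O => (2 * PI)%C | _ => 0 end).
  { intros [|k].
    - transitivity (CInt (fun _ => RtoC 1) 0 (2 * PI)).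
      + apply CInt_ext; [lra|]. intros t _. simpl. rewrite Rmult_0_l, Ropp_0.
        unfold polar. rewrite cos_0, sin_0. unfold RtoC, Cmult; simpl. f_equal; ring.
      + unfold CInt. rewrite !RInt_const. unfold scal; simpl. unfold mult; simpl.
        rewrite <- RtoC_mult. unfold RtoC. f_equal; ring.
    - set (x := INR (S k)). assert (Hx : x <> 0) by (apply not_0_INR; lia).
      set (c := (/ r) ^ S k).
      (* The pair of sine and cosine is a primitive of c e^(-ixt), and has period 2 * PI because [x]
         is an integer. *)
      rewrite (CInt_derive (fun t => (c * / x * sin (x * t), c * / x * cos (x * t))));
        [|lra| | |].
      + replace (x * (2 * PI)) with (0 + 2 * INR (S k) * PI) by (unfold x; ring).
        rewrite sin_period, cos_period, Rmult_0_r. unfold Cminus, Cplus, Copp, RtoC; simpl.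
        f_equal; ring.
      + intros t _. apply ccont_mult; [apply ccont_const | apply ccont_polar_neg].
      + intros t. unfold polar, Cmult, RtoC; simpl. auto_derive; auto.
        rewrite cos_neg, sin_neg. field; auto.
      + intros t. unfold polar, Cmult, RtoC; simpl. auto_derive; auto.
        rewrite cos_neg, sin_neg. field; auto. }
  assert (E1 : Csum (fun k => (w - a) ^ k *
          CInt (fun t => 1 * polar ((/ r) ^ k) (- (INR k * t))) 0 (2 * PI))%C n = (2 * PI)%C).
  { rewrite (Csum_ext _ (fun k => (w - a) ^ k * match k with O => 2 * PI | _ => 0 end)%C)
      by (intros k; rewrite E0; now destruct k).
    destruct n as [|n]; [lia|]. clear Hn Hn0 H. induction n as [|n IH].
    - simpl. ring.
    - change (Csum ?u (S (S n))) with (Csum u (S n) + u (S n))%C. rewrite IH. ring. }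
  cbv beta in H. rewrite E1 in H.
  replace (CInt cauchy_kernel 0 (2 * PI)) with
    (CInt (fun t => 1 * cauchy_kernel t)%C 0 (2 * PI))
    by (apply CInt_ext; [lra|intros; ring]).
  eapply Rle_trans; [apply H|].
  - intros t _. rewrite Cmod_1. lra.
  - left. eapply Rle_lt_trans; [|apply Hn]. right. ring.
Qed.

(** Along the loops shrinking to [w], the factor [s] of dz cancels that of z - w, so the integral of
    f(p s t) against the fixed kernel does not depend on [s]. As [s] tends to 0, f(p s t) tends to
    f(w) uniformly in t, and [kernel_int] gives the value. *)
Lemma cauchy_formula (f : C -> C) (R0 : R) :
  holomorphic_on (disc a R0) f -> r < R0 ->
  CInt (fun t => f (a + polar r t) * cauchy_kernel t)%C 0 (2 * PI) = (2 * PI * f w)%C.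
Proof.
  intros Hf Hr. assert (HPI := PI_RGT_0).
  set (h := fun z : C => (f z * / (z - w))%C).
  set (p := path w (a - w) r).
  assert (Hp : forall s t, (p s t - w)%C = (s * (a + polar r t - w))%C).
  { intros s t. unfold p, path. ring. }
  assert (Hpd : forall s t, 0 <= s <= 1 -> disc a R0 (p s t)).
  { intros s t Hs. unfold disc.
    replace (p s t - a)%C with ((1 - s) * (w - a) + s * polar r t)%C
      by (unfold p, path; ring).
    eapply Rle_lt_trans; [apply Cmod_triangle|].
    rewrite !Cmod_mult, <- RtoC_minus, !Cmod_R, Cmod_polar, !Rabs_pos_eq by lra. nra. }
  assert (Hcp : forall s t, 0 <= s <= 1 -> ccont (fun t => f (p s t)) t).
  { intros s t Hs. apply (ccont_comp f (p s)); [|apply ccont_path_t].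
    apply Hf. now apply Hpd. }
  assert (E : forall s, 0 < s <= 1 -> vside w (a - w)%C r h s 0 (2 * PI) =
    (Ci * CInt (fun t => f (p s t) * cauchy_kernel t) 0 (2 * PI))%C).
  { intros s Hs. rewrite <- CInt_scal; [|lra|].
    - unfold vside. apply CInt_ext; [lra|]. intros t _.
      unfold h. fold p. rewrite Hp. unfold cauchy_kernel. field.
      split; [apply kernel_denominator_neq0|]. intro E. apply RtoC_inj in E. lra.
    - intros t _. apply ccont_mult; [apply Hcp; lra | apply ccont_kernel]. }
  assert (G : forall s, 0 < s <= 1 ->
    CInt (fun t => f (p 1 t) * cauchy_kernel t)%C 0 (2 * PI) =
    CInt (fun t => f (p s t) * cauchy_kernel t)%C 0 (2 * PI)).
  { intros s Hs.
    assert (G : vside w (a - w)%C r h 1 0 (2 * PI) = vside w (a - w)%C r h s 0 (2 * PI)).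
    { apply loop_int_const; [lra|lra|]. intros s' t Hs' Ht.
      apply ex_derive_Cmult.
      - apply Hf, Hpd. lra.
      - apply ex_derive_Cinv_sub. fold p. intro E'. apply Ceq_minus in E'.
        rewrite Hp in E'. revert E'. apply Cmult_neq_0.
        + intro E'. apply RtoC_inj in E'. lra.
        + apply kernel_denominator_neq0. }
    rewrite (E 1), (E s) in G by lra.
    rewrite <- (Cmult_1_l (CInt _ _ _)), <- (Cmult_1_l (CInt (fun t => f (p s t) * _)%C _ _)).
    rewrite <- (Cinv_l Ci Ci_nz), <- !Cmult_assoc, G. reflexivity. }
  rewrite (CInt_ext _ (fun t => f (p 1 t) * cauchy_kernel t)%C); [|lra|].
  2:{ intros t _. do 2 f_equal. unfold p, path. ring. }
  apply Ceq_minus, Cmod_le_0. intros e He.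
  assert (HB : 0 < B) by (apply Rdiv_lt_0_compat; lra).
  assert (Hw : disc a R0 w) by (unfold disc; lra).
  destruct (ex_derive_continuous_Cmod f w (Hf w Hw) (e / (2 * B * (2 * PI)))) as [d [Hd H]].
  { apply Rdiv_lt_0_compat; auto. apply Rmult_lt_0_compat; nra. }
  (* The distance from p s t to [w] is less than 2 * r * s, which is at most d / 2. *)
  set (s := Rmin 1 (d / (4 * r))).
  assert (Hs : 0 < s <= 1 /\ s * (4 * r) <= d).
  { unfold s. split; [split|].
    - apply Rmin_pos; [lra|]. apply Rdiv_lt_0_compat; lra.
    - apply Rmin_l.
    - apply Rle_trans with (d / (4 * r) * (4 * r)).
      + apply Rmult_le_compat_r; [lra | apply Rmin_r].
      + right. field. lra. }
  rewrite (G s) by tauto.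
  replace (2 * PI * f w)%C with (f w * CInt cauchy_kernel 0 (2 * PI))%C
    by (rewrite kernel_int; ring).
  rewrite <- CInt_scal; [|lra|intros; apply ccont_kernel].
  rewrite <- CInt_minus; [|lra| |].
  - replace e with (2 * (e / (2 * B * (2 * PI)) * B) * (2 * PI - 0)) by (field; lra).
    apply CInt_le; [lra| |].
    + intros t _. apply ccont_minus; apply ccont_mult;
        try apply ccont_kernel; [apply Hcp; lra | apply ccont_const].
    + intros t _.
      replace (f (p s t) * cauchy_kernel t - f w * cauchy_kernel t)%C with
        ((f (p s t) - f w) * cauchy_kernel t)%C by ring.
      rewrite Cmod_mult. apply Rmult_le_compat; auto using Cmod_ge_0, kernel_le.
      left. apply H. rewrite Hp, Cmod_mult, Cmod_R, Rabs_pos_eq by lra.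
      assert (Cmod (a + polar r t - w)%C < 2 * r).
      { replace (a + polar r t - w)%C with (polar r t - (w - a))%C by ring.
        unfold Cminus at 1. eapply Rle_lt_trans; [apply Cmod_triangle|].
        rewrite Cmod_opp, Cmod_polar, Rabs_pos_eq; lra. }
      nra.
  - intros t _. apply ccont_mult; [apply Hcp; lra | apply ccont_kernel].
  - intros t _. apply ccont_mult; [apply ccont_const | apply ccont_kernel].
Qed.

Lemma cauchy_bound (f : C -> C) (R0 M : R) :
  holomorphic_on (disc a R0) f -> r < R0 ->
  (forall t, 0 <= t <= 2 * PI -> Cmod (f (a + polar r t)%C) <= M) ->
  Cmod (f w) <= 2 * M * B.
Proof.
  intros Hf Hr HM. assert (HPI := PI_RGT_0).
  assert (H : Cmod (CInt (fun t => f (a + polar r t) * cauchy_kernel t)%C 0 (2 * PI))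
    <= 2 * (M * B) * (2 * PI - 0)).
  { apply CInt_le; [lra| |].
    - intros t _. apply ccont_mult; [|apply ccont_kernel].
      apply (ccont_polar_disc f a r R0); auto. lra.
    - intros t Ht. rewrite Cmod_mult. apply Rmult_le_compat; auto using Cmod_ge_0, kernel_le. }
  rewrite (cauchy_formula f R0), Cmod_mult, <- RtoC_mult, Cmod_R, Rabs_pos_eq in H
    by (auto; lra).
  apply (Rmult_le_reg_l (2 * PI)); lra.
Qed.

Lemma taylor (f : C -> C) (R0 M : R) (n : nat) :
  holomorphic_on (disc a R0) f -> r < R0 ->
  (forall t, 0 <= t <= 2 * PI -> Cmod (f (a + polar r t)%C) <= M) ->
  Cmod (f w - Csum (fun k => coef f a r k * (w - a) ^ k) n)%C <= 2 * (M * B) * q ^ n.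
Proof.
  intros Hf Hr HM. assert (HPI := PI_RGT_0).
  assert (H := kernel_int_expansion (fun t => f (a + polar r t)%C) M n).
  cbv beta in H. rewrite (cauchy_formula f R0 Hf Hr) in H.
  replace (Csum _ n) with (2 * PI * Csum (fun k => coef f a r k * (w - a) ^ k) n)%C in H.
  2:{ clear H. induction n as [|n IH]; simpl; [ring|].
      rewrite <- IH, CInt_coef. ring. }
  replace (2 * PI * f w - 2 * PI * Csum (fun k => coef f a r k * (w - a) ^ k) n)%C
    with (2 * PI * (f w - Csum (fun k => coef f a r k * (w - a) ^ k) n))%C in H by ring.
  rewrite Cmod_mult, <- RtoC_mult, Cmod_R, Rabs_pos_eq in H by lra.
  apply (Rmult_le_reg_l (2 * PI)); [lra|].
  eapply Rle_trans; [apply H; auto|right; ring].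
  intros t. apply (ccont_polar_disc f a r R0); auto. lra.
Qed.

End Cauchy.

(** * Bounds on discs and the identity theorem *)

Lemma circle_bounded (f : C -> C) (a : C) (r R0 : R) :
  holomorphic_on (disc a R0) f -> 0 <= r < R0 ->
  exists M, 0 <= M /\
    forall t, 0 <= t <= 2 * PI -> Cmod (f (a + polar r t)%C) <= M.
Proof.
  intros Hf Hr. assert (HPI := PI_RGT_0).
  apply (ccont_bounded (fun t => f (a + polar r t)%C)); [lra|].
  intros t _. now apply (ccont_polar_disc f a r R0).
Qed.

(** [cauchy_bound] deduces a bound on the disc from one on a larger circle, where the extreme value
    theorem in one real variable applies. *)
Lemma holomorphic_bounded (f : C -> C) (a : C) (rho R0 : R) :
  holomorphic_on (disc a R0) f -> 0 <= rho < R0 ->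
  exists M, 0 <= M /\ forall z, Cmod (z - a)%C <= rho -> Cmod (f z) <= M.
Proof.
  intros Hf Hr. set (r := (rho + R0) / 2).
  destruct (circle_bounded f a r R0 Hf) as [M [HM0 HM]]; [unfold r; lra|].
  exists (2 * M * (r / (r - rho))). split.
  - apply Rmult_le_pos; [lra|]. left. apply Rdiv_lt_0_compat; unfold r; lra.
  - intros z Hz.
    eapply Rle_trans; [apply (cauchy_bound a z r) with (M := M) (R0 := R0)|];
      auto; try (unfold r; lra).
    apply Rmult_le_compat_l; [lra|].
    apply Rmult_le_compat_l; [unfold r; lra|].
    apply Rinv_le_contravar; unfold r; lra.
Qed.

Lemma coef_ext (f g : C -> C) (a : C) (r : R) (k : nat) :
  0 <= r -> (forall z, Cmod (z - a)%C = r -> f z = g z) ->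
  coef f a r k = coef g a r k.
Proof.
  intros Hr H. unfold coef. f_equal. apply CInt_ext; [generalize PI_RGT_0; lra|].
  intros t _. rewrite H; auto.
  replace (a + polar r t - a)%C with (polar r t) by ring.
  rewrite Cmod_polar. now apply Rabs_pos_eq.
Qed.

(** By [coef_radius] the coefficients can be computed on a circle inside the small disc, where f
    vanishes. So all Taylor polynomials are 0, and only the remainder is left. *)
Lemma holomorphic_zero_disc (f : C -> C) (a : C) (e R0 : R) :
  holomorphic_on (disc a R0) f -> 0 < e ->
  (forall z, disc a e z -> f z = 0) -> forall z, disc a R0 z -> f z = 0.
Proof.
  intros Hf He Hz w Hw. unfold disc in *.
  assert (Hm := Cmod_ge_0 (w - a)%C).
  set (r := (Cmod (w - a)%C + R0) / 2).
  assert (Hr : Cmod (w - a)%C < r < R0) by (unfold r; lra).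
  destruct (circle_bounded f a r R0 Hf) as [M [HM0 HM]]; [lra|].
  assert (Hc : forall k, coef f a r k = 0).
  { intros k.
    rewrite (coef_radius f a R0 r (Rmin r (e / 2)));
      [|auto|split; [apply Rmin_pos; lra | apply Rmin_l]|lra].
    rewrite (coef_ext f (fun _ => 0)).
    - unfold coef.
      rewrite (CInt_ext _ (fun _ => 0)) by (try (intros; ring); generalize PI_RGT_0; lra).
      unfold CInt. rewrite !RInt_const. unfold scal; simpl. unfold mult; simpl.
      replace ((2 * PI - 0) * 0, (2 * PI - 0) * 0) with (RtoC 0)
        by (unfold RtoC; f_equal; ring).
      ring.
    - left. apply Rmin_pos; lra.
    - intros z E. apply Hz. rewrite E. generalize (Rmin_r r (e / 2)). lra. }
  apply Cmod_le_0. intros e' He'.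
  assert (Hr0 : 0 < r) by lra.
  destruct (pow_small (2 * (M * (r / (r - Cmod (w - a)%C)))) (Cmod (w - a)%C / r) e')
    as [n [Hn _]]; auto.
  { apply q_bounds; lra. }
  assert (T := taylor a w r Hr0 (proj1 Hr) f R0 M n Hf (proj2 Hr) HM).
  replace (Csum _ n) with (RtoC 0) in T.
  - replace (f w - 0)%C with (f w) in T by ring. lra.
  - clear - Hc. induction n as [|n IH]; simpl; auto. rewrite <- IH, Hc. ring.
Qed.

(* A chain of discs of a common radius, centred on the segment from [a] to [w]. *)
Lemma holomorphic_zero_convex (Om : C -> Prop) (g : C -> C) (a : C) (e : R) :
  open Om -> convex Om -> holomorphic_on Om g -> Om a -> 0 < e ->
  (forall z, disc a e z -> g z = 0) -> forall w, Om w -> g w = 0.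
Proof.
  intros HSo HSc Hg Sa He Hz w Sw.
  destruct (proj1 (open_Cmod Om) HSo a Sa) as [e1 [He1 H1]].
  destruct (proj1 (open_Cmod Om) HSo w Sw) as [e2 [He2 H2]].
  set (r := Rmin e1 e2).
  assert (Hr : 0 < r) by now apply Rmin_pos.
  (* A disc about an intermediate point is the intermediate translate of two discs of the same
     radius about the end points, so convexity puts it into [Om]. *)
  assert (Hdisc : forall t : R, 0 <= t <= 1 ->
    forall z, disc (a + t * (w - a))%C r z -> Om z).
  { intros t Ht z Hd. unfold disc in Hd.
    set (u := (z - (a + t * (w - a)))%C) in *.
    replace z with ((a + u) + t * ((w + u) - (a + u)))%C by (unfold u; ring).
    apply HSc; auto.
    - apply H1. replace (a + u - a)%C with u by ring.
      generalize (Rmin_l e1 e2). fold r. lra.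
    - apply H2. replace (w + u - w)%C with u by ring.
      generalize (Rmin_r e1 e2). fold r. lra. }
  assert (Hm := Cmod_ge_0 (w - a)%C).
  (* N + 1 steps are each shorter than [r], so every new centre is interior to the preceding
     disc. *)
  destruct (nfloor_ex (Cmod (w - a)%C / r)) as [N HN].
  { apply Rmult_le_pos; auto. left. now apply Rinv_0_lt_compat. }
  set (K := INR (N + 1)).
  assert (HK : 0 < K) by (apply lt_0_INR; lia).
  assert (HKr : Cmod (w - a)%C / K < r).
  { apply (Rmult_lt_reg_r K); auto. unfold Rdiv. rewrite Rmult_assoc, Rinv_l by lra.
    destruct HN as [_ HN]. rewrite <- (S_INR N), <- (Nat.add_1_r N) in HN. fold K in HN.
    apply (Rmult_lt_compat_r r) in HN; auto.
    unfold Rdiv in HN. rewrite Rmult_assoc, Rinv_l in HN by lra. lra. }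
  assert (Key : forall j, (j <= N + 1)%nat -> forall z,
    disc (a + (INR j / K)%R * (w - a))%C r z -> g z = 0).
  { assert (Step : forall t : R, 0 <= t <= 1 -> (exists e', 0 < e' /\
        forall z, disc (a + t * (w - a))%C e' z -> g z = 0) ->
        forall z, disc (a + t * (w - a))%C r z -> g z = 0).
    { intros t Ht [e' [He' Hz']].
      apply (holomorphic_zero_disc g (a + t * (w - a))%C e' r); auto.
      intros z Hd. apply Hg. now apply (Hdisc t). }
    assert (HjK : forall j, (j <= N + 1)%nat -> 0 <= INR j / K <= 1).
    { intros j Hj. split.
      - apply Rmult_le_pos; [apply pos_INR|]. left. now apply Rinv_0_lt_compat.
      - apply (Rmult_le_reg_r K); auto. unfold Rdiv.
        rewrite Rmult_assoc, Rinv_l, Rmult_1_r, Rmult_1_l by lra. now apply le_INR. }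
    induction j as [|j IH]; intros Hj.
    - apply Step; [now apply HjK|]. exists e. split; auto.
      intros z Hd. apply Hz. simpl in Hd. unfold Rdiv in Hd. rewrite Rmult_0_l in Hd.
      now replace (a + 0 * (w - a))%C with a in Hd by ring.
    - apply Step; [now apply HjK|].
      set (c := (a + (INR j / K)%R * (w - a))%C) in *.
      set (c' := (a + (INR (S j) / K)%R * (w - a))%C) in *.
      assert (Hcc : Cmod (c' - c)%C = Cmod (w - a)%C / K).
      { unfold c, c'. rewrite S_INR.
        replace (a + ((INR j + 1) / K)%R * (w - a) - (a + (INR j / K)%R * (w - a)))%C
          with ((((INR j + 1) / K)%R - (INR j / K)%R) * (w - a))%C by ring.
        rewrite Cmod_mult, <- RtoC_minus, Cmod_R.
        replace ((INR j + 1) / K - INR j / K) with (/ K) by (field; lra).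
        rewrite Rabs_pos_eq; [unfold Rdiv; ring|].
        left. now apply Rinv_0_lt_compat. }
      exists (r - Cmod (w - a)%C / K). split; [lra|].
      intros z Hd. apply (IH ltac:(lia)). unfold disc in *.
      generalize (Cmod_triangle_minus z c' c). lra. }
  apply (Key (N + 1)%nat (le_n _)). fold K.
  replace (K / K) with 1 by (field; lra).
  replace (a + 1 * (w - a))%C with w by ring. now apply disc_center.
Qed.

(** * Power series with gaps *)

(** The factor 1 - q^j makes the right side the exact geometric sum, which lets the induction
    close. *)
Lemma Csum_tail_le (u : nat -> C) (M q : R) (K j : nat) :
  0 <= q < 1 -> (forall k, Cmod (u k) <= M * q ^ k) ->
  Cmod (Csum u (K + j) - Csum u K)%C <= M * q ^ K / (1 - q) * (1 - q ^ j).
Proof.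
  intros Hq Hu. induction j as [|j IH].
  - rewrite Nat.add_0_r. replace (Csum u K - Csum u K)%C with (RtoC 0) by ring.
    rewrite Cmod_0. simpl. lra.
  - rewrite Nat.add_succ_r. simpl Csum.
    replace (Csum u (K + j) + u (K + j)%nat - Csum u K)%C with
      ((Csum u (K + j) - Csum u K) + u (K + j)%nat)%C by ring.
    eapply Rle_trans; [apply Cmod_triangle|].
    specialize (Hu (K + j)%nat).
    replace (M * q ^ K / (1 - q) * (1 - q ^ S j)) with
      (M * q ^ K / (1 - q) * (1 - q ^ j) + M * q ^ (K + j)).
    + lra.
    + rewrite pow_add. simpl. field. lra.
Qed.

Lemma geometric_bound_ge0 (u : nat -> C) (M q : R) :
  (forall k, Cmod (u k) <= M * q ^ k) -> 0 <= M.
Proof.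
  intros H. specialize (H O). simpl in H. generalize (Cmod_ge_0 (u O)). lra.
Qed.

Lemma Csum_cv (u : nat -> C) (M q : R) :
  0 <= q < 1 -> (forall k, Cmod (u k) <= M * q ^ k) ->
  exists l : C, forall K, Cmod (l - Csum u K)%C <= M * q ^ K / (1 - q).
Proof.
  intros Hq Hu.
  assert (HM := geometric_bound_ge0 u M q Hu).
  assert (Htail : forall K N, (K <= N)%nat ->
    Cmod (Csum u N - Csum u K)%C <= M * q ^ K / (1 - q)).
  { intros K N HKN. replace N with (K + (N - K))%nat by lia.
    eapply Rle_trans; [apply (Csum_tail_le u M q); auto|].
    assert (0 <= q ^ (N - K)) by (apply pow_le; lra).
    assert (0 <= M * q ^ K / (1 - q)).
    { apply Rmult_le_pos; [apply Rmult_le_pos; auto; apply pow_le; lra|].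
      left. apply Rinv_0_lt_compat. lra. }
    nra. }
  assert (Hsmall : forall e, 0 < e -> exists K, M * q ^ K / (1 - q) < e).
  { intros e He. destruct (pow_small (M / (1 - q)) q e Hq He) as [K [HK _]].
    exists K. unfold Rdiv in *. lra. }
  assert (Hcauchy : forall P : C -> R, (forall z w, Rabs (P z - P w) <= Cmod (z - w)%C) ->
     Cauchy_crit (fun N => P (Csum u N))).
  { intros P HP e He. destruct (Hsmall (e / 2)) as [K HK]; [lra|].
    exists K. intros n m Hn Hm. unfold R_dist.
    eapply Rle_lt_trans; [apply HP|].
    eapply Rle_lt_trans; [apply (Cmod_triangle_minus _ (Csum u K))|].
    rewrite (Cmod_minus_sym (Csum u K)).
    generalize (Htail K n Hn) (Htail K m Hm). lra. }
  destruct (Rcomplete.R_complete _ (Hcauchy Re (fun z w => re_le_Cmod (z - w)%C))) as [x Hx].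
  destruct (Rcomplete.R_complete _ (Hcauchy Im (fun z w => Im_le_Cmod (z - w)%C))) as [y Hy].
  exists (x, y). intros K. apply le_epsilon. intros e He.
  destruct (Hx (e / 2)) as [N1 H1]; [lra|].
  destruct (Hy (e / 2)) as [N2 H2]; [lra|].
  set (N := (K + (N1 + N2))%nat).
  specialize (H1 N ltac:(unfold N; lia)). specialize (H2 N ltac:(unfold N; lia)).
  eapply Rle_trans; [apply (Cmod_triangle_minus _ (Csum u N))|].
  generalize (Htail K N ltac:(unfold N; lia)).
  assert (Cmod ((x, y) - Csum u N)%C <= e); [|lra].
  rewrite Cmod_minus_sym.
  eapply Rle_trans; [apply Cmod_le_Re_Im|].
  unfold R_dist in *.
  change (Rabs (Re (Csum u N) - x) + Rabs (Im (Csum u N) - y) <= e). lra.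
Qed.

Lemma sqr_pow_bound (q : R) : 0 <= q < 1 ->
  exists B s, 0 <= B /\ 0 <= s < 1 /\ forall n, INR n ^ 2 * q ^ n <= B * s ^ n.
Proof.
  intros Hq. set (s := 1 - (1 - q) / 3).
  assert (Hs : 0 < s < 1) by (unfold s; lra).
  assert (Hs3 : q <= s ^ 3).
  { assert (E : s ^ 3 - q = (1 - q) ^ 2 * ((8 + q) / 27)) by (unfold s; field).
    assert (0 <= (1 - q) ^ 2 * ((8 + q) / 27)); [|lra].
    apply Rmult_le_pos; [apply pow2_ge_0 | lra]. }
  set (x := / s - 1).
  assert (Hx : 0 < x).
  { unfold x. assert (/ 1 < / s) by (apply Rinv_lt_contravar; lra). lra. }
  exists ((/ x) ^ 2), s. split; [apply pow2_ge_0|]. split; [lra|]. intros n.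
  assert (Hn : INR n * s ^ n <= / x).
  { assert (P := poly n x Hx).
    replace (1 + x) with (/ s) in P by (unfold x; ring).
    assert (Hsn : 0 < s ^ n) by (apply pow_lt; lra).
    assert (E : (/ s) ^ n * s ^ n = 1) by (rewrite <- Rpow_mult_distr, Rinv_l, pow1; lra).
    apply (Rmult_le_reg_l x); auto. rewrite Rinv_r by lra.
    assert (INR n * x * s ^ n <= (/ s) ^ n * s ^ n) by (apply Rmult_le_compat_r; lra).
    lra. }
  apply Rle_trans with (INR n ^ 2 * (s ^ 3) ^ n).
  - apply Rmult_le_compat_l; [apply pow2_ge_0|]. apply pow_incr. lra.
  - replace (INR n ^ 2 * (s ^ 3) ^ n) with ((INR n * s ^ n) ^ 2 * s ^ n).
    + apply Rmult_le_compat_r; [apply pow_le; lra|]. apply pow_incr. split; auto.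
      apply Rmult_le_pos; [apply pos_INR | apply pow_le; lra].
    + rewrite <- pow_mult. replace (3 * n)%nat with (n + n + n)%nat by lia.
      rewrite !pow_add. ring.
Qed.

(** If T_n is the second-order remainder, then T_(n+1) = x T_n + n z^(n-1) (x - z)^2, and n^2 + n <=
    (n+1)^2. The factor rho^2 on the left stands for a division that would be awkward for n < 2 or
    rho = 0. *)
Lemma pow_remainder (z x : C) (rho : R) (n : nat) :
  Cmod z <= rho -> Cmod x <= rho ->
  rho ^ 2 * Cmod (x ^ n - z ^ n - INR n * z ^ pred n * (x - z))%C
  <= INR n ^ 2 * rho ^ n * Cmod (x - z)%C ^ 2.
Proof.
  intros Hz Hx. assert (Hr : 0 <= rho) by (generalize (Cmod_ge_0 z); lra).
  set (D := Cmod (x - z)%C). assert (HD : 0 <= D) by apply Cmod_ge_0.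
  induction n as [|n IH].
  - simpl. replace (1 - 1 - 0 * 1 * (x - z))%C with (RtoC 0) by ring.
    rewrite Cmod_0. lra.
  - assert (E : (x ^ S n - z ^ S n - INR (S n) * z ^ pred (S n) * (x - z))%C =
      (x * (x ^ n - z ^ n - INR n * z ^ pred n * (x - z))
       + INR n * z ^ pred n * (x - z) * (x - z))%C).
    { destruct n as [|n].
      - simpl. ring.
      - rewrite (S_INR (S n)), RtoC_plus. simpl pred. rewrite !Cpow_S. ring. }
    rewrite E. set (T := (x ^ n - z ^ n - INR n * z ^ pred n * (x - z))%C) in *.
    assert (HT := Cmod_ge_0 T).
    assert (Hp : rho ^ 2 * (INR n * Cmod z ^ pred n) <= INR n * rho ^ S n).
    { destruct n as [|n]; [simpl; lra|]. simpl pred.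
      assert (Cmod z ^ n <= rho ^ n).
      { apply pow_incr. split; [apply Cmod_ge_0 | auto]. }
      assert (Hn := pos_INR (S n)).
      replace (INR (S n) * rho ^ S (S n)) with (rho ^ 2 * (INR (S n) * rho ^ n))
        by (simpl; ring).
      apply Rmult_le_compat_l; [apply pow2_ge_0|].
      apply Rmult_le_compat_l; auto. }
    apply Rle_trans with (rho ^ 2 * (Cmod x * Cmod T + INR n * Cmod z ^ pred n * D * D)).
    + apply Rmult_le_compat_l; [apply pow2_ge_0|].
      eapply Rle_trans; [apply Cmod_triangle|].
      rewrite !Cmod_mult, Cmod_pow, Cmod_R, (Rabs_pos_eq (INR n)) by apply pos_INR.
      fold D. lra.
    + assert (A1 : Cmod x * (rho ^ 2 * Cmod T) <= rho * (INR n ^ 2 * rho ^ n * D ^ 2)).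
      { apply Rmult_le_compat; auto using Cmod_ge_0.
        apply Rmult_le_pos; auto. apply pow2_ge_0. }
      assert (A2 : rho ^ 2 * (INR n * Cmod z ^ pred n) * D ^ 2 <= INR n * rho ^ S n * D ^ 2).
      { apply Rmult_le_compat_r; auto. apply pow2_ge_0. }
      assert (A3 : 0 <= rho ^ S n * D ^ 2 * (INR n + 1)).
      { apply Rmult_le_pos; [apply Rmult_le_pos; [apply pow_le; auto | apply pow2_ge_0]|].
        generalize (pos_INR n). lra. }
      rewrite S_INR. simpl in *. nra.
Qed.

Section PowerSeries.

Variables (a : C) (c : nat -> C) (n : nat -> nat) (R0 M : R).
Hypothesis R0_pos : 0 < R0.
Hypothesis n_ge : forall k, (k <= n k)%nat.
Hypothesis c_le : forall k, Cmod (c k) * R0 ^ n k <= M.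

Definition term (z : C) (k : nat) : C := (c k * (z - a) ^ n k)%C.

Lemma coefficient_pow_le (rho : R) (k : nat) :
  0 <= rho -> Cmod (c k) * rho ^ n k <= M * (rho / R0) ^ n k.
Proof.
  intros Hr.
  assert (HR : 0 < R0 ^ n k) by now apply pow_lt.
  replace (rho ^ n k) with (R0 ^ n k * (rho / R0) ^ n k).
  - rewrite <- Rmult_assoc. apply Rmult_le_compat_r; auto.
    apply pow_le. apply Rmult_le_pos; auto. left. now apply Rinv_0_lt_compat.
  - rewrite <- Rpow_mult_distr. f_equal. field. lra.
Qed.

Lemma M_ge0 : 0 <= M.
Proof.
  eapply Rle_trans; [|apply (c_le 0)].
  apply Rmult_le_pos; [apply Cmod_ge_0|]. left. now apply pow_lt.
Qed.

Lemma pow_antitone (q : R) (i j : nat) : 0 <= q < 1 -> (i <= j)%nat -> q ^ j <= q ^ i.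
Proof.
  intros Hq Hij. replace j with (i + (j - i))%nat by lia. rewrite pow_add.
  assert (0 <= q ^ i) by (apply pow_le; lra).
  assert (q ^ (j - i) <= 1).
  { rewrite <- (pow1 (j - i)). apply pow_incr. lra. }
  nra.
Qed.

Lemma ratio_bounds (rho : R) : 0 <= rho < R0 -> 0 <= rho / R0 < 1.
Proof.
  intros H. split.
  - apply Rmult_le_pos; [lra|]. left. now apply Rinv_0_lt_compat.
  - apply (Rmult_lt_reg_r R0); auto. unfold Rdiv. rewrite Rmult_assoc, Rinv_l; lra.
Qed.

Lemma term_le (z : C) (k : nat) :
  Cmod (z - a)%C < R0 -> Cmod (term z k) <= M * (Cmod (z - a)%C / R0) ^ k.
Proof.
  intros Hz. unfold term. rewrite Cmod_mult, Cmod_pow.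
  eapply Rle_trans; [apply coefficient_pow_le, Cmod_ge_0|].
  apply Rmult_le_compat_l; [apply M_ge0|].
  apply pow_antitone; auto. apply ratio_bounds. split; auto. apply Cmod_ge_0.
Qed.

(** Exponents [n k] with k <= n k cover both the lacunary series and ordinary Taylor series.
    Differentiability comes from comparison with the termwise derivative, with a quadratic error
    uniform near z. *)
Lemma power_series :
  exists F : C -> C, holomorphic_on (disc a R0) F /\
    forall z, disc a R0 z -> forall K,
      Cmod (F z - Csum (term z) K)%C <=
      M * (Cmod (z - a)%C / R0) ^ K / (1 - Cmod (z - a)%C / R0).
Proof.
  (* The condition on z stands under the existential so that choice yields a total function. *)
  assert (H : forall z, exists l, disc a R0 z -> forall K,
      Cmod (l - Csum (term z) K)%C <=
      M * (Cmod (z - a)%C / R0) ^ K / (1 - Cmod (z - a)%C / R0)).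
  { intros z. destruct (classic (disc a R0 z)) as [Hz|Hz].
    - destruct (Csum_cv (term z) M (Cmod (z - a)%C / R0)) as [l Hl].
      + apply ratio_bounds. split; auto. apply Cmod_ge_0.
      + intros k. now apply term_le.
      + now exists l.
    - exists 0. tauto. }
  set (F := fun z => proj1_sig (constructive_indefinite_description _ (H z))).
  assert (HF : forall z, disc a R0 z -> forall K,
      Cmod (F z - Csum (term z) K)%C <=
      M * (Cmod (z - a)%C / R0) ^ K / (1 - Cmod (z - a)%C / R0)).
  { intros z. unfold F. now destruct (constructive_indefinite_description _ (H z)). }
  exists F. split; auto. clearbody F. clear H.
  assert (HFsmall : forall z, disc a R0 z -> forall e, 0 < e -> exists K0, forall K, (K0 <= K)%nat ->
    Cmod (F z - Csum (term z) K)%C <= e).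
  { intros z Hz e He.
    assert (Hq := ratio_bounds _ (conj (Cmod_ge_0 (z - a)%C) Hz)).
    destruct (pow_small (M / (1 - Cmod (z - a)%C / R0)) _ e Hq He) as [K0 [HK0 _]].
    exists K0. intros K HK. eapply Rle_trans; [now apply HF|].
    assert (P := pow_antitone _ _ _ Hq HK).
    assert (0 <= M / (1 - Cmod (z - a)%C / R0)).
    { apply Rmult_le_pos; [apply M_ge0|]. left. apply Rinv_0_lt_compat. lra. }
    apply (Rmult_le_compat_l _ _ _ H) in P. unfold Rdiv in *. lra. }
  intros z Hz. unfold disc in Hz.
  assert (Hz0 := Cmod_ge_0 (z - a)%C).
  (* A radius strictly between |z - a| and R0: it leaves room for a neighbourhood of z, and the
     terms at radius [rho] decay geometrically even after multiplication by (n k)^2. *)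
  set (rho := (Cmod (z - a)%C + R0) / 2).
  assert (Hrho : Cmod (z - a)%C < rho < R0 /\ 0 < rho) by (unfold rho; lra).
  destruct (sqr_pow_bound (rho / R0)) as [B [s [HB [Hs HBs]]]].
  { apply ratio_bounds; lra. }
  assert (HM := M_ge0).
  assert (Hcn : forall k, INR (n k) ^ 2 * (Cmod (c k) * rho ^ n k) <= M * B * s ^ k).
  { intros k. eapply Rle_trans.
    - apply Rmult_le_compat_l; [apply pow2_ge_0 | apply coefficient_pow_le; lra].
    - replace (INR (n k) ^ 2 * (M * (rho / R0) ^ n k)) with
        (M * (INR (n k) ^ 2 * (rho / R0) ^ n k)) by ring.
      rewrite Rmult_assoc. apply Rmult_le_compat_l; auto.
      eapply Rle_trans; [apply HBs|]. apply Rmult_le_compat_l; auto.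
      apply pow_antitone; auto. }
  set (v := fun k => (c k * (INR (n k) * (z - a) ^ pred (n k)))%C).
  assert (Hv : forall k, Cmod (v k) <= M * B / rho * s ^ k).
  { intros k. unfold v. rewrite !Cmod_mult, Cmod_pow, Cmod_R, Rabs_pos_eq by apply pos_INR.
    apply (Rmult_le_reg_l rho); [lra|].
    replace (rho * (M * B / rho * s ^ k)) with (M * B * s ^ k) by (field; lra).
    eapply Rle_trans; [|apply Hcn].
    assert (Hc := Cmod_ge_0 (c k)).
    destruct (n k) as [|m]; [simpl; lra|]. simpl pred.
    assert (P : Cmod (z - a)%C ^ m <= rho ^ m) by (apply pow_incr; lra).
    assert (P1 : 0 <= rho ^ m) by (apply pow_le; lra).
    assert (N1 : 1 <= INR (S m)) by (rewrite S_INR; generalize (pos_INR m); lra).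
    replace (rho * (Cmod (c k) * (INR (S m) * Cmod (z - a)%C ^ m))) with
      ((Cmod (c k) * rho * INR (S m)) * Cmod (z - a)%C ^ m) by ring.
    apply Rle_trans with ((Cmod (c k) * rho * INR (S m)) * rho ^ m).
    - apply Rmult_le_compat_l; auto.
      apply Rmult_le_pos; [apply Rmult_le_pos|]; lra.
    - replace (INR (S m) ^ 2 * (Cmod (c k) * rho ^ S m)) with
        (Cmod (c k) * rho * INR (S m) * rho ^ m * INR (S m)) by (simpl; ring).
      assert (0 <= Cmod (c k) * rho * INR (S m) * rho ^ m).
      { apply Rmult_le_pos; auto. apply Rmult_le_pos; [apply Rmult_le_pos|]; lra. }
      nra. }
  destruct (Csum_cv v (M * B / rho) s Hs Hv) as [l Hl].
  assert (Hlsmall : forall e, 0 < e -> exists K0, forall K, (K0 <= K)%nat ->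
    Cmod (l - Csum v K)%C <= e).
  { intros e He.
    destruct (pow_small (M * B / rho / (1 - s)) s e Hs He) as [K0 [HK0 _]].
    exists K0. intros K HK. eapply Rle_trans; [apply Hl|].
    assert (P := pow_antitone _ _ _ Hs HK).
    assert (0 <= M * B / rho / (1 - s)).
    { repeat apply Rmult_le_pos; auto; left; apply Rinv_0_lt_compat; lra. }
    apply (Rmult_le_compat_l _ _ _ H) in P. unfold Rdiv in *. lra. }
  set (Q := M * B / rho ^ 2 / (1 - s)).
  assert (Hrho2 : 0 < rho ^ 2) by (apply pow_lt; lra).
  assert (HQ : 0 <= Q).
  { unfold Q. repeat apply Rmult_le_pos; auto; left; apply Rinv_0_lt_compat; lra. }
  assert (Key : forall x, Cmod (x - a)%C <= rho ->
    Cmod (F x - F z - l * (x - z))%C <= Q * Cmod (x - z)%C ^ 2).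
  { intros x Hx. apply le_epsilon. intros e He.
    set (D := Cmod (x - z)%C). assert (HD : 0 <= D) by apply Cmod_ge_0.
    destruct (HFsmall x) with (e := e / 3) as [K1 H1]; [unfold disc; lra|lra|].
    destruct (HFsmall z) with (e := e / 3) as [K2 H2]; [unfold disc; lra|lra|].
    destruct (Hlsmall (e / (3 * (D + 1)))) as [K3 H3]; [apply Rdiv_lt_0_compat; lra|].
    set (K := (K1 + K2 + K3)%nat).
    specialize (H1 K ltac:(unfold K; lia)). specialize (H2 K ltac:(unfold K; lia)).
    specialize (H3 K ltac:(unfold K; lia)).
    assert (HK : Cmod (Csum (term x) K - Csum (term z) K - Csum v K * (x - z))%C
                 <= Q * D ^ 2).
    { set (u := fun k => (term x k - term z k - v k * (x - z))%C).
      replace (Csum (term x) K - Csum (term z) K - Csum v K * (x - z))%C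
        with (Csum u K).
      2:{ clear. induction K as [|K IH]; simpl; [ring|]. rewrite IH. unfold u. ring. }
      assert (Hu : forall k, Cmod (u k) <= M * B / rho ^ 2 * D ^ 2 * s ^ k).
      { intros k. unfold u, term, v.
        replace (c k * (x - a) ^ n k - c k * (z - a) ^ n k -
                 c k * (INR (n k) * (z - a) ^ pred (n k)) * (x - z))%C with
          (c k * ((x - a) ^ n k - (z - a) ^ n k
             - INR (n k) * (z - a) ^ pred (n k) * ((x - a) - (z - a))))%C by ring.
        rewrite Cmod_mult. apply (Rmult_le_reg_l (rho ^ 2)); auto.
        assert (P := pow_remainder (z - a)%C (x - a)%C rho (n k) ltac:(lra) Hx).
        replace (x - a - (z - a))%C with (x - z)%C in * by ring. fold D in P.
        apply (Rmult_le_compat_l (Cmod (c k))) in P; [|apply Cmod_ge_0].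
        specialize (Hcn k).
        apply (Rmult_le_compat_r (D ^ 2)) in Hcn; [|apply pow2_ge_0].
        replace (rho ^ 2 * (M * B / rho ^ 2 * D ^ 2 * s ^ k)) with
          (M * B * s ^ k * D ^ 2) by (field; lra).
        lra. }
      assert (T := Csum_tail_le u _ s 0 K Hs Hu).
      change (Csum u 0) with (RtoC 0) in T.
      replace (Csum u (0 + K) - 0)%C with (Csum u K) in T by (simpl Nat.add; ring).
      eapply Rle_trans; [apply T|].
      assert (0 <= s ^ K) by (apply pow_le; lra).
      replace (M * B / rho ^ 2 * D ^ 2 * s ^ 0 / (1 - s)) with (Q * D ^ 2)
        by (unfold Q; simpl; field; lra).
      assert (0 <= Q * D ^ 2) by (apply Rmult_le_pos; auto; apply pow2_ge_0).
      nra. }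
    replace (F x - F z - l * (x - z))%C with
      ((Csum (term x) K - Csum (term z) K - Csum v K * (x - z)) +
       ((F x - Csum (term x) K) + (- (F z - Csum (term z) K) +
         - ((l - Csum v K) * (x - z)))))%C by ring.
    eapply Rle_trans; [apply Cmod_triangle|].
    apply Rplus_le_compat; auto.
    eapply Rle_trans; [apply Cmod_triangle|].
    eapply Rle_trans; [apply Rplus_le_compat_l, Cmod_triangle|].
    rewrite !Cmod_opp, Cmod_mult. fold D.
    assert (Cmod (l - Csum v K)%C * D <= e / (3 * (D + 1)) * (D + 1)).
    { apply Rmult_le_compat; auto using Cmod_ge_0. lra. }
    replace (e / (3 * (D + 1)) * (D + 1)) with (e / 3) in H by (field; lra).
    lra. }
  apply ex_derive_Cmod. exists l. intros e He.
  exists (Rmin (rho - Cmod (z - a)%C) (e / (Q + 1))). split.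
  { apply Rmin_pos; [lra|]. apply Rdiv_lt_0_compat; lra. }
  intros x Hx.
  assert (X1 := Rlt_le_trans _ _ _ Hx (Rmin_l _ _)).
  assert (X2 := Rlt_le_trans _ _ _ Hx (Rmin_r _ _)).
  eapply Rle_trans; [apply Key|].
  - generalize (Cmod_triangle_minus x z a). lra.
  - set (D := Cmod (x - z)%C) in *. assert (HD : 0 <= D) by apply Cmod_ge_0.
    apply (Rmult_lt_compat_l (Q + 1)) in X2; [|lra].
    replace ((Q + 1) * (e / (Q + 1))) with e in X2 by (field; lra).
    replace (Q * D ^ 2) with (Q * D * D) by ring.
    apply Rmult_le_compat_r; auto. nra.
Qed.

End PowerSeries.

(** * A lacunary series *)

Lemma rpow_ge0 (x p : R) : 0 <= rpow x p.
Proof. unfold rpow. destruct (Rlt_dec 0 x); [left; apply exp_pos | lra]. Qed.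

Lemma rpow_le (x y p : R) : 0 < p -> x <= y -> rpow x p <= rpow y p.
Proof.
  intros Hp Hxy. unfold rpow. destruct (Rlt_dec 0 x), (Rlt_dec 0 y); try lra.
  - apply Rle_Rpower_l; lra.
  - left. apply exp_pos.
Qed.

Lemma rpow_mult (x y p : R) : 0 <= x -> 0 <= y -> rpow (x * y) p = rpow x p * rpow y p.
Proof.
  intros Hx Hy. unfold rpow.
  destruct (Rlt_dec 0 x), (Rlt_dec 0 y), (Rlt_dec 0 (x * y)); try nra.
  symmetry. now apply Rpower_mult_distr.
Qed.

Lemma rpow_small (p e : R) : 0 < p -> 0 < e ->
  exists d, 0 < d /\ forall x, x < d -> rpow x p < e.
Proof.
  intros Hp He. exists (Rpower e (/ p)). split; [apply exp_pos|].
  intros x Hx. unfold rpow. destruct (Rlt_dec 0 x); auto.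
  replace e with (Rpower (Rpower e (/ p)) p).
  - apply Rlt_Rpower_l; auto.
  - rewrite Rpower_mult, Rinv_l, Rpower_1; lra.
Qed.

Lemma continuous_rpow (p x : R) : 0 < p -> continuous (fun y => rpow y p) x.
Proof.
  intros Hp. destruct (Rlt_or_le 0 x) as [Hx|Hx].
  - apply (continuous_ext_loc _ (fun y => exp (p * ln y))).
    + exists (mkposreal x Hx). intros y Hy.
      change (Rabs (y - x) < x) in Hy. apply Rabs_def2 in Hy.
      unfold rpow. destruct (Rlt_dec 0 y); [reflexivity | lra].
    + apply (ex_derive_continuous (V := R_NormedModule)). auto_derive. auto.
  - apply continuous_Rabs. intros e He. destruct (rpow_small p e Hp He) as [d [Hd H]].
    exists d. split; auto. intros u Hu.
    replace (rpow x p) with 0 by (unfold rpow; destruct (Rlt_dec 0 x); lra).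
    rewrite Rminus_0_r, Rabs_pos_eq by apply rpow_ge0. apply H.
    apply Rabs_def2 in Hu. lra.
Qed.

Lemma polar_unit_disc (r t : R) : 0 <= r < 1 -> unit_disc (polar r t).
Proof. intros H. unfold unit_disc. rewrite Cmod_polar, Rabs_pos_eq; lra. Qed.

Lemma continuous_rpow_polar (f : C -> C) (p r t : R) :
  0 < p -> 0 <= r < 1 -> holomorphic_on unit_disc f ->
  continuous (fun t => rpow (Cmod (f (polar r t))) p) t.
Proof.
  intros Hp Hr Hf.
  apply (continuous_comp (fun t => Cmod (f (polar r t))) (fun y => rpow y p)).
  - apply (continuous_Cmod (fun t => f (polar r t))).
    apply (ccont_comp f (polar r)); [|apply ccont_polar].
    apply Hf. now apply polar_unit_disc.
  - now apply continuous_rpow.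
Qed.

Lemma ex_RInt_rpow_polar (f : C -> C) (p r a b : R) :
  0 < p -> 0 <= r < 1 -> holomorphic_on unit_disc f ->
  ex_RInt (fun t => rpow (Cmod (f (polar r t))) p) a b.
Proof.
  intros Hp Hr Hf. apply (ex_RInt_continuous (V := R_CompleteNormedModule)).
  intros t _. now apply continuous_rpow_polar.
Qed.

Lemma exp_monotone (x y : R) : x <= y -> exp x <= exp y.
Proof.
  intros [H| ->]; [left; now apply exp_increasing | apply Rle_refl].
Qed.

(** The inequality ln y < y at y = x / (2p) gives the constant (2p)^p. The exponent x / 2 is what
    [exp_half_sum_le] can split between real and imaginary parts. *)
Lemma rpow_le_exp (p : R) : 0 < p ->
  exists A, 0 < A /\ forall x, 0 <= x -> rpow x p <= A * exp (x / 2).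
Proof.
  intros Hp. exists (exp (p * ln (2 * p))). split; [apply exp_pos|].
  intros x Hx. unfold rpow. destruct (Rlt_dec 0 x) as [H|H].
  - unfold Rpower. rewrite <- exp_plus. apply exp_monotone.
    assert (Hy : 0 < x / (2 * p)) by (apply Rdiv_lt_0_compat; lra).
    assert (L : ln (x / (2 * p)) < x / (2 * p)).
    { apply exp_lt_inv. rewrite exp_ln by auto.
      assert (E := exp_ineq1_le (x / (2 * p))). lra. }
    rewrite ln_div in L by lra.
    apply (Rmult_lt_compat_l p) in L; auto.
    replace (p * (x / (2 * p))) with (x / 2) in L by (field; lra). lra.
  - apply Rmult_le_pos; left; apply exp_pos.
Qed.

(** Squaring 1 - x/2 <= exp(-x/2) gives exp x <= (1 - x/2)^(-2), and (1 + x + 2 x^2)(1 - x/2)^2 - 1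
    = x^2 (1 - x)(5/2 - x)/2 is nonnegative here. *)
Lemma exp_le_quadratic (x : R) : -1 <= x <= 1 -> exp x <= 1 + x + 2 * x ^ 2.
Proof.
  intros Hx.
  assert (E := exp_ineq1_le (- x / 2)).
  assert (H1 : 0 < 1 + - x / 2) by lra.
  assert (P : exp x * (exp (- x / 2) * exp (- x / 2)) = 1).
  { rewrite <- !exp_plus. replace (x + (- x / 2 + - x / 2)) with 0 by field. apply exp_0. }
  assert (Q : exp x * ((1 + - x / 2) * (1 + - x / 2)) <= 1).
  { rewrite <- P. apply Rmult_le_compat_l; [left; apply exp_pos|].
    apply Rmult_le_compat; lra. }
  assert (S : 1 <= (1 + x + 2 * x ^ 2) * ((1 + - x / 2) * (1 + - x / 2))).
  { assert (0 <= x ^ 2 * ((1 - x) * (5 / 2 - x) / 2)).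
    { apply Rmult_le_pos; [apply pow2_ge_0|]. nra. }
    lra. }
  assert (0 < (1 + - x / 2) * (1 + - x / 2)) by nra.
  apply (Rmult_le_reg_r ((1 + - x / 2) * (1 + - x / 2))); lra.
Qed.

Fixpoint Rsum (u : nat -> R) (n : nat) : R :=
  match n with O => 0 | S n => Rsum u n + u n end.

Lemma Rsum_S (u : nat -> R) (n : nat) : Rsum u (S n) = Rsum u n + u n.
Proof. reflexivity. Qed.

(** * Riesz products and exponential moments of lacunary cosine sums *)

Section Riesz.

Variables (b : nat -> R) (phi alpha : R).
Hypothesis b_bounds : forall k, 0 <= b k <= / INR (S k).

Definition freq (k : nat) : R := INR (3 ^ k).

(** Each factor is the bound of [exp_le_quadratic] for x = b cos(...), with x^2 replaced by b^2. *)
Fixpoint riesz (K : nat) (t : R) : R :=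
  match K with
  | O => 1
  | S K => riesz K t * (1 + 2 * b K ^ 2 + b K * cos (freq K * t + phi))
  end.

(** The mean of the Riesz product over a period, by [riesz_integral]. *)
Fixpoint riesz_mass (K : nat) : R :=
  match K with
  | O => 1
  | S K => riesz_mass K * (1 + 2 * b K ^ 2)
  end.

(** The frequencies of [riesz K] are at most 1 + 3 + ... + 3^(K-1) = (3^K - 1) / 2, which is less
    than m. In the induction the new cosine shifts m by 3^K up or down, and 3^(K+1) <= 2m still
    leaves 3^K <= 2(m - 3^K). *)
Lemma riesz_orthogonal (K m : nat) (psi : R) :
  (3 ^ K <= 2 * m)%nat ->
  is_RInt (fun t => riesz K t * cos (INR m * t + psi)) alpha (alpha + 2 * PI) 0.
Proof.
  revert m psi. induction K as [|K IH]; intros m psi Hm.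
  - simpl in Hm. assert (Hm0 : INR m <> 0) by (apply not_0_INR; lia).
    set (F := fun t => sin (INR m * t + psi) / INR m).
    replace 0 with (minus (F (alpha + 2 * PI)) (F alpha)).
    + apply (is_RInt_derive (V := R_CompleteNormedModule) F).
      * intros t _. unfold F. auto_derive; auto. simpl. field. auto.
      * intros t _. apply (ex_derive_continuous (V := R_NormedModule)).
        simpl. auto_derive. auto.
    + unfold F, minus, plus, opp; simpl.
      replace (INR m * (alpha + 2 * PI) + psi) with
        (INR m * alpha + psi + 2 * INR m * PI) by ring.
      rewrite sin_period. ring.
  - assert (Hp : (3 ^ S K = 3 * 3 ^ K)%nat) by reflexivity.
    assert (I1 := IH m psi ltac:(lia)).
    assert (I2 := IH (m - 3 ^ K)%nat (psi - phi) ltac:(lia)).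
    assert (I3 := IH (m + 3 ^ K)%nat (psi + phi) ltac:(lia)).
    apply (is_RInt_scal (V := R_NormedModule) _ _ _ (1 + 2 * b K ^ 2)) in I1.
    apply (is_RInt_scal (V := R_NormedModule) _ _ _ (b K / 2)) in I2.
    apply (is_RInt_scal (V := R_NormedModule) _ _ _ (b K / 2)) in I3.
    assert (I := is_RInt_plus _ _ _ _ _ _ I1 (is_RInt_plus _ _ _ _ _ _ I2 I3)).
    replace 0 with (plus (scal (1 + 2 * b K ^ 2) 0) (plus (scal (b K / 2) 0) (scal (b K / 2) 0))).
    + revert I. apply is_RInt_ext. intros t _.
      unfold plus, scal; simpl. unfold mult; simpl. fold (freq K).
      rewrite minus_INR, plus_INR by lia. fold (freq K).
      replace ((INR m - freq K) * t + (psi - phi)) with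
        ((INR m * t + psi) - (freq K * t + phi)) by ring.
      replace ((INR m + freq K) * t + (psi + phi)) with
        ((INR m * t + psi) + (freq K * t + phi)) by ring.
      rewrite (cos_minus (INR m * t + psi)), (cos_plus (INR m * t + psi)). field.
    + unfold plus, scal; simpl. unfold mult; simpl. ring.
Qed.

Lemma riesz_integral (K : nat) :
  is_RInt (riesz K) alpha (alpha + 2 * PI) (2 * PI * riesz_mass K).
Proof.
  induction K as [|K IH].
  - simpl. replace (2 * PI * 1) with (scal (alpha + 2 * PI - alpha) 1).
    + apply (is_RInt_const (V := R_NormedModule)).
    + unfold scal; simpl. unfold mult; simpl. ring.
  - assert (I := riesz_orthogonal K (3 ^ K) phi ltac:(lia)).
    apply (is_RInt_scal (V := R_NormedModule) _ _ _ (1 + 2 * b K ^ 2)) in IH.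
    apply (is_RInt_scal (V := R_NormedModule) _ _ _ (b K)) in I.
    assert (J := is_RInt_plus _ _ _ _ _ _ IH I).
    replace (2 * PI * riesz_mass (S K)) with
      (plus (scal (1 + 2 * b K ^ 2) (2 * PI * riesz_mass K)) (scal (b K) 0)).
    + revert J. apply is_RInt_ext. intros t _.
      unfold plus, scal; simpl. unfold mult; simpl. unfold freq. ring.
    + unfold plus, scal; simpl. unfold mult; simpl. ring.
Qed.

Lemma riesz_mass_le (K : nat) : 0 < riesz_mass K <= exp 4.
Proof.
  (* The strengthened bound telescopes: 2 / (x+1)^2 <= 4 / (x+1) - 4 / (x+2). *)
  assert (H : 0 < riesz_mass K <= exp (4 - 4 / INR (S K))).
  { induction K as [|K IH].
    - simpl. replace (4 - 4 / 1) with 0 by field. rewrite exp_0. lra.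
    - simpl riesz_mass. assert (Hb := b_bounds K).
      assert (Hb2 : 0 <= b K ^ 2 <= (/ INR (S K)) ^ 2).
      { split; [apply pow2_ge_0 | apply pow_incr; auto]. }
      split; [apply Rmult_lt_0_compat; lra|].
      apply Rle_trans with (exp (4 - 4 / INR (S K)) * exp (2 * b K ^ 2)).
      + apply Rmult_le_compat; try lra. apply exp_ineq1_le.
      + rewrite <- exp_plus. apply exp_monotone.
        assert (P := pos_INR K). rewrite !S_INR in *.
        set (x := INR K) in *.
        assert (D : 4 / (x + 1) - 4 / (x + 1 + 1) - 2 * (/ (x + 1)) ^ 2 =
                    2 * x / ((x + 1) ^ 2 * (x + 2))) by (field; lra).
        assert (0 <= 2 * x / ((x + 1) ^ 2 * (x + 2))).
        { apply Rmult_le_pos; [lra|]. left. apply Rinv_0_lt_compat.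
          apply Rmult_lt_0_compat; [apply pow_lt|]; lra. }
        lra. }
  split; [apply H|]. apply Rle_trans with (1 := proj2 H). apply exp_monotone.
  assert (0 < 4 / INR (S K)); [|lra].
  apply Rdiv_lt_0_compat; [lra|]. apply lt_0_INR. lia.
Qed.

Definition cos_sum (K : nat) (t : R) : R :=
  Rsum (fun k => b k * cos (freq k * t + phi)) K.

Lemma exp_cos_sum_le (K : nat) (t : R) : exp (cos_sum K t) <= riesz K t.
Proof.
  unfold cos_sum. induction K as [|K IH]; simpl.
  - rewrite exp_0. lra.
  - rewrite exp_plus. set (x := b K * cos (freq K * t + phi)) in *.
    assert (Hb := b_bounds K).
    assert (Hb1 : b K <= 1).
    { apply Rle_trans with (1 := proj2 Hb). rewrite <- Rinv_1.
      apply Rinv_le_contravar; [lra|]. rewrite S_INR. generalize (pos_INR K). lra. }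
    assert (Hc := COS_bound (freq K * t + phi)).
    assert (Hx : -1 <= x <= 1) by (unfold x; nra).
    assert (Hx2 : x ^ 2 <= b K ^ 2).
    { unfold x. rewrite Rpow_mult_distr. assert (0 <= b K ^ 2) by apply pow2_ge_0.
      assert (cos (freq K * t + phi) ^ 2 <= 1) by nra. nra. }
    apply Rmult_le_compat; auto; try (left; apply exp_pos).
    replace (b K * (b K * 1)) with (b K ^ 2) by ring.
    generalize (exp_le_quadratic x Hx). lra.
Qed.

Lemma continuous_cos_sum (K : nat) (t : R) : continuous (cos_sum K) t.
Proof.
  unfold cos_sum. induction K as [|K IH]; simpl.
  - apply continuous_const.
  - apply (continuous_plus (V := R_NormedModule)); auto.
    apply (ex_derive_continuous (V := R_NormedModule)). auto_derive. auto.
Qed.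

Lemma continuous_exp_cos_sum (K : nat) (t : R) :
  continuous (fun t => exp (cos_sum K t)) t.
Proof.
  apply (continuous_comp (cos_sum K) exp); [apply continuous_cos_sum|].
  apply (ex_derive_continuous (V := R_NormedModule)). auto_derive. auto.
Qed.

(** The bound does not depend on [K], the phase or the coefficients, hence is uniform in the radius
    when b k is the amplitude at radius r. *)
Lemma exp_cos_sum_int (K : nat) :
  RInt (fun t => exp (cos_sum K t)) alpha (alpha + 2 * PI) <= 2 * PI * exp 4.
Proof.
  assert (HPI := PI_RGT_0).
  apply Rle_trans with (RInt (riesz K) alpha (alpha + 2 * PI)).
  - apply RInt_le; [lra| | |].
    + apply (ex_RInt_continuous (V := R_CompleteNormedModule)).
      intros t _. apply continuous_exp_cos_sum.
    + eexists. apply riesz_integral.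
    + intros t _. apply exp_cos_sum_le.
  - rewrite (is_RInt_unique _ _ _ _ (riesz_integral K)).
    apply Rmult_le_compat_l; [lra|]. apply riesz_mass_le.
Qed.

End Riesz.

Lemma Re_Csum (u : nat -> C) (n : nat) : Re (Csum u n) = Rsum (fun k => Re (u k)) n.
Proof. induction n as [|n IH]; simpl; auto. now rewrite <- IH. Qed.

Lemma Im_Csum (u : nat -> C) (n : nat) : Im (Csum u n) = Rsum (fun k => Im (u k)) n.
Proof. induction n as [|n IH]; simpl; auto. now rewrite <- IH. Qed.

Lemma Rsum_ext (u v : nat -> R) (n : nat) :
  (forall k, u k = v k) -> Rsum u n = Rsum v n.
Proof. intros H. induction n as [|n IH]; simpl; auto. now rewrite IH, H. Qed.

Lemma Rsum_opp (u : nat -> R) (n : nat) : Rsum (fun k => - u k) n = - Rsum u n.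
Proof. induction n as [|n IH]; simpl; lra. Qed.

(** Half of |u| + |v| is at most the larger of the two, and exp |w| <= exp w + exp (-w). *)
Lemma exp_half_sum_le (x y u v : R) :
  x <= Rabs u + Rabs v + y ->
  exp (x / 2) <= exp (y / 2) * ((exp u + exp (- u)) + (exp v + exp (- v))).
Proof.
  intros H.
  assert (A : forall w, exp (Rabs w) <= exp w + exp (- w)).
  { intros w. generalize (exp_pos w) (exp_pos (- w)).
    unfold Rabs. destruct (Rcase_abs w); lra. }
  apply Rle_trans with (exp (y / 2) * exp (Rmax (Rabs u) (Rabs v))).
  - rewrite <- exp_plus. apply exp_monotone.
    generalize (Rmax_l (Rabs u) (Rabs v)) (Rmax_r (Rabs u) (Rabs v)). lra.
  - apply Rmult_le_compat_l; [left; apply exp_pos|].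
    assert (A1 := A u). assert (A2 := A v).
    generalize (exp_pos u) (exp_pos (- u)) (exp_pos v) (exp_pos (- v)).
    unfold Rmax. destruct (Rle_dec _ _); lra.
Qed.

(** A nonnegative angle can be approximated by natural multiples of a step. *)
Lemma unit_circle_polar (zeta : C) :
  unit_circle zeta -> exists theta, 0 <= theta /\ zeta = polar 1 theta.
Proof.
  destruct zeta as [x y]. unfold unit_circle. intros H.
  assert (E : x ^ 2 + y ^ 2 = 1).
  { unfold Cmod in H. simpl fst in H. simpl snd in H.
    rewrite <- (pow2_sqrt (x ^ 2 + y ^ 2)); [rewrite H; ring|].
    generalize (pow2_ge_0 x) (pow2_ge_0 y). lra. }
  assert (Hx : -1 <= x <= 1) by (generalize (pow2_ge_0 y); split; nra).
  assert (HPI := PI_RGT_0). assert (Hb := acos_bound x).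
  assert (Hs : 1 - x² = y²) by (unfold Rsqr; lra).
  destruct (Rle_dec 0 y) as [Hy|Hy].
  - exists (acos x). split; [lra|]. unfold polar.
    rewrite cos_acos, sin_acos, Hs, sqrt_Rsqr by lra. f_equal; ring.
  - exists (- acos x + 2 * INR 1 * PI). split; [simpl; lra|]. unfold polar.
    rewrite cos_period, sin_period, cos_neg, sin_neg, cos_acos, sin_acos, Hs by lra.
    rewrite sqrt_Rsqr_abs, Rabs_left by lra. f_equal; ring.
Qed.

Lemma Bernoulli_sub (d : R) (n : nat) : 0 <= d <= 1 -> 1 - INR n * d <= (1 - d) ^ n.
Proof.
  intros Hd. induction n as [|n IH].
  - simpl. lra.
  - rewrite S_INR. simpl.
    assert (P := pos_INR n).
    assert ((1 - d) * (1 - INR n * d) <= (1 - d) * (1 - d) ^ n)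
      by (apply Rmult_le_compat_l; lra).
    assert (0 <= INR n * d * d) by (repeat apply Rmult_le_pos; lra).
    lra.
Qed.

Lemma harmonic_ge_ln (n : nat) : ln (INR (S n)) <= Rsum (fun k => / INR (S k)) n.
Proof.
  induction n as [|n IH].
  - simpl. rewrite ln_1. lra.
  - rewrite !Rsum_S. assert (P : 0 < INR (S n)) by (apply lt_0_INR; lia).
    assert (E : INR (S (S n)) = INR (S n) * (1 + / INR (S n)))
      by (rewrite (S_INR (S n)); field; lra).
    assert (0 < / INR (S n)) by now apply Rinv_0_lt_compat.
    rewrite E, ln_mult by lra.
    assert (ln (1 + / INR (S n)) <= / INR (S n)); [|lra].
    rewrite <- (ln_exp (/ INR (S n))) at 2. apply ln_le; [lra|]. apply exp_ineq1_le.
Qed.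

(** Total unboundedness with the components eliminated; see [totally_unbounded_iff]. *)
Definition nowhere_bounded (h : C -> C) : Prop :=
  forall zeta e M, unit_circle zeta -> 0 < e ->
    exists z, disc zeta e z /\ unit_disc z /\ M < Cmod (h z).

(** * The lacunary series: integral bounds and unboundedness *)

Section Lacunary.

Variable h : C -> C.
Hypothesis h_approx : forall z, unit_disc z -> forall K,
  Cmod (h z - Csum (fun k => / INR (S k) * z ^ (3 ^ k)) K)%C
  <= Cmod z ^ K / (1 - Cmod z).

Let amp (r : R) (k : nat) : R := / INR (S k) * r ^ (3 ^ k).

Lemma amp_bounds (r : R) (k : nat) : 0 <= r < 1 -> 0 <= amp r k <= / INR (S k).
Proof.
  intros Hr. unfold amp.
  assert (P : 0 < / INR (S k)) by (apply Rinv_0_lt_compat, lt_0_INR; lia).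
  assert (0 <= r ^ (3 ^ k)) by (apply pow_le; lra).
  assert (r ^ (3 ^ k) <= 1) by (rewrite <- (pow1 (3 ^ k)); apply pow_incr; lra).
  nra.
Qed.

Lemma lacunary_term (r t : R) (k : nat) :
  (/ INR (S k) * polar r t ^ (3 ^ k))%C = polar (amp r k) (freq k * t).
Proof.
  rewrite polar_pow, <- RtoC_inv, RtoC_polar; [reflexivity|].
  apply not_0_INR. lia.
Qed.

(** The remainder depends on |z| only, so one threshold serves all angles. *)
Lemma lacunary_close (r : R) : 0 <= r < 1 -> exists K0, forall K t, (K0 <= K)%nat ->
  Cmod (h (polar r t) - Csum (fun k => polar (amp r k) (freq k * t)) K)%C <= 1.
Proof.
  intros Hr. destruct (pow_small (/ (1 - r)) r 1 Hr Rlt_0_1) as [K0 [HK0 _]].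
  exists K0. intros K t HK.
  assert (H := h_approx (polar r t) (polar_unit_disc r t Hr) K).
  rewrite (Csum_ext _ (fun k => polar (amp r k) (freq k * t))) in H
    by (intros; apply lacunary_term).
  rewrite Cmod_polar, Rabs_pos_eq in H by lra.
  assert (P := pow_antitone r K0 K Hr HK).
  assert (0 < / (1 - r)) by (apply Rinv_0_lt_compat; lra).
  eapply Rle_trans; [apply H|]. unfold Rdiv.
  assert (/ (1 - r) * r ^ K <= / (1 - r) * r ^ K0) by (apply Rmult_le_compat_l; lra).
  lra.
Qed.

Lemma lacunary_integral (p : R) : 0 < p ->
  exists B, 0 <= B /\ forall alpha beta r, alpha <= beta <= alpha + 2 * PI -> 0 <= r < 1 ->
    holomorphic_on unit_disc h ->
    RInt (fun t => rpow (Cmod (h (polar r t))) p) alpha beta <= B.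
Proof.
  intros Hp. assert (HPI := PI_RGT_0).
  destruct (rpow_le_exp p Hp) as [A [HA HAx]].
  (* [A] turns the power into exp(|h|/2), exp(1/2) pays for the error 1 of [lacunary_close], and
     four exponentials of cosine sums have integral at most 2 * PI * exp 4 each. *)
  exists (A * exp (1 / 2) * (4 * (2 * PI * exp 4))).
  assert (He := exp_pos (1 / 2)). assert (He4 := exp_pos 4).
  split.
  { assert (0 < A * exp (1 / 2)) by (apply Rmult_lt_0_compat; lra).
    assert (0 < PI * exp 4) by (apply Rmult_lt_0_compat; lra).
    apply Rmult_le_pos; lra. }
  intros alpha beta r Hab Hr Hh.
  destruct (lacunary_close r Hr) as [K HK]. specialize (HK K).
  set (T := fun phi => cos_sum (amp r) phi K).
  (* The phases 0, PI, -PI/2 and PI/2 turn the cosine sum into Re, -Re, Im and -Im of the partial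
     sum. *)
  set (G := fun t => (exp (T 0 t) + exp (T PI t)) + (exp (T (- (PI / 2)) t) + exp (T (PI / 2) t))).
  assert (Hb := fun k => amp_bounds r k Hr).
  assert (HT : forall phi t, continuous (fun t => exp (T phi t)) t)
    by (intros; apply continuous_exp_cos_sum).
  assert (HGc : forall t, continuous G t).
  { intros t. unfold G.
    apply (continuous_plus (V := R_NormedModule) (fun t => exp (T 0 t) + exp (T PI t))).
    - now apply (continuous_plus (V := R_NormedModule) (fun t => exp (T 0 t))).
    - now apply (continuous_plus (V := R_NormedModule) (fun t => exp (T (- (PI / 2)) t))). }
  assert (HexG : forall a b, ex_RInt G a b).
  { intros a b. apply (ex_RInt_continuous (V := R_CompleteNormedModule)). auto. }
  assert (HexT : forall phi a b, ex_RInt (fun t => exp (T phi t)) a b).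
  { intros phi a b. apply (ex_RInt_continuous (V := R_CompleteNormedModule)). auto. }
  assert (HG0 : forall t, 0 <= G t).
  { intros t. unfold G. generalize (exp_pos (T 0 t)) (exp_pos (T PI t))
      (exp_pos (T (- (PI / 2)) t)) (exp_pos (T (PI / 2) t)). lra. }
  assert (HGint : RInt G alpha (alpha + 2 * PI) <= 4 * (2 * PI * exp 4)).
  { assert (Hplus : forall f g : R -> R, ex_RInt f alpha (alpha + 2 * PI) ->
      ex_RInt g alpha (alpha + 2 * PI) ->
      ex_RInt (fun t => f t + g t) alpha (alpha + 2 * PI) /\
      RInt (fun t => f t + g t) alpha (alpha + 2 * PI) =
      RInt f alpha (alpha + 2 * PI) + RInt g alpha (alpha + 2 * PI)).
    { intros f g Hf Hg. split.
      - now apply (ex_RInt_plus (V := R_NormedModule)).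
      - now apply (RInt_plus (V := R_CompleteNormedModule)). }
    destruct (Hplus _ _ (HexT 0 _ _) (HexT PI _ _)) as [X1 E1].
    destruct (Hplus _ _ (HexT (- (PI / 2)) _ _) (HexT (PI / 2) _ _)) as [X2 E2].
    destruct (Hplus _ _ X1 X2) as [_ E3].
    unfold G. rewrite E3, E1, E2.
    assert (I := fun phi => exp_cos_sum_int (amp r) phi alpha Hb K).
    generalize (I 0) (I PI) (I (- (PI / 2))) (I (PI / 2)). unfold T. lra. }
  assert (Hle : forall t, rpow (Cmod (h (polar r t))) p <= A * exp (1 / 2) * G t).
  { intros t. eapply Rle_trans; [apply HAx, Cmod_ge_0|].
    rewrite Rmult_assoc. apply Rmult_le_compat_l; [lra|].
    set (S := Csum (fun k => polar (amp r k) (freq k * t)) K) in *.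
    assert (HS : T 0 t = Re S /\ T PI t = - Re S /\
                 T (- (PI / 2)) t = Im S /\ T (PI / 2) t = - Im S).
    { unfold S, T, cos_sum. rewrite Re_Csum, Im_Csum, <- !Rsum_opp.
      repeat split; apply Rsum_ext; intros k; unfold polar; simpl;
        rewrite cos_plus, ?cos_0, ?sin_0, ?cos_PI, ?sin_PI, ?cos_neg, ?sin_neg,
                ?cos_PI2, ?sin_PI2; ring. }
    destruct HS as (S1 & S2 & S3 & S4). unfold G. rewrite S1, S2, S3, S4.
    apply exp_half_sum_le.
    specialize (HK t (le_n _)).
    assert (H1 := Cmod_minus_ge (h (polar r t)) S).
    assert (H2 := Cmod_le_Re_Im S). fold S in HK. lra. }
  apply Rle_trans with (RInt (fun t => A * exp (1 / 2) * G t) alpha beta).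
  - apply RInt_le; [lra| | |auto].
    + now apply ex_RInt_rpow_polar.
    + now apply (ex_RInt_scal (V := R_NormedModule) G).
  - replace (RInt (fun t => A * exp (1 / 2) * G t) alpha beta) with
      (A * exp (1 / 2) * RInt G alpha beta).
    2:{ symmetry. now apply (RInt_scal (V := R_CompleteNormedModule) G). }
    apply Rmult_le_compat_l; [nra|].
    apply Rle_trans with (2 := HGint).
    (* As G is nonnegative, the integral over the arc is at most the one over a full period, where
       orthogonality holds. *)
    rewrite <- (RInt_Chasles G alpha beta (alpha + 2 * PI)) by auto.
    assert (0 <= RInt G beta (alpha + 2 * PI)) by (apply RInt_ge_0; auto; lra).
    unfold plus; simpl. lra.
Qed.

(** At the angle of a root of unity of order 3^K all terms from index K on are nonnegative reals,
    and close enough to the circle many of them keep half of their weight. The first K terms have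
    modulus at most 1. *)
Lemma lacunary_nowhere_bounded : nowhere_bounded h.
Proof.
  intros zeta e M Hz He. assert (HPI := PI_RGT_0).
  destruct (unit_circle_polar zeta Hz) as [theta [Hth ->]].
  (* Such roots are spaced by 2 * PI / 3^K and [polar_lipschitz] doubles the distance; the rest of
     [e] is for the radial move. *)
  destruct (pow_small (2 * (2 * PI)) (/ 3) (e / 2)) as [K [HK _]]; [lra|lra|].
  set (N := INR (3 ^ K)).
  assert (HN : N = 3 ^ K) by (unfold N; rewrite pow_INR; f_equal; simpl; lra).
  assert (HN0 : 0 < N) by (rewrite HN; apply pow_lt; lra).
  destruct (nfloor_ex (theta * N / (2 * PI))) as [m Hm].
  { apply Rmult_le_pos; [nra|]. left. apply Rinv_0_lt_compat. lra. }
  set (t := 2 * PI * INR m / N).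
  assert (Ht : Rabs (t - theta) <= 2 * PI * (/ 3) ^ K).
  { rewrite pow_inv, <- HN. unfold t.
    replace (2 * PI * INR m / N - theta) with
      (2 * PI * / N * (INR m - theta * N / (2 * PI))) by (field; lra).
    rewrite Rabs_mult.
    assert (0 < / N) by now apply Rinv_0_lt_compat.
    rewrite (Rabs_pos_eq (2 * PI * / N)) by (apply Rmult_le_pos; lra).
    assert (Rabs (INR m - theta * N / (2 * PI)) <= 1) by (apply Rabs_le; lra).
    rewrite <- (Rmult_1_r (2 * PI * / N)) at 2.
    apply Rmult_le_compat_l; auto. apply Rmult_le_pos; lra. }
  (* The aim is Re S >= Q - K = |M| + 2, which survives the error 1 of [lacunary_close]. In 2 * Q +
     K below, the 2 makes up for the weights r^(3^k) >= 1/2 and K for the first K harmonic terms. *)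
  set (Q := Rabs M + INR K + 2).
  assert (HQ : 0 < Q) by (unfold Q; generalize (Rabs_pos M) (pos_INR K); lra).
  destruct (nfloor_ex (exp (2 * Q + INR K))) as [L HL]; [left; apply exp_pos|].
  set (N0 := (K + L)%nat).
  assert (Hharm : 2 * Q + INR K <= Rsum (fun k => / INR (S k)) N0).
  { eapply Rle_trans; [|apply harmonic_ge_ln].
    rewrite <- (ln_exp (2 * Q + INR K)). apply ln_le; [apply exp_pos|].
    assert (INR (S L) <= INR (S N0)) by (apply le_INR; unfold N0; lia).
    rewrite S_INR in H. lra. }
  set (n0 := (3 ^ N0)%nat).
  (* The second bound gives n0 * d <= 1/2, so that (1 - d)^n0 >= 1/2 by Bernoulli. *)
  set (d := Rmin (e / 4) (/ (2 * (INR n0 + 1)))).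
  assert (Hn0 := pos_INR n0).
  assert (Hd : 0 < d <= 1 / 2 /\ d <= e / 4 /\ INR n0 * d <= 1 / 2).
  { assert (D1 : 0 < / (2 * (INR n0 + 1))) by (apply Rinv_0_lt_compat; lra).
    assert (D2 := Rmin_l (e / 4) (/ (2 * (INR n0 + 1)))).
    assert (D3 := Rmin_r (e / 4) (/ (2 * (INR n0 + 1)))). fold d in D2, D3.
    assert (D4 : (INR n0 + 1) * / (2 * (INR n0 + 1)) = 1 / 2) by (field; lra).
    assert (D5 : 0 < d) by (apply Rmin_pos; lra).
    repeat split; auto; nra. }
  set (r := 1 - d).
  assert (Hr : 0 <= r < 1) by (unfold r; lra).
  assert (Hrn : forall k, (k < N0)%nat -> 1 / 2 <= r ^ (3 ^ k)).
  { intros k Hk. apply Rle_trans with (r ^ n0).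
    - generalize (Bernoulli_sub d n0 ltac:(lra)). fold r. lra.
    - apply pow_antitone; auto. unfold n0. apply Nat.pow_le_mono_r; lia. }
  exists (polar r t). split; [|split].
  - unfold disc.
    eapply Rle_lt_trans; [apply (Cmod_triangle_minus _ (polar 1 t))|].
    assert (E1 : Cmod (polar r t - polar 1 t)%C = d).
    { replace (polar r t - polar 1 t)%C with (polar (- d) t).
      - rewrite Cmod_polar, Rabs_Ropp, Rabs_pos_eq; lra.
      - unfold polar, Cminus, Cplus, Copp, r; simpl. f_equal; ring. }
    assert (E2 := polar_lipschitz 1 t theta ltac:(lra)). lra.
  - now apply polar_unit_disc.
  - destruct (lacunary_close r Hr) as [K1 HK1].
    (* The approximation may need more than N0 terms; the additional ones are nonnegative. *)
    set (Nn := (N0 + K1)%nat).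
    specialize (HK1 Nn t ltac:(unfold Nn; lia)).
    set (S := Csum (fun k => polar (amp r k) (freq k * t)) Nn) in *.
    assert (HRe : Q <= Re S + INR K).
    { unfold S. rewrite Re_Csum.
      assert (Hcos : forall k, (K <= k)%nat -> cos (freq k * t) = 1).
      { intros k Hk. unfold t, freq.
        replace (INR (3 ^ k) * (2 * PI * INR m / N)) with
          (0 + 2 * INR (3 ^ (k - K) * m) * PI).
        - rewrite cos_period. apply cos_0.
        - rewrite mult_INR. replace k with (K + (k - K))%nat at 2 by lia.
          rewrite Nat.pow_add_r, mult_INR. fold N. field. lra. }
      assert (Hk1 : forall k, Rabs (Re (polar (amp r k) (freq k * t))) <= 1).
      { intros k. eapply Rle_trans; [apply re_le_Cmod|]. rewrite Cmod_polar.
        assert (A := amp_bounds r k Hr). rewrite Rabs_pos_eq by lra.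
        apply Rle_trans with (1 := proj2 A). rewrite <- Rinv_1.
        apply Rinv_le_contravar; [lra|]. rewrite S_INR. generalize (pos_INR k). lra. }
      assert (L1 : - INR K <= Rsum (fun k => Re (polar (amp r k) (freq k * t))) K).
      { generalize K. induction K0 as [|j IH]; [simpl; lra|].
        rewrite S_INR. rewrite !Rsum_S. specialize (Hk1 j). apply Rabs_le_between in Hk1. lra. }
      assert (L2 : Rsum (fun k => / INR (Datatypes.S k)) K <= INR K).
      { generalize K. induction K0 as [|j IH]; [simpl; lra|].
        rewrite S_INR. rewrite !Rsum_S.
        assert (/ INR (Datatypes.S j) <= 1); [|lra]. rewrite <- Rinv_1.
        apply Rinv_le_contravar; [lra|]. rewrite S_INR. generalize (pos_INR j). lra. }
      assert (L3 : forall j, (K + j <= N0)%nat ->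
        (Rsum (fun k => / INR (Datatypes.S k)) (K + j)
         - Rsum (fun k => / INR (Datatypes.S k)) K) / 2 <=
        Rsum (fun k => Re (polar (amp r k) (freq k * t))) (K + j)
         - Rsum (fun k => Re (polar (amp r k) (freq k * t))) K).
      { induction j as [|j IH]; intros Hj.
        - rewrite Nat.add_0_r. lra.
        - rewrite Nat.add_succ_r. rewrite !Rsum_S. specialize (IH ltac:(lia)).
          specialize (Hcos (K + j)%nat ltac:(lia)).
          specialize (Hrn (K + j)%nat ltac:(lia)).
          assert (P : 0 < / INR (Datatypes.S (K + j)))
            by (apply Rinv_0_lt_compat, lt_0_INR; lia).
          assert (E : Re (polar (amp r (K + j)) (freq (K + j) * t)) =
                      / INR (Datatypes.S (K + j)) * r ^ (3 ^ (K + j))).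
          { unfold polar. simpl Re. rewrite Hcos, Rmult_1_r. reflexivity. }
          rewrite E.
          assert (/ INR (Datatypes.S (K + j)) * (1 / 2) <=
                  / INR (Datatypes.S (K + j)) * r ^ (3 ^ (K + j)))
            by (apply Rmult_le_compat_l; lra).
          lra. }
      assert (L4 : forall j,
        Rsum (fun k => Re (polar (amp r k) (freq k * t))) N0 <=
        Rsum (fun k => Re (polar (amp r k) (freq k * t))) (N0 + j)).
      { induction j as [|j IH].
        - rewrite Nat.add_0_r. lra.
        - rewrite Nat.add_succ_r. rewrite !Rsum_S.
          specialize (Hcos (N0 + j)%nat ltac:(unfold N0; lia)).
          assert (A := amp_bounds r (N0 + j) Hr).
          assert (E : Re (polar (amp r (N0 + j)) (freq (N0 + j) * t)) = amp r (N0 + j)).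
          { unfold polar. simpl Re. rewrite Hcos. ring. }
          rewrite E. lra. }
      specialize (L4 K1). specialize (L3 L (le_n _)). fold Nn in L4. fold N0 in L3.
      lra. }
    assert (H1 := Cmod_minus_ge S (h (polar r t))). rewrite Cmod_minus_sym in H1.
    assert (H2 := re_le_Cmod S). assert (H3 := Rle_abs (Re S)).
    assert (H4 := Rle_abs M). unfold Q in HRe. fold S in HK1.
    lra.
Qed.

End Lacunary.

(** * The metrics *)

(** Cantor's nested intervals: [step] passes to a closed subinterval avoiding [u n]. The start is
    the middle third, so that the limit is interior to (a, b). *)
Lemma interval_uncountable (u : nat -> R) (a b : R) :
  a < b -> exists x, a < x < b /\ forall n, u n <> x.
Proof.
  intros Hab.
  set (step := fun (v : R) (I : R * R) => let (l, r) := I in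
    if Rle_dec v ((l + r) / 2) then (((l + r) / 2 + r) / 2, r) else (l, (l + r) / 2)).
  set (I := fix I n := match n with
    | O => ((2 * a + b) / 3, (a + 2 * b) / 3)
    | S n => step (u n) (I n) end).
  assert (Hstep : forall v l r, l < r ->
    l <= fst (step v (l, r)) < snd (step v (l, r)) /\ snd (step v (l, r)) <= r /\
    forall x, fst (step v (l, r)) <= x <= snd (step v (l, r)) -> v <> x).
  { intros v l r Hlr. unfold step. destruct (Rle_dec v ((l + r) / 2)) as [H|H]; simpl;
      (split; [lra|]; split; [lra|]; intros x Hx E; lra). }
  assert (Hlt : forall n, fst (I n) < snd (I n)).
  { induction n as [|n IH]; [simpl; lra|].
    simpl. destruct (I n) as [l r]. simpl in IH. now apply Hstep. }
  assert (Hmono1 : forall n, fst (I n) <= fst (I (S n)) /\ snd (I (S n)) <= snd (I n) /\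
    forall x, fst (I (S n)) <= x <= snd (I (S n)) -> u n <> x).
  { intros n. specialize (Hlt n). simpl. destruct (I n) as [l r]. simpl in Hlt.
    destruct (Hstep (u n) l r Hlt) as (H1 & H2 & H3). simpl. repeat split; auto. apply H1. }
  assert (Hmono : forall n k, fst (I n) <= fst (I (n + k)%nat) /\ snd (I (n + k)%nat) <= snd (I n)).
  { intros n. induction k as [|k IH]; [rewrite Nat.add_0_r; lra|].
    rewrite Nat.add_succ_r. destruct (Hmono1 (n + k)%nat) as (H1 & H2 & _). lra. }
  assert (Hnest : forall n m, fst (I n) <= snd (I m)).
  { intros n m. destruct (Hmono n m) as [H1 _]. destruct (Hmono m n) as [_ H2].
    rewrite Nat.add_comm in H2. specialize (Hlt (n + m)%nat). lra. }
  destruct (completeness (fun x => exists n, x = fst (I n))) as [x [Hub Hl]].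
  { exists (snd (I O)). intros x [n ->]. apply Hnest. }
  { exists (fst (I O)). now exists O. }
  assert (Hx : forall n, fst (I n) <= x <= snd (I n)).
  { intros n. split; [apply Hub; now exists n|].
    apply Hl. intros y [k ->]. apply Hnest. }
  exists x. split.
  - specialize (Hx O). simpl in Hx. lra.
  - intros n. now apply (proj2 (proj2 (Hmono1 n))).
Qed.

Lemma sup_over_spec {T : Type} (P : T -> Prop) (h : T -> R) (x0 : T) (B : R) :
  P x0 -> (forall x, P x -> h x <= B) ->
  real (sup_over P h) <= B /\ forall x, P x -> h x <= real (sup_over P h).
Proof.
  intros H0 HB. unfold sup_over.
  set (E := fun y => exists x, P x /\ y = h x).
  destruct (Lub_Rbar_correct E) as [Hub Hl].
  assert (H1 : Rbar_le (Lub_Rbar E) B).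
  { apply Hl. intros y [x [Hx ->]]. simpl. auto. }
  assert (H2 : forall x, P x -> Rbar_le (h x) (Lub_Rbar E)).
  { intros x Hx. apply Hub. now exists x. }
  specialize (H2 x0 H0) as H3.
  destruct (Lub_Rbar E) as [s| |]; simpl in *; try tauto.
Qed.

(** Infinite suprema are harmless because [real] sends both infinities to 0. *)
Lemma sup_over_ge0 {T : Type} (P : T -> Prop) (h : T -> R) :
  (forall x, P x -> 0 <= h x) -> 0 <= real (sup_over P h).
Proof.
  intros H. unfold sup_over. set (E := fun y => exists x, P x /\ y = h x).
  destruct (Lub_Rbar_correct E) as [Hub Hl].
  destruct (Lub_Rbar E) as [s| |]; simpl; try lra.
  destruct (classic (exists x, P x)) as [[x Hx]|Hn].
  - apply Rle_trans with (h x); auto. apply (Hub (h x)). now exists x.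
  - exfalso. apply (Hl m_infty). intros y [x [Hx _]]. apply Hn. now exists x.
Qed.

Lemma Hp_iff (p : R) (J : closed_arc) (f : C -> C) :
  Hp p J f <-> holomorphic_on unit_disc f /\
               exists B, forall r, radius r -> arc_integral p J f r <= B.
Proof.
  unfold Hp, sup_over. set (E := fun y => exists r, radius r /\ y = arc_integral p J f r).
  destruct (Lub_Rbar_correct E) as [Hub Hl].
  split; intros [Hf H]; split; auto.
  - assert (H0 : E (arc_integral p J f 0)) by (exists 0; split; auto; unfold radius; lra).
    apply Hub in H0.
    destruct (Lub_Rbar E) as [s| |]; simpl in *; try tauto.
    exists s. intros r Hr. apply (Hub (arc_integral p J f r)). now exists r.
  - destruct H as [B HB].
    assert (H1 : Rbar_le (Lub_Rbar E) B).
    { apply Hl. intros y [r [Hr ->]]. simpl. auto. }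
    destruct (Lub_Rbar E); simpl in *; tauto.
Qed.

Lemma fun_sub_holomorphic (S : C -> Prop) (f g : C -> C) :
  holomorphic_on S f -> holomorphic_on S g -> holomorphic_on S (fun_sub f g).
Proof.
  intros Hf Hg z Hz. unfold fun_sub.
  apply ex_derive_Cmod.
  destruct (proj1 (ex_derive_Cmod _ _) (Hf z Hz)) as [l Hl].
  destruct (proj1 (ex_derive_Cmod _ _) (Hg z Hz)) as [m Hm].
  exists (l - m)%C. intros e He.
  destruct (Hl (e / 2)) as [d1 [Hd1 H1]]; [lra|].
  destruct (Hm (e / 2)) as [d2 [Hd2 H2]]; [lra|].
  exists (Rmin d1 d2). split; [now apply Rmin_pos|]. intros w Hw.
  specialize (H1 w (Rlt_le_trans _ _ _ Hw (Rmin_l _ _))).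
  specialize (H2 w (Rlt_le_trans _ _ _ Hw (Rmin_r _ _))).
  replace (f w - g w - (f z - g z) - (l - m) * (w - z))%C with
    ((f w - f z - l * (w - z)) - (g w - g z - m * (w - z)))%C by ring.
  eapply Rle_trans; [apply Cmod_triangle|]. rewrite Cmod_opp. lra.
Qed.

Lemma arc_integral_ge0 (p : R) (J : closed_arc) (f : C -> C) (r : R) :
  0 < p -> radius r -> holomorphic_on unit_disc f -> 0 <= arc_integral p J f r.
Proof.
  intros Hp Hr Hf. apply RInt_ge_0.
  - left. apply arc_lt.
  - now apply ex_RInt_rpow_polar.
  - intros t _. apply rpow_ge0.
Qed.

Lemma dist_m_ge0 (m : nat) (p : R) (J : closed_arc) (f g : C -> C) :
  0 < p -> holomorphic_on unit_disc f -> holomorphic_on unit_disc g ->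
  0 <= dist_m m p J f g.
Proof.
  intros Hp Hf Hg. unfold dist_m, dist_arc, dist_disc.
  destruct (Nat.eqb m 1); [destruct (Rle_dec 1 p)|]; apply sup_over_ge0.
  - intros r0 _. apply rpow_ge0.
  - intros r0 Hr. apply arc_integral_ge0; auto. now apply fun_sub_holomorphic.
  - intros z _. apply Cmod_ge_0.
Qed.

Lemma Series_ge0 (u : nat -> R) : (forall k, 0 <= u k) -> ex_series u -> 0 <= Series u.
Proof.
  intros H Hu. replace 0 with (Series (fun k => 0 * u k)) by (rewrite Series_scal_l; ring).
  apply Series_le; auto. intros k. specialize (H k). lra.
Qed.

Lemma Series_term_le (u : nat -> R) (n : nat) :
  (forall k, 0 <= u k) -> ex_series u -> u n <= Series u.
Proof.
  revert u. induction n as [|n IH]; intros u H Hu.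
  - rewrite Series_incr_1 by auto.
    assert (0 <= Series (fun k => u (S k))); [|lra].
    apply Series_ge0; auto. now apply (ex_series_incr_1 u).
  - rewrite Series_incr_1 by auto.
    assert (u (S n) <= Series (fun k => u (S k))).
    { apply (IH (fun k => u (S k))); auto. now apply (ex_series_incr_1 u). }
    specialize (H O). lra.
Qed.

Lemma frac_bounds (x : R) : 0 <= x -> 0 <= x / (1 + x) < 1 /\ x / (1 + x) <= x.
Proof.
  intros Hx. set (y := x / (1 + x)).
  assert (H0 : 0 < / (1 + x)) by (apply Rinv_0_lt_compat; lra).
  assert (E1 : y = 1 - / (1 + x)) by (unfold y; field; lra).
  assert (E2 : x - y = y * x) by (unfold y; field; lra).
  assert (Hy : 0 <= y) by (apply Rmult_le_pos; lra).
  assert (0 <= y * x) by (apply Rmult_le_pos; lra).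
  lra.
Qed.

Lemma pow_half_bounds (k : nat) : 0 < 1 / 2 ^ S k.
Proof. apply Rdiv_lt_0_compat; [lra|]. apply pow_lt. lra. Qed.

Definition dist_term (d : nat -> R) (k : nat) : R :=
  1 / 2 ^ S k * (d (S k) / (1 + d (S k))).

Lemma dist_term_bounds (d : nat -> R) (k : nat) :
  (forall m, (1 <= m)%nat -> 0 <= d m) -> 0 <= dist_term d k <= (/ 2) ^ k.
Proof.
  intros Hd. unfold dist_term.
  destruct (frac_bounds (d (S k)) (Hd (S k) ltac:(lia))) as [H _].
  assert (P := pow_half_bounds k).
  assert (E : (/ 2) ^ k = 2 * (1 / 2 ^ S k)).
  { rewrite pow_inv. simpl. field. apply pow_nonzero. lra. }
  rewrite E. nra.
Qed.

Lemma ex_series_dist_term (d : nat -> R) :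
  (forall m, (1 <= m)%nat -> 0 <= d m) -> ex_series (dist_term d).
Proof.
  intros Hd. apply (ex_series_le (V := R_CompleteNormedModule) _ (fun k => (/ 2) ^ k)).
  - intros k. destruct (dist_term_bounds d k Hd) as [H1 H2].
    change (Rabs (dist_term d k) <= (/ 2) ^ k). now rewrite Rabs_pos_eq.
  - apply ex_series_geom. rewrite Rabs_pos_eq; lra.
Qed.

Lemma sum_dist_ge0 (d : nat -> R) :
  (forall m, (1 <= m)%nat -> 0 <= d m) -> 0 <= sum_dist d.
Proof.
  intros Hd. apply (Series_ge0 (dist_term d)).
  - intros k. now apply dist_term_bounds.
  - now apply ex_series_dist_term.
Qed.

(** One term is at most the whole sum, and t / (1 + t) is increasing. The radius depends on m and e
    alone, hence is uniform over pairs of functions. *)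
Lemma sum_dist_control (m : nat) (e : R) : (1 <= m)%nat -> 0 < e ->
  exists r, 0 < r /\ forall d : nat -> R, (forall m, (1 <= m)%nat -> 0 <= d m) ->
    sum_dist d < r -> d m < e.
Proof.
  intros Hm He. destruct m as [|k]; [lia|].
  assert (P := pow_half_bounds k).
  exists (1 / 2 ^ S k * (e / (1 + e))). split.
  { apply Rmult_lt_0_compat; auto. apply Rdiv_lt_0_compat; lra. }
  intros d Hd Hs. apply Rnot_le_lt. intro Hle.
  assert (H : dist_term d k <= sum_dist d).
  { apply (Series_term_le (dist_term d)).
    - intros j. now apply dist_term_bounds.
    - now apply ex_series_dist_term. }
  assert (H' : e / (1 + e) <= d (S k) / (1 + d (S k))).
  { apply (Rmult_le_reg_r ((1 + e) * (1 + d (S k)))); [nra|].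
    replace (e / (1 + e) * ((1 + e) * (1 + d (S k)))) with (e * (1 + d (S k)))
      by (field; lra).
    replace (d (S k) / (1 + d (S k)) * ((1 + e) * (1 + d (S k)))) with (d (S k) * (1 + e))
      by (field; lra).
    lra. }
  apply (Rmult_le_compat_l (1 / 2 ^ S k)) in H'; [|lra].
  unfold dist_term in H. lra.
Qed.

Lemma sum_dist_le (d : nat -> R) (N : nat) (e : R) :
  0 <= e -> (forall m, (1 <= m)%nat -> 0 <= d m) ->
  (forall m, (1 <= m <= N)%nat -> d m <= e) ->
  sum_dist d <= 3 * (e + (2 / 3) ^ N).
Proof.
  intros He Hd HN.
  assert (Hq : 0 < (2 / 3) ^ N) by (apply pow_lt; lra).
  (* [1/2 = 2/3 * 3/4] turns the tail bound into a multiple of a geometric series. *)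
  assert (Hle : forall k, 0 <= dist_term d k <=
    3 / 4 * (e + (2 / 3) ^ N) * (3 / 4) ^ k).
  { intros k. split; [now apply dist_term_bounds|]. unfold dist_term.
    destruct (frac_bounds (d (S k)) (Hd (S k) ltac:(lia))) as [H1 H2].
    assert (P := pow_half_bounds k).
    assert (Q : 0 < (3 / 4) ^ S k) by (apply pow_lt; lra).
    assert (E : 1 / 2 ^ S k = (2 / 3) ^ S k * (3 / 4) ^ S k).
    { rewrite <- Rpow_mult_distr. replace (2 / 3 * (3 / 4)) with (/ 2) by field.
      rewrite pow_inv. unfold Rdiv. ring. }
    replace (3 / 4 * (e + (2 / 3) ^ N) * (3 / 4) ^ k) with
      ((e + (2 / 3) ^ N) * (3 / 4) ^ S k) by (simpl; ring).
    rewrite E. set (x := d (S k) / (1 + d (S k))) in *.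
    assert (T : 0 < (2 / 3) ^ S k) by (apply pow_lt; lra).
    replace ((2 / 3) ^ S k * (3 / 4) ^ S k * x) with ((2 / 3) ^ S k * x * (3 / 4) ^ S k) by ring.
    apply Rmult_le_compat_r; [lra|].
    destruct (Nat.le_gt_cases (S k) N) as [Hk|Hk].
    - assert ((2 / 3) ^ S k <= 1) by (rewrite <- (pow1 (S k)); apply pow_incr; lra).
      assert (x <= e) by (apply Rle_trans with (1 := H2), HN; lia). nra.
    - assert ((2 / 3) ^ S k <= (2 / 3) ^ N) by (apply pow_antitone; lra || lia). nra. }
  assert (Hex : ex_series (fun k => 3 / 4 * (e + (2 / 3) ^ N) * (3 / 4) ^ k)).
  { apply (ex_series_scal_l (V := R_NormedModule)), ex_series_geom.
    rewrite Rabs_pos_eq; lra. }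
  apply Rle_trans with (1 := Series_le _ _ Hle Hex).
  (* The factor 3 is (3/4) / (1 - 3/4). *)
  rewrite Series_scal_l, Series_geom by (rewrite Rabs_pos_eq; lra).
  right. field.
Qed.

Lemma common_threshold (Q : nat -> R -> Prop) (N : nat) :
  (forall m, (1 <= m)%nat -> exists r, 0 < r /\ forall c, 0 < c < r -> Q m c) ->
  exists r, 0 < r /\ forall m c, (1 <= m <= N)%nat -> 0 < c < r -> Q m c.
Proof.
  intros H. induction N as [|N [r [Hr IH]]].
  - exists 1. split; [lra|]. intros; lia.
  - destruct (H (S N)) as [r' [Hr' H']]; [lia|].
    exists (Rmin r r'). split; [now apply Rmin_pos|]. intros m c Hm Hc.
    assert (H1 := Rmin_l r r'). assert (H2 := Rmin_r r r').
    destruct (Nat.eq_dec m (S N)) as [->|Hne]; [apply H'; lra|].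
    apply IH; [lia | lra].
Qed.

(** Applied at two levels: to the distances inside one space, and to the spaces of an
    intersection. *)
Lemma sum_dist_cv0 (D : R -> nat -> R) :
  (forall c m, (1 <= m)%nat -> 0 <= D c m) ->
  (forall m e, (1 <= m)%nat -> 0 < e ->
     exists r, 0 < r /\ forall c, 0 < c < r -> D c m < e) ->
  forall e, 0 < e -> exists r, 0 < r /\ forall c, 0 < c < r -> sum_dist (D c) < e.
Proof.
  intros H0 H e He.
  (* By [sum_dist_le] the total is at most 3 * (e/9 + e/6), which is less than e. *)
  destruct (pow_small 1 (2 / 3) (e / 6)) as [N [HN _]]; [lra|lra|].
  destruct (common_threshold (fun m c => D c m < e / 9) N) as [r [Hr Hr']].
  { intros m Hm. apply H; auto. lra. }
  exists r. split; auto. intros c Hc.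
  eapply Rle_lt_trans; [apply (sum_dist_le (D c) N (e / 9)); auto|].
  - lra.
  - intros m Hm. left. auto.
  - lra.
Qed.

(** * Perturbation by a function in all the spaces *)

Definition perturb (f h : C -> C) (c : R) : C -> C := fun z => (f z + c * h z)%C.

(** The bound may depend on p but not on the arc, so the perturbation stays in any intersection. *)
Definition in_all_Hp (h : C -> C) : Prop :=
  holomorphic_on unit_disc h /\
  forall p, 0 < p -> exists B, 0 <= B /\
    forall J r, radius r -> arc_integral p J h r <= B.

Lemma perturb_holomorphic (S : C -> Prop) (f h : C -> C) (c : R) :
  holomorphic_on S f -> holomorphic_on S h -> holomorphic_on S (perturb f h c).
Proof.
  intros Hf Hh z Hz. apply ex_derive_Cplus; auto.
  apply (ex_derive_Cmult (fun _ => RtoC c)); auto. apply ex_derive_Cconst.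
Qed.

(** From x + y <= 2 max(x, y); this treats p < 1 and p >= 1 alike. *)
Lemma rpow_add_le (x y p : R) : 0 < p -> 0 <= x -> 0 <= y ->
  rpow (x + y) p <= rpow 2 p * rpow x p + rpow 2 p * rpow y p.
Proof.
  intros Hp Hx Hy. rewrite <- !rpow_mult by lra.
  assert (H1 := rpow_ge0 (2 * x) p). assert (H2 := rpow_ge0 (2 * y) p).
  destruct (Rle_dec x y).
  - assert (rpow (x + y) p <= rpow (2 * y) p) by (apply rpow_le; lra). lra.
  - assert (rpow (x + y) p <= rpow (2 * x) p) by (apply rpow_le; lra). lra.
Qed.

Lemma Hp_perturb (p : R) (J : closed_arc) (f h : C -> C) (c : R) :
  0 < p -> Hp p J f -> in_all_Hp h -> Hp p J (perturb f h c).
Proof.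
  intros Hp0 Hf [Hh HB].
  apply Hp_iff in Hf. destruct Hf as [Hf [A HA]].
  destruct (HB p Hp0) as [B [HB0 HB']].
  apply Hp_iff. split; [now apply perturb_holomorphic|].
  set (k1 := rpow 2 p). set (k2 := rpow 2 p * rpow (Rabs c) p).
  exists (k1 * A + k2 * B). intros r Hr.
  assert (K1 : 0 <= k1) by apply rpow_ge0.
  assert (K2 : 0 <= k2) by (apply Rmult_le_pos; apply rpow_ge0).
  set (F := fun t => rpow (Cmod (f (polar r t))) p).
  set (H := fun t => rpow (Cmod (h (polar r t))) p).
  assert (EF : ex_RInt F (arc_lo J) (arc_hi J)) by now apply ex_RInt_rpow_polar.
  assert (EH : ex_RInt H (arc_lo J) (arc_hi J)) by now apply ex_RInt_rpow_polar.
  apply (ex_RInt_scal (V := R_NormedModule) F _ _ k1) in EF as EF'.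
  apply (ex_RInt_scal (V := R_NormedModule) H _ _ k2) in EH as EH'.
  apply Rle_trans with
    (RInt (fun t => plus (scal k1 (F t)) (scal k2 (H t))) (arc_lo J) (arc_hi J)).
  - apply RInt_le.
    + left. apply arc_lt.
    + apply ex_RInt_rpow_polar; auto. now apply perturb_holomorphic.
    + now apply (ex_RInt_plus (V := R_NormedModule)).
    + intros t _. unfold F, H, perturb, plus, scal; simpl. unfold mult; simpl.
      apply Rle_trans with (rpow (Cmod (f (polar r t)) + Rabs c * Cmod (h (polar r t))) p).
      * apply rpow_le; auto. eapply Rle_trans; [apply Cmod_triangle|].
        rewrite Cmod_mult, Cmod_R. lra.
      * assert (P := Cmod_ge_0 (h (polar r t))). assert (Q := Rabs_pos c).
        eapply Rle_trans; [apply rpow_add_le; auto using Cmod_ge_0|].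
        -- now apply Rmult_le_pos.
        -- rewrite (rpow_mult (Rabs c)) by auto. unfold k1, k2. lra.
  - rewrite (RInt_plus (V := R_CompleteNormedModule)) by auto.
    rewrite !(RInt_scal (V := R_CompleteNormedModule)) by auto.
    unfold plus, scal; simpl. unfold mult; simpl.
    apply Rplus_le_compat; apply Rmult_le_compat_l; auto; [now apply HA | now apply HB'].
Qed.

Lemma unit_disc_holomorphic (f : C -> C) :
  holomorphic_on unit_disc f -> holomorphic_on (disc 0 1) f.
Proof. intros H z Hz. apply H. now apply unit_disc_disc. Qed.

Lemma inv_m_bounds (m : nat) : (2 <= m)%nat -> 0 <= 1 - 1 / INR m < 1.
Proof.
  intros Hm. apply le_INR in Hm. simpl in Hm.
  assert (0 < / INR m) by (apply Rinv_0_lt_compat; lra).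
  assert (/ INR m <= / 2) by (apply Rinv_le_contravar; lra). lra.
Qed.

Lemma holomorphic_bounded_unit (f : C -> C) (rho : R) :
  holomorphic_on unit_disc f -> 0 <= rho < 1 ->
  exists M, 0 <= M /\ forall z, Cmod z <= rho -> Cmod (f z) <= M.
Proof.
  intros Hf Hrho.
  destruct (holomorphic_bounded f 0 rho 1 (unit_disc_holomorphic f Hf) Hrho) as [M [HM H]].
  exists M. split; auto. intros z Hz. apply H. now replace (z - 0)%C with z by ring.
Qed.

Lemma dist_m_perturb (m : nat) (p : R) (J : closed_arc) (f h : C -> C) (e : R) :
  (1 <= m)%nat -> 0 < p -> in_all_Hp h -> 0 < e ->
  exists r, 0 < r /\ forall c, 0 < c < r -> dist_m m p J f (perturb f h c) < e.
Proof.
  intros Hm Hp0 [Hh HB] He.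
  assert (Hsub : forall c z, 0 < c ->
    Cmod (f z - perturb f h c z)%C = c * Cmod (h z)).
  { intros c z Hc. unfold perturb. replace (f z - (f z + c * h z))%C with (- (c * h z))%C by ring.
    rewrite Cmod_opp, Cmod_mult, Cmod_R, Rabs_pos_eq; lra. }
  unfold dist_m. destruct (Nat.eqb_spec m 1) as [Hm1|Hm1].
  - destruct (HB p Hp0) as [B [HB0 HB']].
    assert (Hint : forall c r, 0 < c -> radius r ->
      arc_integral p J (fun_sub f (perturb f h c)) r <= rpow c p * B).
    { intros c r Hc Hr.
      apply Rle_trans with (rpow c p * arc_integral p J h r).
      - right. unfold arc_integral.
        rewrite <- (RInt_scal (V := R_CompleteNormedModule)
          (fun t => rpow (Cmod (h (polar r t))) p)) by now apply ex_RInt_rpow_polar.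
        apply RInt_ext. intros t _. unfold fun_sub. rewrite Hsub by auto.
        apply rpow_mult; [lra | apply Cmod_ge_0].
      - apply Rmult_le_compat_l; [apply rpow_ge0 | auto]. }
    assert (Hd : exists d, 0 < d /\ forall x, x < d -> rpow x (1 / p) < e / 2).
    { apply rpow_small; [apply Rdiv_lt_0_compat|]; lra. }
    destruct Hd as [d [Hd Hd']].
    (* One threshold for both forms of [dist_arc]: below [d] the root of order p is small, and below
       e / 2 the integral itself is. Halving e keeps the supremum strictly below it. *)
    set (d' := Rmin d (e / 2)).
    assert (Hd0 : 0 < d') by (apply Rmin_pos; lra).
    destruct (rpow_small p (d' / (B + 1)) Hp0) as [r [Hr Hr']].
    { apply Rdiv_lt_0_compat; lra. }
    exists r. split; auto. intros c Hc.
    assert (Hc' : rpow c p * B < d').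
    { specialize (Hr' c (proj2 Hc)).
      apply (Rmult_lt_compat_r (B + 1)) in Hr'; [|lra].
      replace (d' / (B + 1) * (B + 1)) with d' in Hr' by (field; lra).
      assert (P := rpow_ge0 c p). lra. }
    assert (D1 := Rmin_l d (e / 2)). assert (D2 := Rmin_r d (e / 2)). fold d' in D1, D2.
    assert (R0 : radius 0) by (unfold radius; lra).
    unfold dist_arc. destruct (Rle_dec 1 p).
    + eapply Rle_lt_trans; [apply (sup_over_spec radius _ 0 (e / 2) R0)|lra].
      intros s Hs. left. apply Hd'.
      specialize (Hint c s (proj1 Hc) Hs). lra.
    + eapply Rle_lt_trans; [apply (sup_over_spec radius _ 0 (e / 2) R0)|lra].
      intros s Hs. specialize (Hint c s (proj1 Hc) Hs). lra.
  - assert (Hm2 : (2 <= m)%nat) by lia.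
    assert (Hrho := inv_m_bounds m Hm2).
    destruct (holomorphic_bounded_unit h _ Hh Hrho) as [M [HM HM']].
    exists (e / (2 * (M + 1))). split; [apply Rdiv_lt_0_compat; lra|]. intros c Hc.
    unfold dist_disc.
    eapply Rle_lt_trans; [apply (sup_over_spec _ _ (RtoC 0) (e / 2))|lra].
    + rewrite Cmod_0. lra.
    + intros z Hz. rewrite Hsub by lra. specialize (HM' z Hz).
      apply Rle_trans with (e / (2 * (M + 1)) * (M + 1)).
      * apply Rmult_le_compat; try apply Cmod_ge_0; lra.
      * right. field. lra.
Qed.

Lemma dist_disc_ge (m : nat) (f g : C -> C) (z : C) :
  (2 <= m)%nat -> holomorphic_on unit_disc f -> holomorphic_on unit_disc g ->
  Cmod z <= 1 - 1 / INR m -> Cmod (f z - g z)%C <= dist_disc m f g.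
Proof.
  intros Hm Hf Hg Hz.
  destruct (holomorphic_bounded_unit (fun_sub f g) (1 - 1 / INR m)) as [M [HM HM']].
  { now apply fun_sub_holomorphic. }
  { now apply inv_m_bounds. }
  unfold dist_disc.
  apply (sup_over_spec (fun z : C => Cmod z <= 1 - 1 / INR m)
           (fun z => Cmod (f z - g z)%C) z M Hz HM'). exact Hz.
Qed.

Lemma exists_radius_index (rho : R) : rho < 1 ->
  exists m, (2 <= m)%nat /\ rho <= 1 - 1 / INR m.
Proof.
  intros H. destruct (nfloor_ex (/ (1 - rho))) as [n [_ Hn]].
  { left. apply Rinv_0_lt_compat. lra. }
  exists (S (S n)). split; [lia|].
  assert (H0 : 0 < / (1 - rho)) by (apply Rinv_0_lt_compat; lra).
  assert (/ INR (S (S n)) <= / / (1 - rho)).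
  { apply Rinv_le_contravar; auto. rewrite !S_INR. lra. }
  rewrite Rinv_inv in H1. lra.
Qed.

Lemma dist_Hp_ge0 (p : R) (J : closed_arc) (f g : C -> C) :
  0 < p -> holomorphic_on unit_disc f -> holomorphic_on unit_disc g ->
  0 <= dist_Hp p J f g.
Proof. intros Hp Hf Hg. apply sum_dist_ge0. intros m _. now apply dist_m_ge0. Qed.

Lemma dist_Hp_control (p : R) (J : closed_arc) (rho e : R) :
  0 < p -> rho < 1 -> 0 < e ->
  exists r, 0 < r /\ forall f g, holomorphic_on unit_disc f -> holomorphic_on unit_disc g ->
    dist_Hp p J f g < r -> forall z, Cmod z <= rho -> Cmod (f z - g z)%C < e.
Proof.
  intros Hp0 Hrho He. destruct (exists_radius_index rho Hrho) as [m [Hm Hrm]].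
  destruct (sum_dist_control m e ltac:(lia) He) as [r [Hr H]].
  exists r. split; auto. intros f g Hf Hg Hd z Hz.
  eapply Rle_lt_trans; [apply (dist_disc_ge m f g z); auto; lra|].
  specialize (H (fun m => dist_m m p J f g)). unfold dist_m in H.
  destruct (Nat.eqb_spec m 1); [lia|]. apply H; auto.
  intros k _. now apply (dist_m_ge0 k p J f g).
Qed.

Lemma dist_Hp_perturb (p : R) (J : closed_arc) (f h : C -> C) (e : R) :
  0 < p -> holomorphic_on unit_disc f -> in_all_Hp h -> 0 < e ->
  exists r, 0 < r /\ forall c, 0 < c < r -> dist_Hp p J f (perturb f h c) < e.
Proof.
  intros Hp0 Hf Hh He.
  apply (sum_dist_cv0 (fun c m => dist_m m p J f (perturb f h c))); auto.
  - intros c m _. apply dist_m_ge0; auto. apply perturb_holomorphic; auto. apply Hh.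
  - intros m e' Hm He'. now apply dist_m_perturb.
Qed.

(** All that the two residual sets require of a space, so that single spaces and intersections are
    treated together from here on. *)
Record admissible (X : (C -> C) -> Prop) (d : (C -> C) -> (C -> C) -> R) : Prop := {
  adm_holomorphic : forall f, X f -> holomorphic_on unit_disc f;
  adm_control : forall rho e, rho < 1 -> 0 < e -> exists r, 0 < r /\
    forall f g, X f -> X g -> d f g < r ->
      forall z, Cmod z <= rho -> Cmod (f z - g z)%C < e;
  adm_perturb : forall f h c, X f -> in_all_Hp h -> X (perturb f h c);
  adm_cv : forall f h e, X f -> in_all_Hp h -> 0 < e -> exists r, 0 < r /\
    forall c, 0 < c < r -> d f (perturb f h c) < e
}.

Lemma hardy_admissible (X : (C -> C) -> Prop) (d : (C -> C) -> (C -> C) -> R) :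
  hardy_type_space X d -> admissible X d.
Proof.
  intros [p J Hp0|p J Hp0].
  - assert (Hol : forall f, Hp p J f -> holomorphic_on unit_disc f) by (intros f []; auto).
    split; auto.
    + intros rho e Hrho He.
      destruct (dist_Hp_control p J rho e Hp0 Hrho He) as [r [Hr H]].
      exists r. split; auto.
    + intros f h c Hf Hh. now apply Hp_perturb.
    + intros f h e Hf Hh He. apply dist_Hp_perturb; auto.
  - assert (Hol : forall f, Hp_inter p J f -> holomorphic_on unit_disc f).
    { intros f Hf. apply (Hf 1%nat (le_n _)). }
    split; auto.
    + intros rho e Hrho He.
      (* Each factor of the intersection controls locally uniform distance; the first one is
         used. *)
      destruct (dist_Hp_control (p 1%nat) (J 1%nat) rho e (Hp0 _ (le_n _)) Hrho He)
        as [r [Hr H]].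
      destruct (sum_dist_control 1 r (le_n _) Hr) as [r' [Hr' H']].
      exists r'. split; auto. intros f g Hf Hg Hd. apply H; auto.
      apply (H' (fun n => dist_Hp (p n) (J n) f g)); auto.
      intros m Hm. apply dist_Hp_ge0; auto.
    + intros f h c Hf Hh n Hn. apply Hp_perturb; auto.
    + intros f h e Hf Hh He.
      assert (Hsmall : forall m e', (1 <= m)%nat -> 0 < e' -> exists r, 0 < r /\
        forall c, 0 < c < r -> dist_Hp (p m) (J m) f (perturb f h c) < e').
      { intros m e' Hm He'. apply dist_Hp_perturb; auto. }
      apply (sum_dist_cv0 (fun c n => dist_Hp (p n) (J n) f (perturb f h c))); auto.
      intros c m Hm. apply dist_Hp_ge0; auto.
      apply perturb_holomorphic; auto. apply Hh.
Qed.

(** * The two residual sets *)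

Definition mesh (j : nat) : R := / INR (S j).

(** The index [i] is unbounded: the points simply run around the circle repeatedly. The index [j]
    fixes the scale, and below also the size of the bounds. *)
Definition net (i j : nat) : C := polar 1 (INR i * mesh j).

Lemma mesh_bounds (j : nat) : 0 < mesh j <= 1.
Proof.
  unfold mesh. assert (H : 1 <= INR (S j)) by (rewrite S_INR; generalize (pos_INR j); lra).
  split; [apply Rinv_0_lt_compat; lra|].
  rewrite <- Rinv_1. apply Rinv_le_contravar; lra.
Qed.

Lemma net_on_circle (i j : nat) : unit_circle (net i j).
Proof. unfold unit_circle, net. rewrite Cmod_polar. apply Rabs_pos_eq. lra. Qed.

Lemma net_dense (zeta : C) (e : R) : unit_circle zeta -> 0 < e ->
  exists i j, mesh j <= e /\ Cmod (net i j - zeta)%C <= 2 * mesh j.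
Proof.
  intros Hz He. destruct (unit_circle_polar zeta Hz) as [theta [Hth ->]].
  destruct (nfloor_ex (/ e)) as [j [_ Hj]]; [left; now apply Rinv_0_lt_compat|].
  assert (Hm := mesh_bounds j).
  destruct (nfloor_ex (theta * INR (S j))) as [i Hi].
  { apply Rmult_le_pos; auto. apply pos_INR. }
  exists i, j. split.
  - unfold mesh. rewrite <- (Rinv_inv e). apply Rinv_le_contravar.
    + now apply Rinv_0_lt_compat.
    + rewrite S_INR. lra.
  - unfold net. eapply Rle_trans; [apply polar_lipschitz; lra|].
    assert (E : theta * INR (S j) * mesh j = theta).
    { unfold mesh. field. apply not_0_INR. lia. }
    assert (Rabs (INR i * mesh j - theta) <= mesh j); [|lra].
    apply Rabs_le. rewrite <- E. split; nra.
Qed.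

Lemma totally_unbounded_iff (g : C -> C) : totally_unbounded g <-> nowhere_bounded g.
Proof.
  split.
  - intros H zeta e M Hz He.
    set (S := set_inter (disc zeta e) unit_disc).
    assert (HS : component S S).
    { apply convex_component; [|now apply circle_disc_meets].
      apply convex_inter; [apply convex_disc | apply convex_unit_disc]. }
    apply NNPP. intro Hn. apply (H zeta e Hz He S HS).
    exists M. intros z [H1 H2]. apply Rnot_lt_le. intro. apply Hn. now exists z.
  - intros H zeta e Hz He Y HY [M HM].
    destruct (H zeta e M Hz He) as [z [H1 [H2 H3]]].
    assert (Cmod (g z) <= M); [|lra].
    apply HM. apply (component_convex (set_inter (disc zeta e) unit_disc)); auto.
    + apply convex_inter; [apply convex_disc | apply convex_unit_disc].
    + now split.
Qed.

(** Small scale and large bound can share the index [j], since both are required for all [j]. *)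
Lemma nowhere_bounded_iff_net (g : C -> C) :
  nowhere_bounded g <-> forall i j, exists z,
    disc (net i j) (mesh j) z /\ unit_disc z /\ INR j < Cmod (g z).
Proof.
  split.
  - intros H i j. apply H; [apply net_on_circle | apply mesh_bounds].
  - intros H zeta e M Hz He.
    assert (HM : 0 < / (Rabs M + 2)) by (apply Rinv_0_lt_compat; generalize (Rabs_pos M); lra).
    (* The disc of the net lies within 3 * mesh j < e of [zeta], and j + 1 >= |M| + 2 gives j >
       M. *)
    destruct (net_dense zeta (Rmin (e / 4) (/ (Rabs M + 2))) Hz) as [i [j [Hj Hij]]].
    { apply Rmin_pos; lra. }
    assert (J1 := Rle_trans _ _ _ Hj (Rmin_l _ _)).
    assert (J2 := Rle_trans _ _ _ Hj (Rmin_r _ _)).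
    destruct (H i j) as [z [Hz1 [Hz2 Hz3]]]. exists z. split; [|split]; auto.
    + unfold disc in *. generalize (Cmod_triangle_minus z (net i j) zeta). lra.
    + unfold mesh in J2. apply Rinv_le_contravar in J2; [|apply mesh_bounds].
      rewrite !Rinv_inv, S_INR in J2. generalize (Rle_abs M). lra.
Qed.

Lemma lacunary_exists : exists h, in_all_Hp h /\ nowhere_bounded h.
Proof.
  destruct (power_series 0 (fun k => / INR (S k))%C (fun k => 3 ^ k)%nat 1 1)
    as [h [Hh Happ]].
  - lra.
  - intros k. apply Nat.lt_le_incl, Nat.pow_gt_lin_r. lia.
  - intros k. rewrite pow1, Rmult_1_r, <- RtoC_inv, Cmod_R by (apply not_0_INR; lia).
    assert (H := mesh_bounds k). unfold mesh in H. rewrite Rabs_pos_eq; lra.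
  - assert (Hh' : holomorphic_on unit_disc h).
    { intros z Hz. apply Hh. exact (proj1 (unit_disc_disc z) Hz). }
    assert (Happ' : forall z, unit_disc z -> forall K,
      Cmod (h z - Csum (fun k => / INR (S k) * z ^ (3 ^ k)) K)%C
      <= Cmod z ^ K / (1 - Cmod z)).
    { intros z Hz K.
      specialize (Happ z (proj1 (unit_disc_disc z) Hz) K). unfold term in Happ.
      replace (z - 0)%C with z in Happ by ring.
      unfold Rdiv in *. rewrite Rinv_1, !Rmult_1_r, Rmult_1_l in Happ. exact Happ. }
    exists h. split; [split; auto|].
    + intros p Hp. destruct (lacunary_integral h Happ' p Hp) as [B [HB H]].
      exists B. split; auto. intros J r Hr. apply H; auto.
      generalize (arc_lt J) (arc_le J). lra.
    + now apply lacunary_nowhere_bounded.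
Qed.

(** Each condition is a strict inequality at some point z, and nearby functions in the metric have
    nearby values at that point. *)
Lemma totally_unbounded_Gdelta (X : (C -> C) -> Prop) (d : (C -> C) -> (C -> C) -> R) :
  admissible X d -> Gdelta_in X d totally_unbounded.
Proof.
  intros HX.
  exists (fun n g => let (i, j) := of_nat n in exists z,
    disc (net i j) (mesh j) z /\ unit_disc z /\ INR j < Cmod (g z)).
  split.
  - intros n f Xf. destruct (of_nat n) as [i j]. intros [z [Hz1 [Hz2 Hz3]]].
    destruct (adm_control X d HX (Cmod z) (Cmod (f z) - INR j)) as [r [Hr H]]; auto; [lra|].
    exists r. split; auto. intros g Xg Hd. exists z. split; [|split]; auto.
    specialize (H f g Xf Xg Hd z (Rle_refl _)).
    generalize (Cmod_minus_ge (f z) (g z)). lra.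
  - intros f _. rewrite totally_unbounded_iff, nowhere_bounded_iff_net. split.
    + intros H n. destruct (of_nat n). apply H.
    + intros H i j. specialize (H (to_nat (i, j))). now rewrite cancel_of_to in H.
Qed.

(* On each disc of the net at most one multiple of [h] can make [f + c h] bounded,
   so that all but countably many [c] work. *)
Lemma totally_unbounded_dense (X : (C -> C) -> Prop) (d : (C -> C) -> (C -> C) -> R) :
  admissible X d -> dense_in X d totally_unbounded.
Proof.
  intros HX f Xf e He. destruct lacunary_exists as [h [Hh Hub]].
  destruct (adm_cv X d HX f h e Xf Hh He) as [r [Hr Hd]].
  set (bad := fun n c => let (i, j) := of_nat n in exists M, forall z,
    disc (net i j) (mesh j) z -> unit_disc z -> Cmod (perturb f h c z) <= M).
  assert (Hbad : forall n c c', bad n c -> bad n c' -> c = c').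
  { intros n c c'. unfold bad. destruct (of_nat n) as [i j]. intros [M HM] [M' HM'].
    apply NNPP. intro Hne.
    assert (Hc : 0 < Rabs (c - c')) by (apply Rabs_pos_lt; lra).
    destruct (Hub (net i j) (mesh j) ((M + M') / Rabs (c - c'))) as [z [H1 [H2 H3]]];
      [apply net_on_circle | apply mesh_bounds|].
    specialize (HM z H1 H2). specialize (HM' z H1 H2).
    assert (E : (perturb f h c z - perturb f h c' z = (c - c') * h z)%C)
      by (unfold perturb; ring).
    assert (T : Cmod ((c - c') * h z)%C <= M + M').
    { rewrite <- E. eapply Rle_trans; [apply Cmod_triangle|]. rewrite Cmod_opp. lra. }
    rewrite Cmod_mult, <- RtoC_minus, Cmod_R in T.
    apply (Rmult_lt_compat_l (Rabs (c - c'))) in H3; auto.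
    replace (Rabs (c - c') * ((M + M') / Rabs (c - c'))) with (M + M') in H3
      by (field; lra).
    lra. }
  (* [u n] is the only bad multiple for the disc number n; 0 is a dummy value when there is none. *)
  set (u := fun n => match excluded_middle_informative (exists c, bad n c) with
    | left H => proj1_sig (constructive_indefinite_description _ H)
    | right _ => 0 end).
  destruct (interval_uncountable u 0 r Hr) as [c [Hc Hcu]].
  exists (perturb f h c). split; [now apply (adm_perturb X d HX)|]. split; [|auto].
  apply totally_unbounded_iff. intros zeta e' M Hz He'.
  apply NNPP. intro Hn.
  destruct (net_dense zeta (e' / 4) Hz) as [i [j [Hj Hij]]]; [lra|].
  apply (Hcu (to_nat (i, j))).
  assert (Hb : bad (to_nat (i, j)) c).
  { unfold bad. rewrite cancel_of_to. exists M. intros z Hz1 Hz2.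
    apply Rnot_lt_le. intro. apply Hn. exists z. split; [|split]; auto.
    unfold disc in *. generalize (Cmod_triangle_minus z (net i j) zeta).
    generalize (mesh_bounds j). lra. }
  unfold u. destruct (excluded_middle_informative _) as [H|H].
  - destruct (constructive_indefinite_description _ H) as [c' Hc']. simpl.
    now apply (Hbad (to_nat (i, j))).
  - exfalso. apply H. now exists c.
Qed.

(** * Extendability and Taylor coefficients *)

Lemma extension_bounded (zeta : C) (e : R) (F : C -> C) :
  0 < e -> holomorphic_on (disc zeta e) F ->
  exists M, 0 <= M /\ forall z, Cmod (z - zeta)%C <= e / 2 -> Cmod (F z) <= M.
Proof. intros He HF. apply (holomorphic_bounded F zeta (e / 2) e HF). lra. Qed.

(** An extension is bounded on a smaller disc about the boundary point. This carries density over
    from totally unbounded to non-extendable functions. *)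
Lemma nowhere_bounded_non_extendable (f : C -> C) :
  holomorphic_on unit_disc f -> nowhere_bounded f -> non_extendable f.
Proof.
  intros Hf Hn. split; auto. intro Hext.
  apply extendable_iff_disc in Hext. destruct Hext as [zeta [e [F [Hz [He [HF HfF]]]]]].
  destruct (extension_bounded zeta e F He HF) as [M [_ HM]].
  destruct (Hn zeta (e / 2) M Hz) as [z [H1 [H2 H3]]]; [lra|].
  unfold disc in *. rewrite HfF in H3 by (auto; lra).
  assert (Cmod (F z) <= M); [|lra]. apply HM. lra.
Qed.

Lemma coef_minus (f g : C -> C) (a : C) (r R0 : R) (k : nat) :
  holomorphic_on (disc a R0) f -> holomorphic_on (disc a R0) g -> 0 <= r < R0 ->
  coef (fun_sub f g) a r k = (coef f a r k - coef g a r k)%C.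
Proof.
  intros Hf Hg Hr. unfold coef, fun_sub. assert (HPI := PI_RGT_0).
  rewrite (CInt_ext _ (fun t =>
    f (a + polar r t) * polar ((/ r) ^ k) (- (INR k * t)) -
    g (a + polar r t) * polar ((/ r) ^ k) (- (INR k * t))))%C; [|lra|intros; ring].
  rewrite CInt_minus; [ring|lra| |]; intros t _;
    (apply ccont_mult; [|apply ccont_polar_neg]);
    [now apply (ccont_polar_disc f a r R0) | now apply (ccont_polar_disc g a r R0)].
Qed.

(** The disc of radius [mesh j] about this point is tangent to the circle from inside at [net i j];
    for j = 0 it is the unit disc. *)
Definition tangent_center (i j : nat) : C := polar (1 - mesh j) (INR i * mesh j).

Lemma tangent_center_dist (i j : nat) :
  Cmod (tangent_center i j - net i j)%C = mesh j.
Proof.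
  unfold tangent_center, net. assert (H := mesh_bounds j).
  replace (polar (1 - mesh j) (INR i * mesh j) - polar 1 (INR i * mesh j))%C with
    (polar (- mesh j) (INR i * mesh j))
    by (unfold polar, Cminus, Cplus, Copp; simpl; f_equal; ring).
  rewrite Cmod_polar, Rabs_Ropp. apply Rabs_pos_eq. lra.
Qed.

Lemma tangent_disc (i j : nat) (r : R) (z : C) :
  Cmod (z - tangent_center i j)%C <= r -> Cmod z <= 1 - mesh j + r.
Proof.
  intros H. assert (Hm := mesh_bounds j).
  assert (T := Cmod_minus_ge z (tangent_center i j)).
  unfold tangent_center in T at 1. rewrite Cmod_polar, Rabs_pos_eq in T; lra.
Qed.

Lemma tangent_disc_sub (i j : nat) (z : C) :
  disc (tangent_center i j) (mesh j) z -> unit_disc z.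
Proof.
  unfold disc, unit_disc. intros H.
  generalize (tangent_disc i j _ z (Rle_refl _)). lra.
Qed.

(* The condition says that the Taylor series of [f] at the centre of the disc
   violates the Cauchy estimates of a function bounded by [(j + 1) / 2] on the
   disc of twice the radius, which goes beyond the circle. *)
Definition large_coef (i j : nat) (f : C -> C) : Prop :=
  exists k, INR (S j) < Cmod (coef f (tangent_center i j) (mesh j / 2) k) * (2 * mesh j) ^ k.

(** The Taylor series converges on the disc of radius 2 * mesh j about the centre, which contains
    the disc of radius mesh j about [net i j]. Its sum equals f near the centre, hence on the convex
    intersection with the unit disc by the identity theorem. *)
Lemma small_coef_extendable (i j : nat) (f : C -> C) :
  holomorphic_on unit_disc f -> ~ large_coef i j f -> extendable f.
Proof.
  intros Hf Hn. assert (Hm := mesh_bounds j).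
  set (a := tangent_center i j). set (c := coef f a (mesh j / 2)).
  destruct (power_series a c (fun k => k) (2 * mesh j) (INR (S j))) as [F [HF Happ]];
    [lra|auto| |].
  { intros k. apply Rnot_lt_le. intro. apply Hn. now exists k. }
  assert (Hfa : holomorphic_on (disc a (mesh j)) f).
  { intros z Hz. now apply Hf, (tangent_disc_sub i j). }
  destruct (circle_bounded f a (mesh j / 2) (mesh j) Hfa) as [M [HM0 HM]]; [lra|].
  (* f and F are approximated by the same partial sums, and both remainders tend to 0. *)
  assert (Hnear : forall z, disc a (mesh j / 2) z -> fun_sub f F z = 0).
  { intros z Hz. unfold fun_sub. unfold disc in Hz.
    assert (Hz0 := Cmod_ge_0 (z - a)%C).
    assert (Hz2 : Cmod (z - a)%C < 2 * mesh j) by lra.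
    assert (Hq1 : 0 <= Cmod (z - a)%C / (mesh j / 2) < 1)
      by (apply (ratio_bounds (mesh j / 2)); lra).
    assert (Hq2 : 0 <= Cmod (z - a)%C / (2 * mesh j) < 1)
      by (apply (ratio_bounds (2 * mesh j)); lra).
    apply Cmod_le_0. intros e He.
    set (K1 := 2 * (M * (mesh j / 2 / (mesh j / 2 - Cmod (z - a)%C)))).
    set (K2 := INR (S j) / (1 - Cmod (z - a)%C / (2 * mesh j))).
    destruct (pow_small K1 _ (e / 2) Hq1) as [n1 [H1 _]]; [lra|].
    destruct (pow_small K2 _ (e / 2) Hq2) as [n2 [H2 _]]; [lra|].
    assert (HK1 : 0 <= K1).
    { unfold K1. apply Rmult_le_pos; [lra|]. apply Rmult_le_pos; auto.
      left. apply Rdiv_lt_0_compat; lra. }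
    assert (HK2 : 0 <= K2).
    { unfold K2. apply Rmult_le_pos; [apply pos_INR|].
      left. apply Rinv_0_lt_compat. lra. }
    set (n := (n1 + n2)%nat).
    assert (P1 := pow_antitone _ n1 n Hq1 ltac:(unfold n; lia)).
    assert (P2 := pow_antitone _ n2 n Hq2 ltac:(unfold n; lia)).
    apply (Rmult_le_compat_l K1) in P1; auto. apply (Rmult_le_compat_l K2) in P2; auto.
    assert (T := taylor a z (mesh j / 2) ltac:(lra) Hz f (mesh j) M n Hfa ltac:(lra) HM).
    fold K1 c in T.
    specialize (Happ z Hz2 n). unfold term in Happ.
    replace (f z - F z)%C with
      ((f z - Csum (fun k => c k * (z - a) ^ k) n) -
       (F z - Csum (fun k => c k * (z - a) ^ k) n))%C by ring.
    eapply Rle_trans; [apply Cmod_triangle|]. rewrite Cmod_opp.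
    unfold K2, Rdiv in *. lra. }
  set (S := set_inter (disc a (2 * mesh j)) unit_disc).
  assert (HS : forall z, S z -> fun_sub f F z = 0).
  { apply (holomorphic_zero_convex S (fun_sub f F) a (mesh j / 2)); auto; try lra.
    - apply open_set_inter; [apply open_disc | apply open_unit_disc].
    - apply convex_inter; [apply convex_disc | apply convex_unit_disc].
    - apply fun_sub_holomorphic; intros z [H1 H2]; auto.
    - split; [apply disc_center; lra|].
      apply (tangent_disc_sub i j), disc_center. lra. }
  apply extendable_iff_disc. exists (net i j), (mesh j), F.
  split; [apply net_on_circle|]. split; [lra|].
  assert (Hsub : forall z, disc (net i j) (mesh j) z -> disc a (2 * mesh j) z).
  { intros z Hz. unfold disc in *.
    assert (D := tangent_center_dist i j). rewrite Cmod_minus_sym in D. fold a in D.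
    generalize (Cmod_triangle_minus z (net i j) a). lra. }
  split.
  - intros z Hz. auto.
  - intros z Hz Hd. apply Ceq_minus. apply (HS z). split; auto.
Qed.

(** The coefficients of f are those of F, because the small circle lies where both agree. For F they
    can be computed on the circle of radius 2 * mesh j, where the Cauchy estimate bounds them. *)
Lemma extendable_small_coef (f : C -> C) :
  extendable f -> exists i j, ~ large_coef i j f.
Proof.
  intros Hext. apply extendable_iff_disc in Hext.
  destruct Hext as [zeta [e [F [Hz [He [HF HfF]]]]]].
  destruct (extension_bounded zeta e F He HF) as [M [HM0 HM]].
  (* The large circle stays within 5 * mesh j <= e / 2 of [zeta], where |F| <= M, and j + 1 >= 2 * M
     + 1 exceeds the Cauchy bound 2 * M. *)
  destruct (net_dense zeta (Rmin (e / 16) (/ (2 * M + 1))) Hz) as [i [j [Hj Hij]]].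
  { apply Rmin_pos; [lra|]. apply Rinv_0_lt_compat. lra. }
  assert (J1 := Rle_trans _ _ _ Hj (Rmin_l _ _)).
  assert (J2 := Rle_trans _ _ _ Hj (Rmin_r _ _)).
  assert (Hm := mesh_bounds j).
  exists i, j. intros [k Hk]. revert Hk. apply Rle_not_lt.
  set (a := tangent_center i j).
  assert (Ha : Cmod (a - zeta)%C <= 3 * mesh j).
  { eapply Rle_trans; [apply (Cmod_triangle_minus a (net i j))|].
    unfold a. rewrite tangent_center_dist. lra. }
  assert (Hnear : forall z r, Cmod (z - a)%C <= r -> Cmod (z - zeta)%C <= r + 3 * mesh j).
  { intros z r Hr. generalize (Cmod_triangle_minus z a zeta). lra. }
  assert (HFa : holomorphic_on (disc a (3 * mesh j)) F).
  { intros z Hd. apply HF. unfold disc in *.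
    generalize (Hnear z _ (Rle_refl _)). lra. }
  rewrite (coef_ext f F).
  - rewrite <- (coef_radius F a (3 * mesh j) (2 * mesh j)); auto; try lra.
    apply Rle_trans with (2 * M).
    + apply (coef_le F a (3 * mesh j) (2 * mesh j) M k HFa); [lra|].
      intros t _. apply HM.
      assert (Cmod (a + polar (2 * mesh j) t - a)%C <= 2 * mesh j).
      { replace (a + polar (2 * mesh j) t - a)%C with (polar (2 * mesh j) t) by ring.
        rewrite Cmod_polar, Rabs_pos_eq; lra. }
      generalize (Hnear _ _ H). lra.
    + unfold mesh in J2. apply Rinv_le_contravar in J2; [|apply mesh_bounds].
      rewrite !Rinv_inv in J2. lra.
  - lra.
  - intros z E. apply HfF.
    + unfold disc. generalize (Hnear z _ (Req_le _ _ E)). lra.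
    + apply (tangent_disc_sub i j). unfold disc. fold a. lra.
Qed.

(** A single coefficient of index k witnesses the condition, and it depends continuously on the
    values of f on a circle inside |z| <= 1 - rho. *)
Lemma large_coef_open (X : (C -> C) -> Prop) (d : (C -> C) -> (C -> C) -> R) (i j : nat) :
  admissible X d -> open_in X d (large_coef i j).
Proof.
  intros HX f Xf [k Hk]. assert (Hm := mesh_bounds j).
  set (a := tangent_center i j) in *. set (rho := mesh j / 2) in *.
  assert (Hrho : 0 < rho < mesh j) by (unfold rho; lra).
  (* [q] converts the weight rho^k of the Cauchy estimate into (2 * mesh j)^k. With gap / (4 * q)
     the weighted coefficient changes by at most gap / 2. *)
  set (q := (2 * mesh j / rho) ^ k).
  assert (Hq : 0 < q) by (apply pow_lt, Rdiv_lt_0_compat; lra).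
  assert (Hqk : (2 * mesh j) ^ k = q * rho ^ k).
  { unfold q. rewrite <- Rpow_mult_distr. f_equal. field. lra. }
  set (gap := Cmod (coef f a rho k) * (2 * mesh j) ^ k - INR (S j)).
  assert (Hgap : 0 < gap) by (unfold gap; lra).
  destruct (adm_control X d HX (1 - rho) (gap / (4 * q))) as [r [Hr H]];
    [lra|apply Rdiv_lt_0_compat; lra|].
  exists r. split; auto. intros g Xg Hd. exists k. fold a rho.
  assert (Hf : holomorphic_on (disc a (mesh j)) f).
  { intros z Hz. apply (adm_holomorphic X d HX f Xf), (tangent_disc_sub i j), Hz. }
  assert (Hg : holomorphic_on (disc a (mesh j)) g).
  { intros z Hz. apply (adm_holomorphic X d HX g Xg), (tangent_disc_sub i j), Hz. }
  assert (B : Cmod (coef (fun_sub f g) a rho k) * rho ^ k <= 2 * (gap / (4 * q))).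
  { apply (coef_le (fun_sub f g) a (mesh j)); auto.
    - now apply fun_sub_holomorphic.
    - intros t _. left. apply (H f g Xf Xg Hd).
      replace (1 - rho) with (1 - mesh j + rho) by (unfold rho; field).
      apply (tangent_disc i j). fold a.
      replace (a + polar rho t - a)%C with (polar rho t) by ring.
      rewrite Cmod_polar, Rabs_pos_eq; lra. }
  rewrite (coef_minus f g a rho (mesh j)) in B by (auto; lra).
  assert (T := Cmod_minus_ge (coef f a rho k) (coef g a rho k)).
  apply (Rmult_le_compat_l q) in B; [|lra].
  replace (q * (2 * (gap / (4 * q)))) with (gap / 2) in B by (field; lra).
  assert (P : 0 < (2 * mesh j) ^ k) by (apply pow_lt; lra).
  apply (Rmult_le_compat_r ((2 * mesh j) ^ k)) in T; [|lra].
  replace (q * (Cmod (coef f a rho k - coef g a rho k)%C * rho ^ k)) with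
    (Cmod (coef f a rho k - coef g a rho k)%C * (2 * mesh j) ^ k) in B
    by (rewrite Hqk; ring).
  unfold gap in *. lra.
Qed.

Lemma non_extendable_Gdelta (X : (C -> C) -> Prop) (d : (C -> C) -> (C -> C) -> R) :
  admissible X d -> Gdelta_in X d non_extendable.
Proof.
  intros HX. exists (fun n => let (i, j) := of_nat n in large_coef i j). split.
  - intros n. destruct (of_nat n) as [i j]. now apply large_coef_open.
  - intros f Xf. assert (Hf := adm_holomorphic X d HX f Xf). split.
    + intros [_ Hne] n. destruct (of_nat n) as [i j].
      apply NNPP. intro Hn. now apply Hne, (small_coef_extendable i j).
    + intros H. split; auto. intro Hext.
      destruct (extendable_small_coef f Hext) as [i [j Hn]].
      specialize (H (to_nat (i, j))). now rewrite cancel_of_to in H.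
Qed.

Theorem theorem6p1 :
  forall (X : (C -> C) -> Prop) (d : (C -> C) -> (C -> C) -> R),
    hardy_type_space X d ->
    (Gdelta_in X d totally_unbounded /\ dense_in X d totally_unbounded) /\
    (Gdelta_in X d non_extendable /\ dense_in X d non_extendable).
Proof.
  intros X d H. apply hardy_admissible in H. split; split.
  - now apply totally_unbounded_Gdelta.
  - now apply totally_unbounded_dense.
  - now apply non_extendable_Gdelta.
  - intros f Xf e He.
    destruct (totally_unbounded_dense X d H f Xf e He) as [g [Xg [Hg Hd]]].
    exists g. split; [|split]; auto. apply nowhere_bounded_non_extendable.
    + now apply (adm_holomorphic X d H).
    + now apply totally_unbounded_iff.
Qed.
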